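(* Let $m_1,\dots,m_n$ be different elements of $\mathfrak M_{\mathrm{erg}}(\Omega,\sigma)$ with $n\ge2$. Take $r\ge1$ and $\epsilon>0$ with $$\epsilon<\epsilon_1=\frac{n+2r(n-1)-2\sqrt{r(n-1)\left(r(n-1)+n\right)}}{n^2}$$ (so that $0<\epsilon<1/n$). Let $c_1,\dots,c_n:\Omega\to[0,1]$ be continuous functions with $\min_\Omega c_i=0$, $\max_\Omega c_i=1$, $c_ic_j\equiv0$ for $i\ne j$, and $$1-\epsilon<\int_\Omega c_i\,dm_i\le1,\qquad 0\le\int_\Omega c_i\,dm_j<\epsilon\quad\text{for all } i,j\in\{1,\dots,n\},\ i\ne j.$$ Take constants $\alpha_1\le\alpha_2\le\dots\le\alpha_n$ with $\alpha_1<0$ and $\alpha_n>0$, and define $a_1=\sum_{i=1}^n\alpha_ic_i$, so that $\alpha_1\le a_1(\omega)\le\alpha_n$ for all $\omega\in\Omega$. Then $a_1$ has band spectrum $\mathrm{sp}(a_1)=[-\lambda_+,-\lambda_-]\subset(\alpha_1,\alpha_n)$ (with $\lambda_-<\lambda_+$) and $$(\lambda_+-\lambda_-)^2+4r(\lambda_++\alpha_1)(\lambda_++\alpha_n)>0.$$ Consequently, if $a_3\in C(\Omega)$ takes values in $[r_1,r_2]$ for $r_1>0$ and $r_2=rr_1$, and if $a_2\in C(\Omega)$ satisfies $$2\sqrt{r_2(-\lambda_+-\alpha_1)}<a_2(\omega)<\frac{(\lambda_+-\lambda_-)\sqrt{r_1}}{\sqrt{\lambda_++\alpha_n}}\quad\text{for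 all }\omega\in\Omega$$ $$\Bigl(\text{resp. }-\frac{(\lambda_+-\lambda_-)\sqrt{r_1}}{\sqrt{\lambda_++\alpha_n}}<a_2(\omega)<-2\sqrt{r_2(-\lambda_+-\alpha_1)}\quad\text{for all }\omega\in\Omega\Bigr),$$ then the $\lambda$-parametric family $x'=-a_3(\omega\cdot t)x^3+a_2(\omega\cdot t)x^2+(a_1(\omega\cdot t)+\lambda)x$, $\omega\in\Omega$, exhibits the generalized pitchfork bifurcation of minimal sets (that is, diagram $(\mathrm{GP}_\alpha)$ or $(\mathrm{GP}_\beta)$).
   Context: $\Omega$ is a compact metric space with a continuous flow $\sigma:\mathbb R\times\Omega\to\Omega$, $(t,\omega)\mapsto\omega\cdot t$, which is minimal (every orbit is dense). $\mathfrak M_{\mathrm{erg}}(\Omega,\sigma)$ is the set of $\sigma$-ergodic Borel probability measures. $C(\Omega)$ is the space of continuous real functions on $\Omega$. For $b\in C(\Omega)$, the family $x'=b(\omega\cdot t)x$ has exponential dichotomy over $\Omega$ if there are $k\ge1$, $\delta>0$ such that either $\exp\int_0^t b(\omega\cdot s)\,ds\le ke^{-\delta t}$ for all $\omega$, $t\ge0$, or $\exp\int_0^t b(\omega\cdot s)\,ds\le ke^{\delta t}$ for all $\omega$, $t\le0$. The Sacker and Sell spectrum of $a\in C(\Omega)$ is the set $\mathrm{sp}(a)$ of $\lambda\in\mathbb R$ such that $x'=(a(\omega\cdot t)-\lambda)x$ does not have exponential dichotomy over $\Omega$; it is a compact interval or a point. $a$ has band spectrum if $\mathrm{sp}(a)$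 is a nondegenerate interval. The cubic family with parameter $\lambda$ induces the local skewproduct flow $\tau_\lambda(t,\omega,x_0)=(\omega\cdot t,u_\lambda(t,\omega,x_0))$ on $\Omega\times\mathbb R$, where $u_\lambda(\cdot,\omega,x_0)$ is the maximal solution with value $x_0$ at $t=0$. An equilibrium is a map $\beta:\Omega\to\mathbb R$ with $\beta(\omega\cdot t)=u_\lambda(t,\omega,\beta(\omega))$ for all $\omega,t$. A minimal set is a nonempty compact $\tau_\lambda$-invariant set containing properly no other such set; $\mathcal M_0=\Omega\times\{0\}$ is minimal for all $\lambda$. $\mathcal K_1<\mathcal K_2$ means $x_1<x_2$ whenever $(\omega,x_1)\in\mathcal K_1$, $(\omega,x_2)\in\mathcal K_2$. A minimal set $\mathcal M$ is hyperbolic attractive if there are $\rho>0,k\ge1,\gamma>0$ such that if $(\omega,x_0)\in\mathcal M$ and $|x-x_0|<\rho$ then $u_\lambda(t,\omega,x)$ is defined and $|u_\lambda(t,\omega,x)-u_\lambda(t,\omega,x_0)|\le ke^{-\gamma t}|x-x_0|$ for all $t\ge0$; hyperbolic repulsive is the analogue as $t\to-\infty$; otherwise it is nonhyperbolic. $\tau_\lambda$ has a global attractor $\mathcal A_\lambda=\bigcup_{\omega}(\{\omega\}\times[\alpha_\lambda(\omega),\beta_\lambda(\omega)])$ (compact, invariant, attracting every bounded set as $t\to\infty$), with $\alpha_\lambda\le0\le\beta_\lambda$ semicontinuous equilibria. Families $\kappa^1_\lambda,\kappa^2_\lambda$ of equilibria collide as $\lambda\downarrow\lambda_*$ if $\lim(\kappa^1_\lambda(\omega)-\kappa^2_\lambda(\omega))=0$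 for all $\omega$ in a residual $\sigma$-invariant set. Generalized pitchfork diagram. $\mathcal M_0$ is hyperbolic attractive for $\lambda<\lambda_-$, nonhyperbolic for $\lambda\in[\lambda_-,\lambda_+]$, hyperbolic repulsive for $\lambda>\lambda_+$; for $\lambda>\lambda_+$ there are three minimal sets $\mathcal M^l_\lambda<\mathcal M_0<\mathcal M^u_\lambda$, with $\mathcal M^l_\lambda,\mathcal M^u_\lambda$ hyperbolic attractive and equal to the graphs of $\alpha_\lambda,\beta_\lambda$; and, in addition: $(\mathrm{GP}_\beta)$: $\lambda_-<\lambda_+$, $\beta_\lambda$ collides with $0$ as $\lambda\downarrow\lambda_+$, and there is $\lambda_0\in[\lambda_-,\lambda_+)$ such that $\mathcal M_0$ is the unique $\tau_\lambda$-minimal set for $\lambda<\lambda_0$, $\mathcal A_\lambda=\mathcal M_0$ for $\lambda<\lambda_-$, and for $\lambda\in(\lambda_0,\lambda_+]$ there are two minimal sets $\mathcal M^l_\lambda<\mathcal M_0$, with $\mathcal M^l_\lambda$ hyperbolic attractive and equal to the graph of $\alpha_\lambda$. $(\mathrm{GP}_\alpha)$: the same with $\alpha_\lambda$ and $\beta_\lambda$ exchanged and $\mathcal M^l_\lambda<\mathcal M_0$ replaced by $\mathcal M_0<\mathcal M^u_\lambda$ (with $\mathcal M^u_\lambda$ hyperbolic attractive and equal to the graph of $\beta_\lambda$). *)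

(* Defs.v *)
From HB Require Import structures.
From mathcomp Require Import all_boot all_order all_algebra.
From mathcomp Require Import all_classical all_reals all_analysis.

Set Implicit Arguments.
Unset Strict Implicit.
Unset Printing Implicit Defensive.
Import Order.TTheory GRing.Theory Num.Theory.
Import numFieldNormedType.Exports.

Local Open Scope classical_set_scope.
Local Open Scope ring_scope.

(* The generated sigma-algebras of the library live on pointed types; the base
   spaces considered here carry probability measures, so they are nonempty and
   asking for a distinguished point is no restriction. *)
#[short(type="pointedMetricType")]
HB.structure Definition PointedMetric (K : numDomainType) :=
  { M of Metric K M & Pointed M }.

Notation borel Omega := (g_sigma_algebraType (@open Omega)).

(** * The base flow *)

Section BaseFlow.
Context {R : realType} {Omega : pointedMetricType R}.
Implicit Types sigma : R -> Omega -> Omega.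

Record continuous_flow sigma : Prop := {
  flow_continuous : continuous (fun p : R * Omega => sigma p.1 p.2) ;
  flow0 : forall w, sigma 0 w = w ;
  flowD : forall s t w, sigma (s + t) w = sigma s (sigma t w) }.

Definition minimal_flow sigma : Prop :=
  forall w, dense [set sigma t w | t in [set: R]].

Definition invariant_base sigma (A : set Omega) : Prop :=
  forall t, sigma t @^-1` A = A.

Definition invariant_measure sigma (m : probability (borel Omega) R) : Prop :=
  forall t (A : set (borel Omega)), measurable A -> m (sigma t @^-1` A) = m A.

Definition ergodic_measure sigma (m : probability (borel Omega) R) : Prop :=
  invariant_measure sigma m /\
  forall A : set (borel Omega), measurable A -> invariant_base sigma A ->
    m A = 0%E \/ m A = 1%E.

(* Elements of [probability] are functions on all subsets of Omega, whose
   values outside the Borel sets are irrelevant. *)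
Definition distinct_measures (m m' : probability (borel Omega) R) : Prop :=
  exists2 A : set (borel Omega), measurable A & m A <> m' A.

Definition residual (A : set Omega) : Prop :=
  exists2 U : nat -> set Omega,
    (forall n, open (U n) /\ dense (U n)) & \bigcap_n U n `<=` A.

End BaseFlow.

(** * Exponential dichotomy and Sacker-Sell spectrum *)

Section Spectrum.
Context {R : realType} {Omega : pointedMetricType R}.
Context (sigma : R -> Omega -> Omega).

(* \int_0^t f, with the usual orientation when t < 0 *)
Definition int_from0 (f : R -> R) (t : R) : R :=
  if 0 <= t then \int[lebesgue_measure]_(s in `[0, t]) f s
  else - \int[lebesgue_measure]_(s in `[t, 0]) f s.

Definition exp_dichotomy (b : Omega -> R) : Prop :=
  exists k delta : R, [/\ 1 <= k, 0 < delta &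
    (forall w t, 0 <= t ->
       expR (int_from0 (fun s => b (sigma s w)) t) <= k * expR (- delta * t))
    \/
    (forall w t, t <= 0 ->
       expR (int_from0 (fun s => b (sigma s w)) t) <= k * expR (delta * t))].

Definition spectrum (a : Omega -> R) : set R :=
  [set l | ~ exp_dichotomy (fun w => a w - l)].

End Spectrum.

(** * The local skewproduct flow of x' = h(w.t, x) *)

Section Skewproduct.
Context {R : realType} {Omega : pointedMetricType R}.
Context (sigma : R -> Omega -> Omega) (h : Omega -> R -> R).
Implicit Types (K A B : set (Omega * R)) (al be : Omega -> R).

(* The values of u outside the interval I are irrelevant. *)
Record solution (w : Omega) (x0 : R) (I : set R) (u : R -> R) : Prop := {
  sol_open : open I ;
  sol_itv : is_interval I ;
  sol_dom0 : I 0 ;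
  sol_init : u 0 = x0 ;
  sol_ode : forall t, I t -> is_derive t (1 : R) u (h (sigma t w) (u t)) }.

Definition maximal_solution w x0 (I : set R) (u : R -> R) : Prop :=
  solution w x0 I u /\
  forall J v, solution w x0 J v -> I `<=` J -> {in I, v =1 u} -> J `<=` I.

(* [flow_at t w x0 y]: the maximal solution u(., w, x0) is defined at t and
   takes the value y there, that is, tau(t, w, x0) = (w.t, y). *)
Definition flow_at (t : R) (w : Omega) (x0 y : R) : Prop :=
  exists I u, [/\ maximal_solution w x0 I u, I t & u t = y].

Definition equilibrium (b : Omega -> R) : Prop :=
  forall w t, flow_at t w (b w) (b (sigma t w)).

Definition invariant_set K : Prop :=
  forall w x, K (w, x) -> forall t, exists2 y, flow_at t w x y & K (sigma t w, y).

Definition compact_invariant K : Prop :=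
  [/\ K !=set0, compact K & invariant_set K].

Definition minimal_set K : Prop :=
  compact_invariant K /\
  forall K', compact_invariant K' -> K' `<=` K -> K' = K.

Definition hyperbolic_attractive K : Prop :=
  exists rho k gamma : R, [/\ 0 < rho, 1 <= k, 0 < gamma &
    forall w x0 x, K (w, x0) -> `|x - x0| < rho -> forall t, 0 <= t ->
      exists y0 y, [/\ flow_at t w x0 y0, flow_at t w x y &
        `|y - y0| <= k * expR (- gamma * t) * `|x - x0|]].

Definition hyperbolic_repulsive K : Prop :=
  exists rho k gamma : R, [/\ 0 < rho, 1 <= k, 0 < gamma &
    forall w x0 x, K (w, x0) -> `|x - x0| < rho -> forall t, t <= 0 ->
      exists y0 y, [/\ flow_at t w x0 y0, flow_at t w x y &
        `|y - y0| <= k * expR (gamma * t) * `|x - x0|]].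

Definition nonhyperbolic K : Prop :=
  ~ hyperbolic_attractive K /\ ~ hyperbolic_repulsive K.

Definition bounded_in_ball B : Prop :=
  exists (p : Omega * R) (M : R), B `<=` ball p M.

Definition attracts A B : Prop :=
  forall e : R, 0 < e -> exists T : R, forall t, T <= t ->
    forall w x, B (w, x) ->
      exists2 y, flow_at t w x y & exists2 p, A p & ball p e (sigma t w, y).

Definition global_attractor A : Prop :=
  [/\ compact A, invariant_set A & forall B, bounded_in_ball B -> attracts A B].

Record attractor_with_bounds A al be : Prop := {
  attractor_global : global_attractor A ;
  attractor_fibers : A = [set p | al p.1 <= p.2 <= be p.1] ;
  attractor_le0 : forall w, al w <= 0 ;
  attractor_ge0 : forall w, 0 <= be w ;
  attractor_eq_lower : equilibrium al ;
  attractor_eq_upper : equilibrium be ;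
  attractor_lsc : lower_semicontinuous (fun w => (al w)%:E) ;
  attractor_usc : lower_semicontinuous (fun w => (- be w)%:E) }.

End Skewproduct.

(** * Generalized pitchfork bifurcation diagrams *)

Section Pitchfork.
Context {R : realType} {Omega : pointedMetricType R}.
Context (sigma : R -> Omega -> Omega).
Implicit Types (h : R -> Omega -> R -> R) (A : R -> set (Omega * R))
  (al be : R -> Omega -> R).

Definition graph_of (b : Omega -> R) : set (Omega * R) := [set p | p.2 = b p.1].

Definition M0 : set (Omega * R) := graph_of (fun _ => 0).

Definition set_below (K1 K2 : set (Omega * R)) : Prop :=
  forall w x1 x2, K1 (w, x1) -> K2 (w, x2) -> x1 < x2.

Definition collide_from_right (k1 k2 : R -> Omega -> R) (ls : R) : Prop :=
  exists D : set Omega, [/\ residual D, invariant_base sigma D &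
    forall w, D w -> (fun l => k1 l w - k2 l w) @ ls^'+ --> (0 : R)].

Definition minimal_sets (h : Omega -> R -> R) : set (set (Omega * R)) :=
  [set K | minimal_set sigma h K].

Record pitchfork_common h (lm lp : R) A al be : Prop := {
  pf_attractor : forall l, attractor_with_bounds sigma (h l) (A l) (al l) (be l) ;
  pf_minimal0 : forall l, minimal_set sigma (h l) M0 ;
  pf_attractive : forall l, l < lm -> hyperbolic_attractive sigma (h l) M0 ;
  pf_nonhyperbolic : forall l, lm <= l <= lp -> nonhyperbolic sigma (h l) M0 ;
  pf_repulsive : forall l, lp < l -> hyperbolic_repulsive sigma (h l) M0 ;
  pf_three : forall l, lp < l -> exists Ml Mu,
    [/\ minimal_sets (h l) = [set Ml; M0; Mu],
        set_below Ml M0 /\ set_below M0 Mu,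
        hyperbolic_attractive sigma (h l) Ml,
        hyperbolic_attractive sigma (h l) Mu &
        Ml = graph_of (al l) /\ Mu = graph_of (be l)] }.

Definition GP_beta h (lm lp : R) : Prop :=
  exists A al be, [/\ pitchfork_common h lm lp A al be,
    lm < lp,
    collide_from_right be (fun _ _ => 0) lp &
    exists l0, [/\ lm <= l0 < lp,
      forall l, l < l0 -> minimal_sets (h l) = [set M0],
      forall l, l < lm -> A l = M0 &
      forall l, l0 < l <= lp -> exists Ml,
        [/\ minimal_sets (h l) = [set Ml; M0], set_below Ml M0,
            hyperbolic_attractive sigma (h l) Ml & Ml = graph_of (al l)]]].

Definition GP_alpha h (lm lp : R) : Prop :=
  exists A al be, [/\ pitchfork_common h lm lp A al be,
    lm < lp,
    collide_from_right al (fun _ _ => 0) lp &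
    exists l0, [/\ lm <= l0 < lp,
      forall l, l < l0 -> minimal_sets (h l) = [set M0],
      forall l, l < lm -> A l = M0 &
      forall l, l0 < l <= lp -> exists Mu,
        [/\ minimal_sets (h l) = [set M0; Mu], set_below M0 Mu,
            hyperbolic_attractive sigma (h l) Mu & Mu = graph_of (be l)]]].

Definition generalized_pitchfork h (lm lp : R) : Prop :=
  GP_alpha h lm lp \/ GP_beta h lm lp.

Definition cubic_family (a1 a2 a3 : Omega -> R) (l : R) (w : Omega) (x : R) : R :=
  - a3 w * x ^+ 3 + a2 w * x ^+ 2 + (a1 w + l) * x.

End Pitchfork.

Arguments M0 {R Omega}.

Definition first_idx n (hn : (1 < n)%N) : 'I_n := Ordinal (ltnW hn).
Definition last_idx n (hn : (1 < n)%N) : 'I_n := rev_ord (first_idx hn).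

Definition epsilon1 {R : realType} (n : nat) (r : R) : R :=
  let N := n%:R in
  (N + 2 * r * (N - 1) - 2 * Num.sqrt (r * (N - 1) * (r * (N - 1) + N))) / N ^+ 2.

(* Main.v *)
(** Averages of [a1] against invariant measures lie between the extreme growth
    rates of [x' = a1 x] (Riemann sums along orbits), so the concentration of the
    [c i] separates the endpoints of the spectrum.

    For two solutions [x1], [x2] of the cubic equation, [D = 1/x1 - 1/x2] satisfies
    [D' = - (a1 + l + a3 x1 x2) D].  For [l >= lm] this makes the positive minimal
    set unique.  Let [upper l] be the upper boundary of the attractor.  If
    [upper mu] is bounded away from zero and [mu < l], the quotient of
    [1/upper l - 1/x] by [1/upper mu - 1/upper l] decays like [expR (- (l - mu) t)],
    so [upper l] is continuous and its graph is hyperbolic attractive.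

    A positive solution [v], bounded and bounded away from zero on a negative
    half-line, with [v'/v <= a1 + lp - eta] would give exponential dichotomy at the
    endpoint [- lp], because backward semiorbits are dense.  With the upper bound on
    [a2] this excludes positive solutions for [l < lm]; with [a2 <= 0] it excludes
    them for [l <= lp] and gives the collision at [lp].  The lower bound on [a2]
    makes a positive constant a lower solution for some [l < lp].  The negative
    half-line is the positive one for [- a2]. *)
Require Import Defs.
From mathcomp Require Import all_boot all_order all_algebra.
From mathcomp Require Import all_classical all_reals all_analysis.
From mathcomp Require Import ring lra.

Set Implicit Arguments.
Unset Strict Implicit.
Unset Printing Implicit Defensive.
Import Order.TTheory GRing.Theory Num.Theory.
Import numFieldNormedType.Exports.

Local Open Scope classical_set_scope.
Local Open Scope ring_scope.


(** * Calculus on the line *)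

(** The constants come from small optimizations. [epsilon1 n r] is the smaller root in [e] of
    [(1 - n e)^2 = 4 r (n - 1) e]: the mean values bound the length of the spectrum below by
    [(alphan - alpha1) (1 - n e)], while [- lp - alpha1 <= (n - 1) e (alphan - alpha1)]. The lower
    end of the window for [a2] is the minimum over [x > 0] of [r2 x + (- lp - alpha1) / x]; the
    upper end is [(lp - lm) / X], where [r1 X^2 = lp + alphan] and [X] bounds the upper boundary for
    [l <= lm]. With [r2 = r r1], the positive quantity in the statement says exactly that this
    window is nonempty. The obstacle is that the cubic flow is only local: solutions may explode
    backward, and [flow_at] speaks of maximal solutions. Estimates are therefore made for the
    equation with [x] clipped at a level [N], which is globally Lipschitz and has global solutions;
    they pass to the cubic equation wherever the solution stays within the level. Near zero and near
    another solution the variable [1 / x] is used, since there the equation is linear up to terms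
    that stay bounded along bounded solutions. *)

Section Derivation.
Context {R : realType}.
Implicit Types (f g P p D : R -> R) (s t a b c df dg K : R).

Lemma is_derive_addf f g t df dg : is_derive t (1 : R) f df ->
  is_derive t (1 : R) g dg -> is_derive t (1 : R) (fun s => f s + g s) (df + dg).
Proof. by move=> ? ?; exact: is_deriveD. Qed.

Lemma is_derive_oppf f t df : is_derive t (1 : R) f df ->
  is_derive t (1 : R) (fun s => - f s) (- df).
Proof. by move=> ?; exact: is_deriveN. Qed.

Lemma is_derive_subf f g t df dg : is_derive t (1 : R) f df ->
  is_derive t (1 : R) g dg -> is_derive t (1 : R) (fun s => f s - g s) (df - dg).
Proof. by move=> ? ?; exact: is_deriveB. Qed.

Lemma is_derive_mulf f g t df dg : is_derive t (1 : R) f df ->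
  is_derive t (1 : R) g dg ->
  is_derive t (1 : R) (fun s => f s * g s) (df * g t + f t * dg).
Proof.
move=> fd gd; have fgd : is_derive t (1 : R) (f * g) (f t *: dg + g t *: df).
  exact: is_deriveM.
by apply: is_derive_eq fgd _; rewrite /GRing.scale/= addrC (mulrC df).
Qed.

Lemma is_derive_cstf c t : is_derive t (1 : R) (fun=> c) (0 : R).
Proof. exact: is_derive_cst. Qed.

Lemma is_derive_idf t : is_derive t (1 : R) (fun s : R => s) (1 : R).
Proof. exact: is_derive_id. Qed.

Lemma is_derive_scalef c f t df : is_derive t (1 : R) f df ->
  is_derive t (1 : R) (fun s => c * f s) (c * df).
Proof.
move=> fd; apply: is_derive_eq (is_derive_mulf (is_derive_cstf c t) fd) _.
by rewrite mul0r add0r.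
Qed.

Lemma is_derive_invf f t df : f t != 0 -> is_derive t (1 : R) f df ->
  is_derive t (1 : R) (fun s => (f s)^-1) (- df / (f t) ^+ 2).
Proof.
move=> f0 [fex <-]; apply: DeriveDef; first exact: derivableV.
by rewrite deriveV // /GRing.scale/= mulNr mulrC -mulNr.
Qed.

Lemma is_derive_expf f t df : is_derive t (1 : R) f df ->
  is_derive t (1 : R) (fun s => expR (f s)) (df * expR (f t)).
Proof.
move=> fd; have efd := is_derive1_comp (is_derive_expR (f t)) fd.
by apply: is_derive_eq efd _; rewrite mulrC.
Qed.

Lemma is_derive_linear c t : is_derive t (1 : R) (fun s => c * s) c.
Proof.
by apply: is_derive_eq (is_derive_scalef c (is_derive_idf t)) _; rewrite mulr1.
Qed.

Lemma is_derive_translate f t df c : is_derive (t + c) (1 : R) f df ->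
  is_derive t (1 : R) (fun s => f (s + c)) df.
Proof.
move=> fd; have gd := is_derive_addf (is_derive_idf t) (is_derive_cstf c t).
have h := @is_derive1_comp _ f (fun s => s + c) t df _ fd gd.
by apply: is_derive_eq h _; rewrite addr0 mulr1.
Qed.

Lemma is_derive_reverse f t df : is_derive (- t) (1 : R) f df ->
  is_derive t (1 : R) (fun s => f (- s)) (- df).
Proof.
move=> fd; have gd := is_derive_oppf (is_derive_idf t).
have h := @is_derive1_comp _ f (fun s => - s) t df _ fd gd.
by apply: is_derive_eq h _; rewrite mulrN1.
Qed.

Lemma is_derive_continuous f t df :
  is_derive t (1 : R) f df -> {for t, continuous f}.
Proof.
by case=> fd _; apply: differentiable_continuous; exact/derivable1_diffP.
Qed.

Lemma derive_nondecreasing f f' a b : a <= b ->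
  (forall s, a <= s <= b -> is_derive s (1 : R) f (f' s)) ->
  (forall s, a <= s <= b -> 0 <= f' s) -> f a <= f b.
Proof.
move=> ab fd f0.
have fc : {within `[a, b], continuous f}.
  apply: derivable_within_continuous => s; rewrite in_itv/= => sab.
  by case: (fd s sab).
have [s|s sab fE] := @MVT_segment _ f f' a b ab _ fc.
  by rewrite in_itv/= => /andP[? ?]; apply: fd; rewrite !ltW.
by rewrite -subr_ge0 fE mulr_ge0 ?subr_ge0// f0//; rewrite in_itv/= in sab.
Qed.

Lemma derive_nonincreasing f f' a b : a <= b ->
  (forall s, a <= s <= b -> is_derive s (1 : R) f (f' s)) ->
  (forall s, a <= s <= b -> f' s <= 0) -> f b <= f a.
Proof.
move=> ab fd f0; rewrite -lerN2.
apply: (@derive_nondecreasing (fun s => - f s) (fun s => - f' s)) => //.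
  by move=> s /fd; exact: is_derive_oppf.
by move=> s /f0; rewrite oppr_ge0.
Qed.

(* No sign condition on [f]: both follow from the monotonicity of
   [f * expR (- P)]. *)
Lemma gronwall_ge f f' P p a b : a <= b ->
  (forall s, a <= s <= b -> is_derive s (1 : R) f (f' s)) ->
  (forall s, a <= s <= b -> is_derive s (1 : R) P (p s)) ->
  (forall s, a <= s <= b -> p s * f s <= f' s) ->
  f a * expR (P b - P a) <= f b.
Proof.
move=> ab fd Pd pf.
suff: f a * expR (- P a) <= f b * expR (- P b).
  move=> /(ler_wpM2r (expR_ge0 (P b))).
  by rewrite -!mulrA -!expRD addNr expR0 mulr1 addrC.
pose h' s := f' s * expR (- P s) + f s * (- p s * expR (- P s)).
apply: (@derive_nondecreasing (fun s => f s * expR (- P s)) h') => // s sab.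
  apply: is_derive_mulf; first exact: fd.
  by apply: is_derive_expf; apply: is_derive_oppf; exact: Pd.
by rewrite /h' mulrA -mulrDl mulr_ge0 ?expR_ge0// mulrN (mulrC (f s)) subr_ge0 pf.
Qed.

Lemma gronwall_le f f' P p a b : a <= b ->
  (forall s, a <= s <= b -> is_derive s (1 : R) f (f' s)) ->
  (forall s, a <= s <= b -> is_derive s (1 : R) P (p s)) ->
  (forall s, a <= s <= b -> f' s <= p s * f s) ->
  f b <= f a * expR (P b - P a).
Proof.
move=> ab fd Pd pf; rewrite -lerN2 -mulNr.
apply: (@gronwall_ge (fun s => - f s) (fun s => - f' s) P p) => // s sab.
  by apply: is_derive_oppf; exact: fd.
by rewrite mulrN lerN2 pf.
Qed.

Lemma gronwall_const_ge f f' K a b : a <= b ->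
  (forall s, a <= s <= b -> is_derive s (1 : R) f (f' s)) ->
  (forall s, a <= s <= b -> K * f s <= f' s) ->
  f a * expR (K * (b - a)) <= f b.
Proof.
move=> ab fd Kf; rewrite mulrBr.
apply: (@gronwall_ge f f' (fun s => K * s) (fun=> K)) => // s _.
exact: is_derive_linear.
Qed.

Lemma gronwall_const_le f f' K a b : a <= b ->
  (forall s, a <= s <= b -> is_derive s (1 : R) f (f' s)) ->
  (forall s, a <= s <= b -> f' s <= K * f s) ->
  f b <= f a * expR (K * (b - a)).
Proof.
move=> ab fd Kf; rewrite mulrBr.
apply: (@gronwall_le f f' (fun s => K * s) (fun=> K)) => // s _.
exact: is_derive_linear.
Qed.

(** The witness is the supremum of the times in [[a, b]] where [D] is nonnegative; continuity makes
    it one of them. *)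
Lemma last_nonneg D a b : a <= b -> 0 <= D a -> D b < 0 ->
  (forall s, a <= s <= b -> {for s, continuous D}) ->
  exists c, [/\ a <= c < b, 0 <= D c & forall s, c < s <= b -> D s < 0].
Proof.
move=> ab Da Db Dc.
pose Z := [set s | a <= s <= b /\ 0 <= D s].
have Z0 : Z !=set0 by exists a; split; rewrite ?lexx.
have Zub : ubound Z b by move=> s [/andP[]].
have supZ : has_sup Z by split => //; exists b.
have csb : a <= sup Z <= b.
  by rewrite (ub_le_sup supZ.2)/=; [exact: ge_sup|split; rewrite ?lexx].
have Dsup : 0 <= D (sup Z).
  rewrite leNgt; apply/negP => Dn.
  have : \forall s \near sup Z, D s < 0 by exact: (cvgr_lt _ (Dc _ csb)).
  move=> /nbhs_ballP[e /= e0 eD].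
  have [s Zs ss] := sup_adherent e0 supZ.
  have : D s < 0.
    apply: eD; rewrite /ball/= ger0_norm ?subr_ge0; first by rewrite ltrBlDr addrC -ltrBlDr.
    exact: (ub_le_sup supZ.2).
  by rewrite ltNge; case: Zs => _ ->.
exists (sup Z); split => //.
  case/andP: csb => -> /=; rewrite le_eqVlt => /orP[/eqP e|//].
  by rewrite e leNgt Db in Dsup.
move=> s /andP[cs sb]; rewrite ltNge; apply/negP => Ds.
have := cs; rewrite ltNge => /negP; apply; apply: (ub_le_sup supZ.2).
by split => //; rewrite sb andbT; case/andP: csb => asup _; rewrite (le_trans asup)// ltW.
Qed.

(** After the last time [c] with [0 <= D c], [D] is negative and the bound becomes a linear
    differential inequality; Gronwall then keeps [D] below the negative constant [eta] on []c, b]],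
    against continuity at [c]. *)
Lemma comparison D D' K a b : a <= b -> 0 <= D a ->
  (forall s, a <= s <= b -> is_derive s (1 : R) D (D' s)) ->
  (forall s, a <= s <= b -> - K * `|D s| <= D' s) -> 0 <= D b.
Proof.
move=> ab Da Dd DK; rewrite leNgt; apply/negP => Db.
have Dc s : a <= s <= b -> {for s, continuous D}.
  by move=> /Dd; exact: is_derive_continuous.
have [c [/andP[ac cb] D0 Dn]] := last_nonneg ab Da Db Dc.
pose eta := D b * expR (- `|K| * (b - a)).
have eta0 : eta < 0 by rewrite pmulr_llt0 ?expR_gt0.
have : \forall s \near c, eta < D s.
  by apply: (cvgr_gt _ (Dc _ _)); rewrite ?ac ?ltW// (lt_le_trans eta0).
move=> /nbhs_ballP[e /= e0 eD].
pose s := Num.min b (c + e / 2).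
have sb : s <= b by rewrite ge_min lexx.
have cs : c < s by rewrite lt_min cb ltrDl divr_gt0.
have := eD s; rewrite ltNge /ball/= => /(_ _)/negP; apply.
  rewrite ltr0_norm ?subr_lt0// opprB ltrBlDl (@le_lt_trans _ _ (c + e / 2))//.
    by rewrite ge_min lexx orbT.
  by rewrite ltrD2l ltr_pdivrMr// ltr_pMr// ltr1n.
have Dsb : D s * expR (`|K| * (b - s)) <= D b.
  apply: (@gronwall_const_ge D D') => // u /andP[su ub].
    by apply: Dd; rewrite ub andbT (le_trans ac)// ltW// (lt_le_trans cs).
  apply: le_trans (DK u _); last first.
    by rewrite ub andbT (le_trans ac)// ltW// (lt_le_trans cs).
  have Du : D u < 0 by apply: Dn; rewrite ub andbT (lt_le_trans cs).
  by rewrite (ltr0_norm Du) mulrNN ler_wnM2r ?ler_norm// ltW.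
have := ler_wpM2r (expR_ge0 (- (`|K| * (b - s)))) Dsb.
rewrite -mulrA -expRD subrr expR0 mulr1 => /le_trans; apply.
rewrite /eta ler_wnM2l ?(ltW Db)// ler_expR mulNr lerN2 ler_wpM2l// lerB//.
by rewrite (le_trans ac)// ltW.
Qed.

Lemma derive_eq0_segment D D' K a b : a <= b -> D a = 0 ->
  (forall s, a <= s <= b -> is_derive s (1 : R) D (D' s)) ->
  (forall s, a <= s <= b -> `|D' s| <= K * `|D s|) -> D b = 0.
Proof.
move=> ab Da Dd DK; apply/eqP; rewrite eq_le.
have Db : 0 <= D b.
  apply: (@comparison D D' K a b) => // [|s sab]; first by rewrite Da.
  by rewrite mulNr lerNl (le_trans _ (DK _ sab))// -normrN ler_norm.
have : 0 <= - D b.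
  apply: (@comparison (fun s => - D s) (fun s => - D' s) K a b) => // [|s sab|s sab].
  - by rewrite Da oppr0.
  - exact: is_derive_oppf (Dd _ sab).
  - by rewrite normrN mulNr lerN2 (le_trans _ (DK _ sab))// ler_norm.
by rewrite oppr_ge0 => ->.
Qed.

Lemma derive_eq0_segmentN D D' K a b : a <= b -> D b = 0 ->
  (forall s, a <= s <= b -> is_derive s (1 : R) D (D' s)) ->
  (forall s, a <= s <= b -> `|D' s| <= K * `|D s|) -> D a = 0.
Proof.
move=> ab Db Dd DK; rewrite -[a]opprK.
apply: (@derive_eq0_segment (fun s => D (- s)) (fun s => - D' (- s)) K (- b) (- a)).
- by rewrite lerN2.
- by rewrite opprK.
- move=> s /andP[bs sa]; apply: is_derive_reverse; apply: Dd.
  by rewrite lerNr sa lerNl bs.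
- move=> s /andP[bs sa]; rewrite normrN; apply: DK.
  by rewrite lerNr sa lerNl bs.
Qed.

Lemma derive_eq0_between D D' K t : D 0 = 0 ->
  (forall s, Num.min 0 t <= s <= Num.max 0 t -> is_derive s (1 : R) D (D' s)) ->
  (forall s, Num.min 0 t <= s <= Num.max 0 t -> `|D' s| <= K * `|D s|) -> D t = 0.
Proof.
move=> D0; have [t0|t0] := leP 0 t => Dd DK.
  exact: (derive_eq0_segment t0 D0 Dd DK).
exact: (derive_eq0_segmentN (ltW t0) D0 Dd DK).
Qed.

End Derivation.

(** * Primitives of continuous functions *)

Section Primitive.
Context {R : realType}.
Implicit Types (f : R -> R) (t : R).

Lemma int_from00 f : int_from0 f 0 = 0.
Proof. by rewrite /int_from0 lexx set_itv1 Rintegral_set1. Qed.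

Lemma continuous_integrable_itv f (a b : R) : continuous f ->
  lebesgue_measure.-integrable `[a, b] (EFin \o f).
Proof.
move=> fc; apply: continuous_compact_integrable; first exact: segment_compact.
exact: continuous_subspaceT.
Qed.

Lemma continuous_Rintegral_sub f (a b c : R) : continuous f -> a <= b <= c ->
  \int[lebesgue_measure]_(s in `[a, c]) f s
    - \int[lebesgue_measure]_(s in `[a, b]) f s
  = \int[lebesgue_measure]_(s in `[b, c]) f s.
Proof.
move=> fc /andP[ab bc]; rewrite Rintegral_itvB ?bnd_simp//; last first.
  exact: continuous_integrable_itv.
rewrite Rintegral_itv_obnd_cbnd//.
apply: integrableS (continuous_integrable_itv b c fc) => //.
exact: subset_itv_oc_cc.
Qed.

Lemma int_from0_Rintegral f (L t : R) : continuous f -> L <= 0 -> L <= t ->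
  int_from0 f t = \int[lebesgue_measure]_(s in `[L, t]) f s
    - \int[lebesgue_measure]_(s in `[L, 0]) f s.
Proof.
move=> fc L0 Lt; rewrite /int_from0; case: ifPn => [t0|].
  by rewrite continuous_Rintegral_sub// L0.
by rewrite -ltNge => t0; rewrite -[RHS]opprB continuous_Rintegral_sub// Lt ltW.
Qed.

Lemma is_derive_int_from0 f t : continuous f ->
  is_derive t (1 : R) (int_from0 f) (f t).
Proof.
(* [L] lies to the left of both 0 and [t], so near [t] both branches of [int_from0] are the
   difference of two integrals starting at [L]. *)
move=> fc; pose L : R := - `|t| - 1.
have L0 : L < 0 by rewrite /L; have := normr_ge0 t; lra.
have Lt : L < t by rewrite /L; have := ler_norm (- t); rewrite normrN; lra.
pose F (x : R) := \int[lebesgue_measure]_(s in `[L, x]) f s.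
have [Fd Fe] := continuous_FTC1_closed (ltr_pwDr ltr01 (lexx t))
  (continuous_integrable_itv L (t + 1) fc) Lt (fc t).
have FD : is_derive t (1 : R) F (f t).
  by apply: DeriveDef => //; rewrite -derive1E.
apply: (@near_eq_is_derive _ _ _ (fun x => F x - F 0)).
  near=> x; rewrite (int_from0_Rintegral fc (ltW L0))// ltW//.
  near: x; exact: lt_nbhsr.
by apply: is_derive_eq (is_derive_subf FD (is_derive_cstf _ t)) _; rewrite subr0.
Unshelve. all: by end_near. Qed.

End Primitive.

(** * Global solutions of globally Lipschitz equations *)

Section Picard.
Context {R : realType}.

Lemma primitive_exp_bound_ge0 (F f : R -> R) (M c t : R) : 0 < c -> 0 <= t ->
  F 0 = 0 -> (forall s, is_derive s (1 : R) F (f s)) ->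
  (forall s, `|f s| <= M * expR (c * `|s|)) ->
  F t <= M / c * expR (c * t).
Proof.
move=> c0 t0 F0 Fd fM.
have M0 : 0 <= M.
  by have := fM 0; rewrite normr0 mulr0 expR0 mulr1; apply: le_trans.
suff : 0 <= M / c * expR (c * t) - F t by rewrite subr_ge0.
have : 0 <= M / c * expR (c * 0) - F 0.
  by rewrite F0 subr0 mulr0 expR0 mulr1 divr_ge0// ltW.
move/le_trans; apply.
apply: (@derive_nondecreasing _ (fun s => M / c * expR (c * s) - F s)
  (fun s => M / c * (c * expR (c * s)) - f s)) => // s /andP[s0 _].
  apply: is_derive_subf => //; apply: is_derive_scalef.
  by apply: is_derive_expf; exact: is_derive_linear.
rewrite mulrA divfK ?gt_eqF// subr_ge0.
by rewrite (le_trans (ler_norm _))// (le_trans (fM s))// ger0_norm.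
Qed.

(** Against the weight [exp (c |t|)], integration gains a factor [1 / c]: this is the weighted norm
    in which the Picard map contracts on the whole line at once. *)
Lemma primitive_exp_bound (F f : R -> R) (M c t : R) : 0 < c -> F 0 = 0 ->
  (forall s, is_derive s (1 : R) F (f s)) ->
  (forall s, `|f s| <= M * expR (c * `|s|)) ->
  `|F t| <= M / c * expR (c * `|t|).
Proof.
move=> c0 F0 Fd fM.
wlog t0 : F f t F0 Fd fM / 0 <= t.
  move=> wlg; have [|t0] := leP 0 t; first exact: wlg.
  have := wlg (fun s => F (- s)) (fun s => - f (- s)) (- t).
  rewrite opprK normrN; apply; rewrite ?oppr0 ?oppr_ge0 ?ltW//.
    by move=> s; exact: is_derive_reverse (Fd (- s)).
  by move=> s; rewrite normrN -[`|s|]normrN; exact: fM.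
rewrite (ger0_norm t0) ler_norml lerNl; apply/andP; split.
  apply: (@primitive_exp_bound_ge0 (fun s => - F s) (fun s => - f s)) => //.
  - by rewrite F0 oppr0.
  - by move=> s; rewrite normrN.
exact: (@primitive_exp_bound_ge0 F f).
Qed.

Lemma halving_small (C e : R) : 0 < e -> exists n, C / 2 ^+ n < e.
Proof.
move=> e0; exists (Num.bound (C / e)).
by rewrite ltr_pdivrMr ?exprn_gt0// mulrC -ltr_pdivrMr// upper_nthrootP.
Qed.

(** [q n] is the sum of all steps still allowed from [n] on, so [x n - q n] increases, [x n + q n]
    decreases, and the supremum of the former lies between them. *)
Lemma halving_limit (x : nat -> R) (C : R) :
  (forall n, `|x n.+1 - x n| <= C / 2 ^+ n) ->
  exists l, forall n, `|l - x n| <= 2 * C / 2 ^+ n.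
Proof.
move=> xC; pose q n := 2 * C / 2 ^+ n.
have qS n : q n.+1 = q n - C / 2 ^+ n.
  by rewrite /q exprS; field; rewrite expf_neq0.
have q0 n : 0 <= q n.
  by rewrite /q -mulrA mulr_ge0// (le_trans _ (xC n)).
have lowS : {homo (fun n => x n - q n) : m n / (m <= n)%N >-> m <= n}.
  apply: homo_leq => [//|? ? ?|n]; first exact: le_trans.
  by have := xC n; rewrite qS ler_norml => /andP[]; lra.
have upS : {homo (fun n => - (x n + q n)) : m n / (m <= n)%N >-> m <= n}.
  apply: homo_leq => [//|? ? ?|n]; first exact: le_trans.
  by have := xC n; rewrite qS ler_norml => /andP[]; lra.
have lowup m n : x m - q m <= x n + q n.
  have := lowS _ _ (leq_maxl m n); have := upS _ _ (leq_maxr m n).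
  by have := q0 (maxn m n); lra.
pose A := range (fun n => x n - q n).
have supA : has_sup A.
  split; first by exists (x 0%N - q 0%N); exists 0%N.
  by exists (x 0%N + q 0%N) => _ [n _ <-].
exists (sup A) => n; rewrite ler_norml; apply/andP; split.
  suff : x n - q n <= sup A by rewrite /q; lra.
  by apply: (ub_le_sup supA.2); exists n.
suff : sup A <= x n + q n by rewrite /q; lra.
by apply: ge_sup => [|_ [m _ <-]]; [exact: supA.1|].
Qed.

Variables (g : R -> R -> R) (K x0 : R).
Hypotheses (K_gt0 : 0 < K)
  (g_lip : forall t x y, `|g t x - g t y| <= K * `|x - y|)
  (g_eq0 : forall t, g t 0 = 0)
  (g_cont : forall x, continuous (fun t => g t x)).

Lemma continuous_along (u : R -> R) :
  continuous u -> continuous (fun t => g t (u t)).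
Proof.
move=> uc t; apply/cvgrPdist_lt => e e0; near=> s.
rewrite (_ : _ - _ = (g t (u t) - g s (u t)) + (g s (u t) - g s (u s))); last by ring.
rewrite (le_lt_trans (ler_normD _ _))// (splitr e) ltr_leD//.
  by near: s; apply: cvgr_dist_lt; [exact: g_cont|rewrite divr_gt0].
rewrite (le_trans (g_lip _ _ _))// mulrC -ler_pdivlMr// ltW//.
by near: s; apply: cvgr_dist_lt; [exact: uc|rewrite !divr_gt0].
Unshelve. all: by end_near. Qed.

Fixpoint picard n : R -> R :=
  if n is n'.+1 then fun t => x0 + int_from0 (fun s => g s (picard n' s)) t
  else fun=> x0.

Lemma continuous_picard n : continuous (picard n).
Proof.
elim: n => [|n IHn] t; first exact: cvg_cst.
exact: is_derive_continuous (is_derive_addf (is_derive_cstf x0 t)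
  (is_derive_int_from0 t (continuous_along IHn))).
Qed.

Lemma is_derive_int_along (u : R -> R) t : continuous u ->
  is_derive t (1 : R) (int_from0 (fun s => g s (u s))) (g t (u t)).
Proof. by move=> uc; apply: is_derive_int_from0; exact: continuous_along. Qed.

(** The weight exponent is twice the Lipschitz constant, which makes one Picard step halve the
    weighted distance. *)
Lemma int_along_sub (u v : R -> R) (C t : R) : continuous u -> continuous v ->
  (forall s, `|u s - v s| <= C * expR (2 * K * `|s|)) ->
  `|int_from0 (fun s => g s (u s)) t - int_from0 (fun s => g s (v s)) t|
    <= C / 2 * expR (2 * K * `|t|).
Proof.
move=> uc vc uv; have -> : C / 2 = K * C / (2 * K) by field; rewrite gt_eqF.
apply: (@primitive_exp_bound (fun t => int_from0 (fun s => g s (u s)) t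
    - int_from0 (fun s => g s (v s)) t) (fun s => g s (u s) - g s (v s))).
- by rewrite mulr_gt0.
- by rewrite !int_from00 subrr.
- by move=> s; apply: is_derive_subf; exact: is_derive_int_along.
- by move=> s; rewrite (le_trans (g_lip _ _ _))// -mulrA ler_wpM2l// ltW.
Qed.

Lemma picard_step n t :
  `|picard n.+1 t - picard n t| <= `|x0| * expR (2 * K * `|t|) / 2 ^+ n.
Proof.
elim: n t => [|n IHn] t.
  rewrite expr0 divr1 [picard 1 t]/= addrAC subrr add0r.
  have K2 : 0 < 2 * K by rewrite mulr_gt0.
  apply: le_trans (_ : K * `|x0| / (2 * K) * expR (2 * K * `|t|) <= _).
    apply: (@primitive_exp_bound _ (fun s => g s x0)) => //.
    - exact: int_from00.
    - by move=> s; apply: (@is_derive_int_along (fun=> x0)) => u; exact: cvg_cst.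
    - move=> s; have := g_lip s x0 0; rewrite g_eq0 !subr0 => /le_trans; apply.
      rewrite ler_peMr ?mulr_ge0 ?(ltW K_gt0)//.
      by rewrite (le_trans _ (expR_ge1Dx _))// lerDl mulr_ge0// ltW.
  rewrite ler_wpM2r ?expR_ge0// (_ : _ / _ = `|x0| / 2); last by field; rewrite gt_eqF.
  by rewrite ler_pdivrMr// ler_peMr// ler1n.
rewrite (_ : picard n.+2 t - _ = int_from0 (fun s => g s (picard n.+1 s)) t
    - int_from0 (fun s => g s (picard n s)) t); last by rewrite /=; ring.
have := @int_along_sub (picard n.+1) (picard n) (`|x0| / 2 ^+ n) t
  (@continuous_picard n.+1) (@continuous_picard n).
rewrite exprS (_ : `|x0| * _ / _ = `|x0| / 2 ^+ n / 2 * expR (2 * K * `|t|)).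
  by apply => s; rewrite mulrAC; exact: IHn.
by field; rewrite expf_neq0.
Qed.

(** The iterates converge pointwise, and the weighted bound is uniform on bounded intervals; so the
    limit is continuous and the integral equation passes to the limit. *)
Lemma picard_lindelof : exists u : R -> R,
  u 0 = x0 /\ forall t, is_derive t (1 : R) u (g t (u t)).
Proof.
pose C (t : R) : R := `|x0| * expR (2 * K * `|t|).
have /choice[u uE] : forall t, exists l, forall n,
    `|l - picard n t| <= 2 * C t / 2 ^+ n.
  by move=> t; apply: halving_limit => n; exact: picard_step.
have uc : continuous u.
  move=> t; apply/cvgrPdist_lt => e e0.
  pose C1 := 2 * (`|x0| * expR (2 * K * (`|t| + 1))).
  have [n nC] := @halving_small C1 (e / 3) (divr_gt0 e0 (ltr0n _ 3)).
  have Cs s : `|s| <= `|t| + 1 -> `|u s - picard n s| < e / 3.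
    move=> st; rewrite (le_lt_trans _ nC)// (le_trans (uE _ _))//.
    rewrite ler_pM2r ?invr_gt0 ?exprn_gt0// ler_pM2l// ler_wpM2l// ler_expR.
    by rewrite ler_pM2l// mulr_gt0.
  near=> s.
  rewrite (_ : _ - _ = (u t - picard n t) + (picard n t - picard n s)
    + (picard n s - u s)); last by ring.
  rewrite (le_lt_trans (ler_normD _ _))// (_ : e = e / 3 + e / 3 + e / 3); last by field.
  apply: ltrD; last first.
    rewrite distrC Cs//. rewrite -lerBlDl (le_trans (lerB_dist _ _))// distrC.
  rewrite (le_lt_trans (ler_normD _ _))// ltrD//.
    by rewrite Cs// lerDl.
  near: s; apply: cvgr_dist_lt; first exact: continuous_picard.
  by rewrite divr_gt0.
have ueq t : u t = x0 + int_from0 (fun s => g s (u s)) t.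
  apply/eqP; rewrite -subr_eq0 -normr_le0 leNgt; apply/negP => d0.
  have [n nC] := @halving_small (3 * C t) _ d0.
  have := @int_along_sub u (picard n) (2 * `|x0| / 2 ^+ n) t uc
    (@continuous_picard n).
  have un s : `|u s - picard n s| <= 2 * `|x0| / 2 ^+ n * expR (2 * K * `|s|).
    by rewrite (le_trans (uE s n))// /C; rewrite [leLHS](_ : _ = 2 * `|x0| / 2 ^+ n * expR (2 * K * `|s|))//; ring.
  move=> /(_ un); have := uE t n.+1; rewrite [picard _ _]/= => h1 h2.
  move: nC; rewrite ltNge => /negP; apply.
  rewrite (_ : u t - _ = (u t - (x0 + int_from0 (fun s => g s (picard n s)) t))
    - (int_from0 (fun s => g s (u s)) t
       - int_from0 (fun s => g s (picard n s)) t)); last by ring.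
  rewrite (le_trans (ler_normB _ _))//.
  rewrite (_ : 3 * C t / 2 ^+ n = C t / 2 ^+ n + 2 * C t / 2 ^+ n); last by ring.
  apply: lerD; first apply: le_trans h1 _; last apply: le_trans h2 _.
    by rewrite exprS le_eqVlt (_ : _ / _ = C t / 2 ^+ n) ?eqxx//; field; rewrite expf_neq0.
  rewrite (_ : _ * expR _ = C t / 2 ^+ n); last by rewrite /C; field; rewrite expf_neq0.
  by rewrite -mulrA ler_peMl ?ler1n// mulr_ge0 ?invr_ge0 ?exprn_ge0// mulr_ge0 ?expR_ge0.
exists u; split=> [|t]; first by rewrite ueq int_from00 addr0.
have := is_derive_addf (is_derive_cstf x0 t) (is_derive_int_along t uc).
by rewrite add0r; congr is_derive; apply/funext => s; rewrite -ueq.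
Unshelve. all: by end_near. Qed.

End Picard.

(** * Minimal flows on compact spaces *)

Record compact_minimal_flow {R : realType} {Omega : pointedMetricType R}
    (sigma : R -> Omega -> Omega) : Prop := {
  base_compact : compact [set: Omega] ;
  base_flow : continuous_flow sigma ;
  base_minimal : minimal_flow sigma }.

Section BaseTools.
Context {R : realType} {Omega : pointedMetricType R}.
Variable sigma : R -> Omega -> Omega.
Hypothesis base : compact_minimal_flow sigma.
Implicit Types (f b : Omega -> R) (w : Omega) (t s T : R).

Let sigma0 := flow0 (base_flow base).
Let sigmaD := flowD (base_flow base).

Lemma sigmaK t w : sigma (- t) (sigma t w) = w.
Proof. by rewrite -sigmaD addNr sigma0. Qed.

Lemma sigmaNK t w : sigma t (sigma (- t) w) = w.
Proof. by rewrite -sigmaD subrr sigma0. Qed.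

Lemma continuous_flow_pair t w :
  {for (t, w), continuous (fun p : R * Omega => sigma p.1 p.2)}.
Proof. exact: flow_continuous (base_flow base) (t, w). Qed.

Lemma continuous_flow_along f t w : continuous f ->
  {for (t, w), continuous (fun p : R * Omega => f (sigma p.1 p.2))}.
Proof.
move=> fc; exact: (@continuous_comp _ _ _ (fun p : R * Omega => sigma p.1 p.2)
  f (t, w) (@continuous_flow_pair t w) (fc _)).
Qed.

Lemma continuous_orbit w : continuous (fun t => sigma t w).
Proof.
move=> t; apply: (@continuous_comp _ _ _ (fun t => (t, w))
  (fun p : R * Omega => sigma p.1 p.2)); last exact: continuous_flow_pair.
exact: (cvg_pair cvg_id (cvg_cst w)).
Qed.

Lemma continuous_time_map t : continuous (sigma t).
Proof.
move=> w; apply: (@continuous_comp _ _ _ (fun w => (t, w))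
  (fun p : R * Omega => sigma p.1 p.2)); last exact: continuous_flow_pair.
exact: (cvg_pair (cvg_cst t) cvg_id).
Qed.

Lemma continuous_on_orbit f w : continuous f -> continuous (fun s => f (sigma s w)).
Proof.
move=> fc t; apply: continuous_comp; [exact: continuous_orbit|exact: fc].
Qed.

Lemma continuous_attains_min f : continuous f -> exists w0, forall w, f w0 <= f w.
Proof.
move=> fc.
have Omega0 : [set: Omega] !=set0 by exists point.
have [w0 _ fw0] := compact_EVT_min Omega0 (base_compact base)
  (continuous_subspaceT fc).
by exists w0 => w; apply: fw0; rewrite inE.
Qed.

Lemma continuous_bounded f : continuous f -> exists2 B, 0 < B & forall w, `|f w| <= B.
Proof.
move=> fc; have [|w0 fw0] := @continuous_attains_min (fun w => - `|f w|).
  by move=> w; apply: cvgN; apply: cvg_norm; exact: fc.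
by exists (`|f w0| + 1) => [|w]; [rewrite ltr_wpDl|have := fw0 w; lra].
Qed.

Lemma continuous_lt_gap f (c : R) : continuous f -> (forall w, c < f w) ->
  exists2 e, 0 < e & forall w, c + e <= f w.
Proof.
move=> fc cf; have [w0 fw0] := continuous_attains_min fc.
by exists (f w0 - c) => [|w]; [rewrite subr_gt0|rewrite addrC subrK].
Qed.

(** Compactness of [[- T, T]] makes the neighbourhood of [w] independent of [s]; the difference is
    continuous in both variables and vanishes at [w]. *)
Lemma near_along_flow f w T (e : R) : continuous f -> 0 < e ->
  \forall w' \near w, forall s, `|s| <= T -> `|f (sigma s w') - f (sigma s w)| < e.
Proof.
move=> fc e0.
have cov := (compact_near_coveringP _).1 (@segment_compact R (- T) T).
suff : \forall w' \near w,
    `[- T, T] `<=` (fun s => `|f (sigma s w') - f (sigma s w)| < e).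
  by apply: filterS => w' ww' s sT; apply: ww'; rewrite /= in_itv/= -ler_norml.
apply: cov => s _.
pose G (p : R * Omega) := f (sigma p.1 p.2) - f (sigma p.1 w).
have Gc : {for (s, w), continuous G}.
  apply: cvgB; first exact: continuous_flow_along.
  apply: (@continuous_comp _ _ _ fst (fun s => f (sigma s w))); first exact: cvg_fst.
  exact: continuous_on_orbit.
have : \forall p \near (s, w), `|G (s, w) - G p| < e.
  exact: (cvgr_dist_lt G (G (s, w)) Gc e e0).
have -> : G (s, w) = 0 by rewrite /G subrr.
by apply: filterS => -[s' w'] /=; rewrite sub0r normrN.
Qed.

(** The covering argument with the roles exchanged: compactness of the base makes the time step [h]
    independent of [w]. *)
Lemma uniform_small_time f (e : R) : continuous f -> 0 < e ->
  exists2 h, 0 < h & forall w s, `|s| <= h -> `|f (sigma s w) - f w| < e.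
Proof.
move=> fc e0.
have cov := (compact_near_coveringP _).1 (base_compact base).
have : \forall s \near (0 : R),
    [set: Omega] `<=` [set w | `|f (sigma s w) - f w| < e].
  apply: (cov _ (nbhs (0 : R)) (fun s w => `|f (sigma s w) - f w| < e)) => w _.
  pose G (p : R * Omega) := f (sigma p.1 p.2) - f p.2.
  have Gc : {for (0, w), continuous G}.
    apply: cvgB; first exact: continuous_flow_along.
    apply: (@continuous_comp _ _ _ snd f); first exact: cvg_snd.
    exact: fc.
  have : \forall p \near ((0 : R), w), `|G (0, w) - G p| < e.
    exact: (cvgr_dist_lt G (G (0, w)) Gc e e0).
  have -> : G (0, w) = 0 by rewrite /G sigma0 subrr.
  move=> [[P Q] [/= P0 Qw] PQ]; exists (Q, P) => //= -[w' s] [/= Qw' Ps].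
  by have := PQ (s, w') (conj Ps Qw'); rewrite /= sub0r normrN.
move=> /nbhs_ballP[d /= d0 dA].
exists (d / 2) => [|w s sd]; first by rewrite divr_gt0.
apply: (dA s) => //; rewrite /ball/= sub0r normrN (le_lt_trans sd)//.
by rewrite ltr_pdivrMr// ltr_pMr// ltr1n.
Qed.

(** Minimality supplies a hitting time of either sign and compactness bounds it by [T1]; following
    the orbit of [sigma T1 w] instead shifts [[- T1, T1]] to [[0, 2 T1]]. Minimality is mostly used
    in this form, as forward recurrence with a uniform delay. *)
Lemma visits (U : set Omega) : open U -> U !=set0 ->
  exists2 T, 0 <= T & forall w, exists2 t, 0 <= t <= T & U (sigma t w).
Proof.
move=> oU U0.
have cov := (compact_near_coveringP _).1 (base_compact base).
have : \forall T \near +oo,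
    [set: Omega] `<=` [set w | exists2 t, `|t| <= T & U (sigma t w)].
  apply: (cov _ (+oo : set_system R)
    (fun T w => exists2 t, `|t| <= T & U (sigma t w))) => w _.
  have [v [Ut [t _ tv]]] := base_minimal base w U0 oU; rewrite -tv in Ut.
  have Nw : \forall w' \near w, U (sigma t w').
    by apply: (@continuous_time_map t w U); exact: open_nbhs_nbhs.
  have NT : \forall T \near +oo, `|t| <= T by exact: nbhs_pinfty_ge.
  exists ([set w' | U (sigma t w')], [set T | `|t| <= T]) => //= -[w' T] [/= Uw' tT].
  by exists t.
move=> [T [_ TA]].
pose T1 := Num.max (T + 1) 0; exists (2 * T1) => [|w].
  by rewrite mulr_ge0// le_max lexx orbT.
have [|t tT Ut] := TA T1 _ (sigma T1 w) I.
  by rewrite lt_max ltrDl ltr01.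
exists (t + T1); last by rewrite sigmaD.
by move: tT; rewrite ler_norml; lra.
Qed.

Definition orbit_int b w t := int_from0 (fun s => b (sigma s w)) t.

Lemma orbit_int0 b w : orbit_int b w 0 = 0.
Proof. exact: int_from00. Qed.

Lemma is_derive_orbit_int b w t : continuous b ->
  is_derive t (1 : R) (orbit_int b w) (b (sigma t w)).
Proof. by move=> bc; apply: is_derive_int_from0; exact: continuous_on_orbit. Qed.

Lemma orbit_int_uniq b w (F : R -> R) t : continuous b -> F 0 = 0 ->
  (forall s, is_derive s (1 : R) F (b (sigma s w))) -> orbit_int b w t = F t.
Proof.
move=> bc F0 Fd; apply/eqP; rewrite -subr_eq0; apply/eqP.
apply: (@derive_eq0_between _ (fun t => orbit_int b w t - F t) (fun=> 0) 0).
- by rewrite orbit_int0 F0 subrr.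
- move=> s _; rewrite -[X in is_derive _ _ _ X](subrr (b (sigma s w))).
  by apply: is_derive_subf => //; exact: is_derive_orbit_int.
- by move=> s _; rewrite normr0 mul0r.
Qed.

Lemma orbit_intD b w s t : continuous b ->
  orbit_int b w (s + t) = orbit_int b w s + orbit_int b (sigma s w) t.
Proof.
move=> bc.
suff -> : orbit_int b (sigma s w) t = orbit_int b w (s + t) - orbit_int b w s.
  by rewrite [RHS]addrC subrK.
apply: (@orbit_int_uniq b (sigma s w)
  (fun t => orbit_int b w (s + t) - orbit_int b w s)) => //.
  by rewrite addr0 subrr.
move=> u; rewrite -[X in is_derive _ _ _ X]subr0; apply: is_derive_subf => //.
have := is_derive_translate (is_derive_orbit_int w (u + s) bc).
rewrite sigmaD; congr is_derive; apply/funext => v; by rewrite addrC.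
Qed.

Lemma orbit_intN b w t : continuous b -> orbit_int b w (- t) = - orbit_int b (sigma (- t) w) t.
Proof.
move=> bc; have := orbit_intD w (- t) t bc.
by rewrite addNr orbit_int0 => /eqP; rewrite eq_sym addr_eq0 => /eqP.
Qed.

Lemma orbit_int_le b b' w t : continuous b -> continuous b' ->
  (forall w, b w <= b' w) -> 0 <= t -> orbit_int b w t <= orbit_int b' w t.
Proof.
move=> bc bc' bb t0; rewrite -subr_ge0.
have -> : 0 = orbit_int b' w 0 - orbit_int b w 0 by rewrite !orbit_int0 subrr.
apply: (@derive_nondecreasing _ (fun t => orbit_int b' w t - orbit_int b w t)
  (fun s => b' (sigma s w) - b (sigma s w))) => // s _.
  by apply: is_derive_subf; exact: is_derive_orbit_int.
by rewrite subr_ge0.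
Qed.

Lemma orbit_int_opp b w t : continuous b ->
  orbit_int (fun w => - b w) w t = - orbit_int b w t.
Proof.
move=> bc; apply: (@orbit_int_uniq _ _ (fun t => - orbit_int b w t)).
- by move=> v; apply: cvgN; exact: bc.
- by rewrite orbit_int0 oppr0.
- by move=> s; apply: is_derive_oppf; exact: is_derive_orbit_int.
Qed.

Lemma continuous_addc b (c : R) : continuous b -> continuous (fun w => b w + c).
Proof. by move=> bc w; apply: cvgD; [exact: bc|exact: cvg_cst]. Qed.

Lemma continuous_oppf b : continuous b -> continuous (fun w => - b w).
Proof. by move=> bc w; apply: cvgN; exact: bc. Qed.

Lemma orbit_int_addc b (c : R) w t : continuous b ->
  orbit_int (fun w => b w + c) w t = orbit_int b w t + c * t.
Proof.
move=> bc; apply: (@orbit_int_uniq _ _ (fun t => orbit_int b w t + c * t)).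
- exact: continuous_addc.
- by rewrite orbit_int0 mulr0 addr0.
- by move=> s; apply: is_derive_addf; [exact: is_derive_orbit_int|exact: is_derive_linear].
Qed.

Lemma near_orbit_int b w T (e : R) : continuous b -> 0 < e -> 0 <= T ->
  \forall w' \near w, orbit_int b w' T < orbit_int b w T + e.
Proof.
move=> bc e0 T0; pose d := e / (T + 1).
have d0 : 0 < d by rewrite divr_gt0// ltr_wpDl.
have := @near_along_flow b w T d bc d0; apply: filterS => w' ww'.
rewrite -ltrBlDl; apply: (@le_lt_trans _ _ (d * T)); last first.
  rewrite /d mulrAC ltr_pdivrMr ?ltr_wpDl// ltr_pM2l//; lra.
have -> : orbit_int b w' T - orbit_int b w T
  = d * T - ((d * T - (orbit_int b w' T - orbit_int b w T))
     - (d * 0 - (orbit_int b w' 0 - orbit_int b w 0))).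
  by rewrite !orbit_int0; ring.
rewrite gerBl subr_ge0.
apply: (@derive_nondecreasing _ (fun s => d * s - (orbit_int b w' s - orbit_int b w s))
  (fun s => d - (b (sigma s w') - b (sigma s w)))) => // s /andP[s0 sT].
  apply: is_derive_subf; first exact: is_derive_linear.
  by apply: is_derive_subf; exact: is_derive_orbit_int.
by rewrite subr_ge0 ltW// (le_lt_trans (ler_norm _))// ww'// ger0_norm.
Qed.

(** * Exponential dichotomy *)

(** The first alternative of the dichotomy in logarithmic form, with [k] of any sign; the second
    alternative becomes the same property of [- b]. *)
Definition decaying b := exists k d : R,
  0 < d /\ forall w t, 0 <= t -> orbit_int b w t <= k - d * t.

Lemma exp_dichotomyP b : continuous b ->
  exp_dichotomy sigma b <-> decaying b \/ decaying (fun w => - b w).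
Proof.
move=> bc; split=> [[k [d [k1 d0 H]]]|].
  have k0 : 0 < k by exact: lt_le_trans ltr01 k1.
  have bound x y : expR x <= k * expR y -> x <= ln k + y.
    by move=> h; rewrite -ler_expR expRD lnK.
  case: H => H; [left|right]; exists (ln k), d; split => // w t t0.
    by have /bound := H w t t0; rewrite mulNr.
  (* Starting at [sigma t w] and running backward for time [t] returns to [w], so the backward
     estimate becomes a forward one for [- b]. *)
  have : - t <= 0 by rewrite oppr_le0.
  move=> /(H (sigma t w))/bound; rewrite -/(orbit_int b _ _) orbit_intN// sigmaK.
  by rewrite orbit_int_opp// mulrN.
have bound k x y : x <= k - y -> expR x <= expR `|k| * expR (- y).
  by move=> xk; rewrite -expRD ler_expR (le_trans xk)// lerD2r ler_norm.
have k1 (k : R) : 1 <= expR `|k| by rewrite (le_trans _ (expR_ge1Dx _))// lerDl.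
case=> -[k [d [d0 H]]]; exists (expR `|k|), d; split => //; [left|right] => w t t0.
  by rewrite mulNr; apply: bound; exact: H.
have : 0 <= - t by rewrite oppr_ge0.
move=> /(H (sigma t w)); rewrite orbit_int_opp// -[in sigma t w](opprK t) -orbit_intN//.
by rewrite opprK mulrN => /bound; rewrite opprK.
Qed.

Definition decay_rates b : set R := [set l | decaying (fun w => b w - l)].

(** The upper Lyapunov exponent of [x' = b x] over the whole base, and the right endpoint of the
    spectrum of [b]; the left endpoint is minus the exponent of [- b]. *)
Definition top_exponent b : R := inf (decay_rates b).

Lemma decaying_le b b' : continuous b -> continuous b' ->
  (forall w, b' w <= b w) -> decaying b -> decaying b'.
Proof.
move=> bc bc' bb [k [d [d0 H]]]; exists k, d; split => // w t t0.
by rewrite (le_trans _ (H w t t0))// orbit_int_le.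
Qed.

Lemma decaying_open b : continuous b -> decaying b ->
  exists2 e, 0 < e & decaying (fun w => b w + e).
Proof.
move=> bc [k [d [d0 H]]]; exists (d / 2); first by rewrite divr_gt0.
exists k, (d / 2); split => [|w t t0]; first by rewrite divr_gt0.
by rewrite orbit_int_addc//; have := H w t t0; lra.
Qed.

Lemma decaying_negative b : continuous b -> (forall w, b w < 0) -> decaying b.
Proof.
move=> bc b0; have [||e e0 be] := @continuous_lt_gap (fun w => - b w) 0.
- exact: continuous_oppf.
- by move=> w; rewrite oppr_gt0.
exists 0, e; split => // w t t0; rewrite sub0r.
have -> : - (e * t) = orbit_int (fun=> - e) w t.
  apply/esym; apply: (@orbit_int_uniq _ _ (fun t => - (e * t))).
  - by move=> v; exact: cvg_cst.
  - by rewrite mulr0 oppr0.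
  - by move=> s; apply: is_derive_oppf; exact: is_derive_linear.
apply: orbit_int_le => // [v|v]; first exact: cvg_cst.
by have := be v; lra.
Qed.

Lemma not_decaying b : continuous b -> (forall w, 0 <= b w) -> ~ decaying b.
Proof.
move=> bc b0 [k [d [d0 H]]].
have t0 : 0 <= (`|k| + 1) / d by rewrite divr_ge0 ?addr_ge0// ltW.
have := H point _ t0; rewrite (mulrC d) divfK ?gt_eqF//.
have : orbit_int (fun=> 0) point ((`|k| + 1) / d)
    <= orbit_int b point ((`|k| + 1) / d).
  by apply: orbit_int_le => // v; exact: cvg_cst.
have -> : orbit_int (fun=> 0) point ((`|k| + 1) / d) = 0.
  apply: (@orbit_int_uniq _ _ (fun=> 0)) => // v; exact: cvg_cst.
by have := ler_norm k; lra.
Qed.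

(** The admissible rates form an upper set, bounded below, and open because half of a decay rate can
    be given away; hence they are the open half-line above their infimum. *)
Lemma decay_ratesP b l : continuous b -> decaying (fun w => b w - l) <-> top_exponent b < l.
Proof.
move=> bc; have cc x : continuous (fun w => b w - x) by exact: continuous_addc.
have [B B0 bB] := continuous_bounded bc.
have inf_rates : has_inf (decay_rates b).
  split; last exists (- B).
    exists (B + 1); apply: decaying_negative => // w.
    by have := ler_norm (b w); have := bB w; lra.
  move=> x Dx; rewrite leNgt; apply/negP => xB; apply: (not_decaying (cc x)) Dx => w.
  by have := ler_norm (- b w); rewrite normrN; have := bB w; lra.
split=> [Dl|ltl].
  have [e e0 De] := decaying_open (cc l) Dl.
  have : decay_rates b (l - e).
    rewrite /decay_rates/= (_ : (fun _ => _) = (fun w => b w - l + e))//.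
    by apply/funext => w; ring.
  by move=> /(ge_inf inf_rates.2) /le_lt_trans; apply; rewrite gtrBl.
have e0 : 0 < l - top_exponent b by rewrite subr_gt0.
have [x Dx xl] := inf_adherent e0 inf_rates.
apply: (decaying_le (cc x) (cc l) _ Dx) => w.
by rewrite lerB// ltW// (lt_le_trans xl)// addrC subrK.
Qed.

End BaseTools.

(** * Invariant measures and the spectrum *)

Section ContinuousIntegral.
Context {R : realType} {Omega : pointedMetricType R}.
Variable m : probability (borel Omega) R.
Hypothesis Omega_compact : compact [set: Omega].
Implicit Types f g : Omega -> R.

Lemma continuous_lincomb n (f : 'I_n -> Omega -> R) (al : 'I_n -> R) :
  (forall i, continuous (f i)) -> continuous (fun w => \sum_(i < n) al i * f i w).
Proof.
elim: n f al => [|n IHn] f al fc.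
  under eq_fun do rewrite big_ord0.
  by move=> w; exact: cvg_cst.
under eq_fun do rewrite big_ord_recl.
move=> w; apply: cvgD; last exact: (IHn (fun i => f (lift ord0 i))).
by apply: cvgM; [exact: cvg_cst|exact: fc].
Qed.

Lemma continuous_measurable_borel f : continuous f ->
  measurable_fun [set: borel Omega] (f : borel Omega -> R).
Proof.
move=> /continuousP fc; apply: (measurability _ (measurable_realfun.RGenOpens.measurableE R)).
move=> _ [_ [a [b ->] <-]]; rewrite setTI; apply: sub_sigma_algebra.
exact/fc/interval_open.
Qed.

Lemma continuous_integrable f : continuous f ->
  m.-integrable [set: borel Omega] (EFin \o f).
Proof.
move=> fc; apply: measurable_bounded_integrable => //.
- by apply: le_lt_trans (probability_le1 m _) (ltry 1).
- exact: continuous_measurable_borel.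
have := continuous_compact (continuous_subspaceT fc) Omega_compact.
by move=> /compact_bounded; rewrite /bounded_set => -[M [Mr HM]];
  exists M; split => // x Mx w _; apply: HM Mx _ _; exists w.
Qed.

Lemma Rintegral_cst_prob (r : R) : \int[m]_w r = r.
Proof.
rewrite Rintegral_cst// -[RHS]mulr1; congr (_ * _).
exact: (congr1 fine (probability_setT m)).
Qed.

Lemma continuous_Rintegral_sum n (f : 'I_n -> Omega -> R) (al : 'I_n -> R) :
  (forall i, continuous (f i)) ->
  \int[m]_w (\sum_(i < n) al i * f i w) = \sum_(i < n) al i * \int[m]_w f i w.
Proof.
elim: n f al => [|n IHn] f al fc.
  rewrite big_ord0 -[RHS]Rintegral_cst_prob.
  by apply: eq_Rintegral => w _; rewrite big_ord0.
under eq_Rintegral do rewrite big_ord_recl.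
rewrite big_ord_recl RintegralD//.
- rewrite RintegralZl//; last exact: continuous_integrable.
  by congr (_ + _); exact: (IHn (fun i => f (lift ord0 i)) (fun i => al (lift ord0 i))).
- apply: continuous_integrable => w.
  by apply: cvgM; [exact: cvg_cst|exact: fc].
- by apply: continuous_integrable; apply: continuous_lincomb => i; exact: fc.
Qed.

End ContinuousIntegral.

Section MeanValue.
Context {R : realType} {Omega : pointedMetricType R}.
Variable sigma : R -> Omega -> Omega.
Hypothesis base : compact_minimal_flow sigma.
Variable m : probability (borel Omega) R.
Hypothesis m_inv : invariant_measure sigma m.
Implicit Types b : Omega -> R.

Lemma measurable_time_map t :
  measurable_fun [set: borel Omega] (sigma t : borel Omega -> borel Omega).
Proof.
refine (@measurability _ _ (borel Omega) (borel Omega) setT (sigma t)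
  (@open Omega) erefl _).
move=> _ [A oA <-]; rewrite setTI; apply: sub_sigma_algebra.
have /continuousP sc := continuous_time_map base (t := t).
exact: sc.
Qed.

Lemma invariant_Rintegral b t : continuous b ->
  \int[m]_w b (sigma t w) = \int[m]_w b w.
Proof.
move=> bc; have st := measurable_time_map t.
have bsc : continuous (b \o sigma t).
  by move=> w; apply: continuous_comp; [exact: continuous_time_map|exact: bc].
rewrite /Rintegral; congr fine.
have := @integral_pushforward _ _ _ _ R _ st m setT (EFin \o b).
rewrite preimage_setT => <- //.
- apply: eq_measure_integral => A mA _; exact: m_inv.
- apply/measurable_realfun.measurable_EFinP; exact: continuous_measurable_borel.
- exact: (@continuous_integrable _ _ m (base_compact base) (b \o sigma t)).
Qed.

(** A Riemann sum whose step is uniform in [w] can be averaged over the base by linearity and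
    invariance alone, so time and space integrals never have to be exchanged. *)
Lemma riemann_le_orbit_int b h e w n : continuous b -> 0 < h ->
  (forall w s, `|s| <= h -> `|b (sigma s w) - b w| < e) ->
  \sum_(i < n) h * b (sigma (i%:R * h) w) <= orbit_int sigma b w (n%:R * h) + n%:R * h * e.
Proof.
move=> bc h0 be; elim: n => [|n IHn].
  by rewrite big_ord0 !mul0r orbit_int0 addr0.
rewrite big_ord_recr/= -natr1 mulrDl mul1r orbit_intD//.
set v := sigma _ w.
suff : h * b v <= orbit_int sigma b v h + h * e by lra.
suff : 0 <= orbit_int sigma b v h + (e - b v) * h by lra.
have -> : 0 = orbit_int sigma b v 0 + (e - b v) * 0 by rewrite orbit_int0; ring.
apply: (@derive_nondecreasing _ (fun s => orbit_int sigma b v s + (e - b v) * s)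
  (fun s => b (sigma s v) + (e - b v))); first exact: ltW.
  move=> s _; apply: is_derive_addf; first exact: is_derive_orbit_int.
  exact: is_derive_linear.
move=> s /andP[s0 sh]; have := be v s; rewrite ger0_norm// => /(_ sh).
by rewrite ltr_norml; lra.
Qed.

(** Otherwise [f], which is [b] minus a rate [eta] above the exponent, decays and yet has mean
    [eta]; averaging its Riemann sums gives [n h eta <= k + n h eta / 2] for every [n]. *)
Lemma mean_le_top_exponent b : continuous b -> \int[m]_w b w <= top_exponent sigma b.
Proof.
move=> bc; rewrite leNgt; apply/negP => lt_top.
pose eta := (\int[m]_w b w - top_exponent sigma b) / 2.
have eta0 : 0 < eta by rewrite divr_gt0// subr_gt0.
pose f w := b w - (top_exponent sigma b + eta).
have fc : continuous f by exact: continuous_addc.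
have [k [d [d0 fk]]] : decaying sigma f by apply/(decay_ratesP base) => //; rewrite ltrDl.
have [h h0 fh] := uniform_small_time base fc (divr_gt0 eta0 (ltr0n _ 2)).
have intf : \int[m]_w f w = eta.
  rewrite RintegralD//; [|exact: (continuous_integrable m (base_compact base))..|].
    by rewrite Rintegral_cst_prob /eta; lra.
  apply: (continuous_integrable m (base_compact base)) => w; exact: cvg_cst.
have ineq n : n%:R * (h * eta / 2) <= k.
  have fsc i : continuous (fun w => f (sigma (i%:R * h) w)).
    by move=> w; apply: continuous_comp; [exact: continuous_time_map|exact: fc].
  have : \int[m]_w (\sum_(i < n) h * f (sigma (i%:R * h) w)) <= \int[m]_w (k + n%:R * h * (eta / 2)).
    apply: le_Rintegral => //.
    - apply: (continuous_integrable m (base_compact base)).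
      exact: (@continuous_lincomb _ _ n (fun i w => f (sigma (i%:R * h) w)) (fun=> h)).
    - by apply: (continuous_integrable m (base_compact base)) => w; exact: cvg_cst.
    move=> w _; rewrite (le_trans (riemann_le_orbit_int w n fc h0 fh))// lerD2r.
    have t0 : 0 <= n%:R * h by rewrite mulr_ge0 ?ler0n// ltW.
    by rewrite (le_trans (fk w _ t0))// gerBl mulr_ge0// ltW.
  rewrite (@continuous_Rintegral_sum _ _ m (base_compact base) n
    (fun i w => f (sigma (i%:R * h) w)) (fun=> h))//.
  under eq_bigr do rewrite invariant_Rintegral// intf.
  rewrite sumr_const card_ord -mulr_natl Rintegral_cst_prob.
  by lra.
have q0 : 0 < h * eta / 2 by rewrite divr_gt0// mulr_gt0.
have := ineq (Num.bound (k / (h * eta / 2))); rewrite leNgt => /negP; apply.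
rewrite -ltr_pdivrMr//; have k0 : 0 <= k by have := ineq 0%N; rewrite mul0r.
by rewrite archi_boundP// divr_ge0 ?(ltW q0)//.

Qed.

End MeanValue.

(** * The spectrum as a compact interval *)

Section SpectrumInterval.
Context {R : realType} {Omega : pointedMetricType R}.
Variable sigma : R -> Omega -> Omega.
Hypothesis base : compact_minimal_flow sigma.
Implicit Types a b : Omega -> R.

Lemma orbit_int_nonpos b w s t : continuous b -> (forall w, b w <= 0) -> s <= t ->
  orbit_int sigma b w t <= orbit_int sigma b w s.
Proof.
move=> bc b0 st; apply: (@derive_nonincreasing _ _ (fun s => b (sigma s w)) _ _ st) => u _ //.
exact: is_derive_orbit_int.
Qed.

(** Every orbit enters the region [b < - 2 kap] within time [T] and keeps [b < - kap] for a further
    time [h]; each stretch of length [T + h] thus lowers the integral by at least [eta]. *)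
Lemma decaying_nonpos b : continuous b -> (forall w, b w <= 0) ->
  (exists w, b w < 0) -> decaying sigma b.
Proof.
move=> bc b0 [w0 bw0]; pose kap : R := - b w0 / 4.
have kap0 : 0 < kap by rewrite /kap; lra.
have oU : open [set w | b w < - 2 * kap].
  have /continuousP/(_ [set x : R | x < - 2 * kap]) := bc.
  by apply; exact: open_lt.
have [|T T0 visit] := visits base oU; first by exists w0 => /=; rewrite /kap; lra.
have [h h0 bh] := uniform_small_time base bc kap0.
have T1 : 0 < T + h by rewrite ltr_wpDl.
pose eta := h * kap.
have eta0 : 0 < eta by rewrite mulr_gt0.
have drop w : orbit_int sigma b w (T + h) <= - eta.
  have [t /andP[t0 tT] /= Ut] := visit w.
  apply: (@le_trans _ _ (orbit_int sigma b w (t + h))).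
    by apply: orbit_int_nonpos; rewrite // lerD2r.
  apply: (@le_trans _ _ (orbit_int sigma b (sigma t w) h)).
    rewrite orbit_intD// gerDr -[leRHS](orbit_int0 sigma b w).
    exact: orbit_int_nonpos.
  have := @gronwall_const_le R (fun s => orbit_int sigma b (sigma t w) s + kap * s)
    (fun s => b (sigma s (sigma t w)) + kap) 0 0 h (ltW h0).
  rewrite orbit_int0 mul0r expR0 !mulr1 mulr0 addr0 => le0.
  suff : orbit_int sigma b (sigma t w) h + kap * h <= 0 by rewrite /eta; lra.
  apply: le0 => s /andP[s0 sh].
    by apply: is_derive_addf; [exact: is_derive_orbit_int|exact: is_derive_linear].
  have := bh (sigma t w) s; rewrite ger0_norm// => /(_ sh).
  by rewrite ltr_norml mul0r; move: Ut; lra.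
have drops n w : orbit_int sigma b w (n%:R * (T + h)) <= - (n%:R * eta).
  elim: n w => [|n IHn] w; first by rewrite !mul0r orbit_int0 oppr0.
  rewrite -natr1 mulrDl mul1r orbit_intD// mulrDl mul1r opprD lerD//.
(* The additive constant [eta] pays for the incomplete last stretch. *)
exists eta, (eta / (T + h)); split => [|w t t0]; first by rewrite divr_gt0.
have tT : 0 <= t / (T + h) by rewrite divr_ge0// ltW.
have /andP[n1 n2] := truncn_itv tT; set n := Num.truncn _ in n1 n2.
apply: le_trans (_ : - (n%:R * eta) <= _).
  apply: le_trans (drops n w); apply: orbit_int_nonpos => //.
  by rewrite -ler_pdivlMr.
rewrite lerBrDr addrC mulrAC -mulrA.
have : t / (T + h) * eta <= (n%:R + 1) * eta.
  by rewrite ler_pM2r// natr1 ltW.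
by rewrite mulrCA; lra.
Qed.

(** Strictness is what places the spectrum in the open interval: a neighbourhood of one point below
    [M] is visited often enough to lower the exponent. *)
Lemma top_exponent_lt a (M : R) : continuous a -> (forall w, a w <= M) ->
  (exists w, a w < M) -> top_exponent sigma a < M.
Proof.
move=> ac aM [w0 aw0]; apply/(decay_ratesP base) => //; apply: decaying_nonpos.
- exact: continuous_addc.
- by move=> w; rewrite subr_le0.
- by exists w0; rewrite subr_lt0.
Qed.

Lemma spectrum_itv a : continuous a -> spectrum sigma a =
  `[- top_exponent sigma (fun w => - a w), top_exponent sigma a]%classic.
Proof.
move=> ac; have nac := continuous_oppf ac.
apply/seteqP; split => l.
  rewrite /spectrum/= in_itv/= => nd; apply/andP; split; rewrite leNgt;
    apply/negP => lt; apply: nd; apply/exp_dichotomyP => //;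
    try exact: continuous_addc; [right|left].
    have -> : (fun w => - (a w - l)) = (fun w => - a w - - l).
      by apply/funext => w; ring.
    by apply/(decay_ratesP base) => //; rewrite ltrNr.
  exact/(decay_ratesP base).
rewrite /spectrum/= in_itv/= => /andP[l1 l2].
rewrite exp_dichotomyP//; last exact: continuous_addc.
case=> [/(decay_ratesP base l ac)|]; first by rewrite ltNge l2.
have -> : (fun w => - (a w - l)) = (fun w => - a w - - l).
  by apply/funext => w; ring.
by move=> /(decay_ratesP base (- l) nac); rewrite ltNge lerNl l1.
Qed.

End SpectrumInterval.

(** [epsilon1 n r] is the smaller root of [N^2 e^2 - (2 N + 4 r (N - 1)) e + 1], the difference of
    the two sides of the second inequality. For [u = N^2 eps], lying below it reads
    [2 D < N + 2 s - u], which is then squared. *)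
Lemma epsilon1_gap {R : realType} (n : nat) (r eps : R) : (1 < n)%N -> 1 <= r ->
  0 < eps -> eps < epsilon1 n r ->
  n%:R * eps < 1 /\ 4 * r * (n%:R - 1) * eps < (1 - n%:R * eps) ^+ 2.
Proof.
move=> n1 r1 eps0; rewrite /epsilon1; set N : R := n%:R.
have N2 : 2 <= N by rewrite (ler_nat R 2).
pose s := r * (N - 1); rewrite -/s.
have s1 : 1 <= s by rewrite /s; nra.
set D := Num.sqrt _; have D0 : 0 <= D by exact: sqrtr_ge0.
have DD : D ^+ 2 = s * (s + N) by rewrite sqr_sqrtr//; nra.
have NN : 0 < N ^+ 2 by rewrite exprn_gt0//; lra.
rewrite ltr_pdivlMr// => lt_eps.
have sD : s <= D by rewrite -(@ler_pXn2r _ 2) ?nnegrE ?DD//; nra.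
pose u := eps * N ^+ 2.
have u0 : 0 < u by rewrite mulr_gt0.
have lt_u : u < N + 2 * s - 2 * D by rewrite /u; move: lt_eps; rewrite /s; lra.
have uN : u < N by lra.
have key : 4 * s * u < (N - u) ^+ 2.
  have : (2 * D) ^+ 2 < (N + 2 * s - u) ^+ 2 by rewrite ltr_pXn2r// ?nnegrE; lra.
  by rewrite exprMn DD !expr2; lra.
have uE : u = N * (N * eps) by rewrite /u; ring.
have NE : N * eps < 1 by move: uN; rewrite uE; nra.
split => //; rewrite -(ltr_pM2l NN).
have -> : N ^+ 2 * (1 - N * eps) ^+ 2 = (N - u) ^+ 2 by rewrite uE; ring.
apply: le_lt_trans key; rewrite le_eqVlt; apply/orP; left; apply/eqP.
by rewrite uE /s; ring.
Qed.

(** * Length and position of the spectrum of a combination of bumps *)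

Section BandSpectrum.
Context {R : realType} {Omega : pointedMetricType R}.
Variable sigma : R -> Omega -> Omega.
Hypothesis base : compact_minimal_flow sigma.
Variables (n : nat) (n_gt1 : (1 < n)%N).
Variable m : 'I_n -> probability (borel Omega) R.
Hypothesis m_inv : forall i, invariant_measure sigma (m i).
Variables (r eps : R) (c : 'I_n -> Omega -> R) (alpha : 'I_n -> R).
Hypotheses (r_ge1 : 1 <= r) (eps_gt0 : 0 < eps) (eps_lt : eps < epsilon1 n r)
  (c_continuous : forall i, continuous (c i))
  (c_itv : forall i w, 0 <= c i w <= 1)
  (c_max : forall i, exists w, c i w = 1)
  (c_disjoint : forall i j, i != j -> forall w, c i w * c j w = 0)
  (c_int_diag : forall i, 1 - eps < \int[m i]_w c i w <= 1)
  (c_int_offdiag : forall i j, i != j -> 0 <= \int[m j]_w c i w < eps)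
  (alpha_nondecreasing : forall i j : 'I_n, (i <= j)%N -> alpha i <= alpha j).

Let first := first_idx n_gt1.
Let last := last_idx n_gt1.

Hypotheses (alpha_first : alpha first < 0) (alpha_last : 0 < alpha last).

Definition plateau_sum w : R := \sum_(i < n) alpha i * c i w.

Lemma alpha_bounds i : alpha first <= alpha i <= alpha last.
Proof.
rewrite !alpha_nondecreasing//=; last first.
by rewrite /= subn1 -ltnS (ltn_predK n_gt1).
Qed.

Lemma plateau_sum_at i w : c i w != 0 -> plateau_sum w = alpha i * c i w.
Proof.
move=> ciw; rewrite /plateau_sum (bigD1 i)//= big1 ?addr0// => j ji.
have /eqP := c_disjoint ji w; rewrite mulf_eq0 (negbTE ciw) orbF => /eqP ->.
by rewrite mulr0.
Qed.

Lemma plateau_sum_bounds w : alpha first <= plateau_sum w <= alpha last.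
Proof.
have [/existsP[i ciw]|] := boolP [exists i, c i w != 0].
  rewrite (plateau_sum_at ciw).
  have /andP[a1 a2] := alpha_bounds i; have /andP[c0 c1] := c_itv i w.
  (* The distance to the lower bound is [p1 + p3] and the distance to the upper bound is
     [p2 + p4]. *)
  have p1 : 0 <= (alpha i - alpha first) * c i w by rewrite mulr_ge0// subr_ge0.
  have p2 : 0 <= (alpha last - alpha i) * c i w by rewrite mulr_ge0// subr_ge0.
  have p3 : 0 <= - alpha first * (1 - c i w).
    by rewrite mulr_ge0 ?subr_ge0// oppr_ge0 ltW.
  have p4 : 0 <= alpha last * (1 - c i w) by rewrite mulr_ge0 ?subr_ge0// ltW.
  by apply/andP; split; lra.
rewrite negb_exists => /forallP c0.
rewrite /plateau_sum big1 ?ltW// => i _.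
by have /negPn/eqP -> := c0 i; rewrite mulr0.
Qed.

Lemma continuous_plateau_sum : continuous plateau_sum.
Proof. exact: continuous_lincomb. Qed.

Lemma mean_plateau_sum k :
  \int[m k]_w plateau_sum w = alpha k * (\int[m k]_w c k w)
    + \sum_(i < n | i != k) alpha i * \int[m k]_w c i w.
Proof.
rewrite (@continuous_Rintegral_sum _ _ (m k) (base_compact base))//.
by rewrite (bigD1 k).
Qed.

Lemma card_others (k : 'I_n) (x : R) : \sum_(i < n | i != k) x = (n%:R - 1) * x.
Proof.
have := sumr_const 'I_n x; rewrite card_ord (bigD1 k)//= => e.
by rewrite mulrBl mul1r mulr_natl -e addrAC subrr add0r.
Qed.

(** Worst case: the bump of index [last] misses [eps] of the mass, and each of the other [n - 1]
    bumps has mass [eps] and the most negative coefficient. *)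
Lemma mean_last : alpha last * (1 - eps) + (n%:R - 1) * (alpha first * eps)
  <= \int[m last]_w plateau_sum w.
Proof.
rewrite mean_plateau_sum lerD//.
  by rewrite ler_wpM2l ?ltW//; case/andP: (c_int_diag last).
rewrite -(card_others last); apply: ler_sum => i il.
have /andP[I0 I1] := c_int_offdiag il; have /andP[a1 _] := alpha_bounds i.
apply: (@le_trans _ _ (alpha first * \int[m last]_w c i w)).
  by rewrite ler_wnM2l ?(ltW alpha_first)// ltW.
by rewrite ler_wpM2r.
Qed.

Lemma mean_first : \int[m first]_w plateau_sum w
  <= alpha first * (1 - eps) + (n%:R - 1) * (alpha last * eps).
Proof.
rewrite mean_plateau_sum lerD//.
  by rewrite ler_wnM2l ?ltW//; case/andP: (c_int_diag first).
rewrite -(card_others first); apply: ler_sum => i il.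
have /andP[I0 I1] := c_int_offdiag il; have /andP[_ a2] := alpha_bounds i.
apply: (@le_trans _ _ (alpha last * \int[m first]_w c i w)).
  by rewrite ler_wpM2r.
by rewrite ler_wpM2l ?(ltW alpha_last)// ltW.
Qed.

Let lm := - top_exponent sigma plateau_sum.
Let lp := top_exponent sigma (fun w => - plateau_sum w).

(** With [d = alpha last - alpha first] and [x = - lp - alpha first], the two extreme means give
    [lp - lm >= d (1 - n eps)] and [x <= (n - 1) eps d]. Since [- (lp + alpha first) (lp + alpha
    last) = x (d - x) <= x d], the last claim follows from [d^2] times the inequality satisfied by
    [eps]. *)
Lemma band_endpoints : [/\ lm < lp, alpha first < - lp, - lm < alpha last &
  0 < (lp - lm) ^+ 2 + 4 * r * (lp + alpha first) * (lp + alpha last)].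
Proof.
have ac := continuous_plateau_sum; have nac := continuous_oppf ac.
have [eps1 gap] := epsilon1_gap n_gt1 r_ge1 eps_gt0 eps_lt.
have N2 : 2 <= n%:R :> R by rewrite (ler_nat R 2).
have top_last := le_trans mean_last (mean_le_top_exponent base (@m_inv last) ac).
have low_first : lp >= - (alpha first * (1 - eps) + (n%:R - 1) * (alpha last * eps)).
  apply: le_trans (mean_le_top_exponent base (@m_inv first) nac).
  have -> : \int[m first]_w (- plateau_sum w) = - \int[m first]_w plateau_sum w.
    have := @RintegralZl _ _ _ (m first) setT plateau_sum (-1) measurableT
      (continuous_integrable (m first) (base_compact base) ac).
    by rewrite mulN1r => <-; apply: eq_Rintegral => w _; rewrite mulN1r.
  by rewrite lerN2 mean_first.
have [w1 cw1] := c_max first; have [w2 cw2] := c_max last.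
have a1 : plateau_sum w1 = alpha first.
  by rewrite (plateau_sum_at (i := first)) cw1 ?mulr1 ?oner_neq0.
have a2 : plateau_sum w2 = alpha last.
  by rewrite (plateau_sum_at (i := last)) cw2 ?mulr1 ?oner_neq0.
have lp_lt : alpha first < - lp.
  rewrite ltrNr; apply: (top_exponent_lt base nac).
    by move=> w; rewrite lerN2; case/andP: (plateau_sum_bounds w).
  by exists w2; rewrite ltrN2 a2 (lt_trans alpha_first).
have lm_gt : - lm < alpha last.
  rewrite /lm opprK; apply: (top_exponent_lt base ac).
    by move=> w; case/andP: (plateau_sum_bounds w).
  by exists w1; rewrite a1 (lt_trans alpha_first).
pose d := alpha last - alpha first.
have d0 : 0 < d by rewrite /d subr_gt0 (lt_trans alpha_first).
have band : d * (1 - n%:R * eps) <= lp - lm.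
  move: top_last low_first; rewrite /d /lm; move: (top_exponent _ _) lp.
  by move: (n%:R : R) (alpha first) (alpha last) => N x y t p h1 h2; lra.
have dn0 : 0 < d * (1 - n%:R * eps) by rewrite mulr_gt0// subr_gt0.
split => //; first by rewrite -subr_gt0; exact: lt_le_trans band.
have sq : (d * (1 - n%:R * eps)) ^+ 2 <= (lp - lm) ^+ 2.
  by rewrite ler_pXn2r ?nnegrE ?(ltW dn0)// (le_trans (ltW dn0)).
have gap' : d ^+ 2 * (4 * r * (n%:R - 1) * eps) < d ^+ 2 * (1 - n%:R * eps) ^+ 2.
  by rewrite ltr_pM2l// exprn_gt0.
pose x := - lp - alpha first.
have x0 : 0 < x by rewrite /x; lra.
have xd : x <= (n%:R - 1) * eps * d.
  (* This is what the mean at [first] gives; it is enlarged using [alpha first < 0] and [n >= 2]. *)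
  apply: (@le_trans _ _ (eps * ((n%:R - 1) * alpha last - alpha first))).
    by rewrite /x; lra.
  rewrite -mulrA mulrCA ler_wpM2l ?(ltW eps_gt0)// /d.
  move: N2 alpha_first; move: (n%:R : R) (alpha first) => N y N2 y0.
  by rewrite -subr_ge0 (_ : _ - _ = (N - 2) * - y) ?mulr_ge0//; [lra|lra|ring].
have -> : 4 * r * (lp + alpha first) * (lp + alpha last) = - (4 * r * (x * (d - x))).
  by rewrite /x /d; ring.
rewrite subr_gt0 (lt_le_trans _ sq)// exprMn (le_lt_trans _ gap')//.
have r4 : 0 <= 4 * r by rewrite mulr_ge0// (le_trans ler01).
rewrite (_ : d ^+ 2 * _ = 4 * r * ((n%:R - 1) * eps * d * d)); last by ring.
apply: ler_wpM2l => //; apply: (@le_trans _ _ (x * d)).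
  by rewrite ler_wpM2l ?(ltW x0)// gerBl ltW.
by rewrite ler_wpM2r ?(ltW d0).
Qed.

End BandSpectrum.

(** * The cubic family and its truncation *)

Record cubic_setting {R : realType} {Omega : pointedMetricType R}
    (sigma : R -> Omega -> Omega) (a1 a2 a3 : Omega -> R) : Prop := {
  cubic_base : compact_minimal_flow sigma ;
  cubic_c1 : continuous a1 ;
  cubic_c2 : continuous a2 ;
  cubic_c3 : continuous a3 ;
  cubic_a3_gt0 : forall w, 0 < a3 w }.

Section Clip.
Context {R : realType}.
Implicit Types (N x y : R).

Definition clip N x : R := Num.max (- N) (Num.min N x).

Lemma clip_id N x : `|x| <= N -> clip N x = x.
Proof.
by rewrite ler_norml => /andP[x1 x2]; rewrite /clip (min_idPr x2); apply/max_idPr.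
Qed.

Lemma norm_clip N x : 0 <= N -> `|clip N x| <= N.
Proof.
move=> N0; rewrite /clip ler_norml le_max lexx/= ge_max ge_min lexx/= andbT.
by rewrite ge0_cp.
Qed.

Lemma clip_lip N x y : `|clip N x - clip N y| <= `|x - y|.
Proof.
wlog xy : x y / x <= y.
  move=> wlg; have [|yx] := leP x y; first exact: wlg.
  by rewrite distrC (distrC x); apply: wlg; exact: ltW.
have max_lip (a u v : R) : u <= v -> 0 <= Num.max a v - Num.max a u <= v - u.
  by case: (leP a u) => au; case: (leP a v) => av uv; apply/andP; split; lra.
have min_lip (a u v : R) : u <= v -> 0 <= Num.min a v - Num.min a u <= v - u.
  by case: (leP a u) => au; case: (leP a v) => av uv; apply/andP; split; lra.
have /andP[m1 m2] := min_lip N x y xy; rewrite subr_ge0 in m1.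
have /andP[h1 h2] := max_lip (- N) _ _ m1.
rewrite distrC (distrC x) (ger0_norm h1) (ger0_norm (_ : 0 <= y - x)) ?subr_ge0//.
exact: le_trans h2 m2.
Qed.

End Clip.

Section TruncatedFlow.
Context {R : realType} {Omega : pointedMetricType R}.
Variables (sigma : R -> Omega -> Omega) (a1 a2 a3 : Omega -> R).
Implicit Types (l N x y t s : R) (w : Omega).

(** The relative growth rate [x' / x]; most estimates on positive solutions are bounds on it. *)
Definition cubic_rate l w x : R := - a3 w * x ^+ 2 + a2 w * x + (a1 w + l).

Lemma cubic_familyE l w x : cubic_family a1 a2 a3 l w x = cubic_rate l w x * x.
Proof. by rewrite /cubic_family /cubic_rate; ring. Qed.

Definition cubic_trunc N l w x : R := cubic_family a1 a2 a3 l w (clip N x).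

Lemma cubic_trunc_id N l w x : `|x| <= N ->
  cubic_trunc N l w x = cubic_family a1 a2 a3 l w x.
Proof. by move=> xN; rewrite /cubic_trunc clip_id. Qed.

(** The global solution of the clipped equation, chosen by [xget]; for [0 < N] such a solution
    exists and the default is not met. *)
Definition phi N l t w x : R := xget (fun=> 0 : R) [set u : R -> R | u 0 = x /\
  forall t, is_derive t (1 : R) u (cubic_trunc N l (sigma t w) (u t))] t.

Hypothesis S : cubic_setting sigma a1 a2 a3.
Let base := cubic_base S.

Lemma coefficient_bound : exists2 B, 0 < B &
  forall w, [/\ `|a1 w| <= B, `|a2 w| <= B & `|a3 w| <= B].
Proof.
have [B1 B10 H1] := continuous_bounded base (cubic_c1 S).
have [B2 B20 H2] := continuous_bounded base (cubic_c2 S).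
have [B3 B30 H3] := continuous_bounded base (cubic_c3 S).
exists (B1 + B2 + B3) => [|w]; first by rewrite !addr_gt0.
by have := H1 w; have := H2 w; have := H3 w; split; lra.
Qed.

Lemma leading_coefficient_gap : exists2 r, 0 < r & forall w, r <= a3 w.
Proof.
have [r r0 ar] := continuous_lt_gap base (cubic_c3 S) (cubic_a3_gt0 S).
by exists r => // w; have := ar w; rewrite add0r.
Qed.

Lemma cubic_family_lip N l : 0 < N -> exists2 K, 0 < K &
  forall w x y, `|x| <= N -> `|y| <= N ->
    `|cubic_family a1 a2 a3 l w x - cubic_family a1 a2 a3 l w y| <= K * `|x - y|.
Proof.
move=> N0; have [B B0 HB] := coefficient_bound.
exists (B * (3 * N ^+ 2) + B * (2 * N) + (B + `|l|)) => [|w x y xN yN].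
  by rewrite ltr_pwDr ?addr_ge0 ?mulr_ge0 ?sqr_ge0 ?(ltW B0) ?(ltW N0)// ltr_wpDr.
have [h1 h2 h3] := HB w.
rewrite (_ : _ - _ = (- a3 w * (x ^+ 2 + x * y + y ^+ 2) + a2 w * (x + y) + (a1 w + l))
  * (x - y)); last by rewrite /cubic_family; ring.
rewrite normrM ler_wpM2r// (le_trans (ler_normD _ _))// lerD//; last first.
  by rewrite (le_trans (ler_normD _ _))// lerD2r.
rewrite (le_trans (ler_normD _ _))// lerD//; rewrite normrM ler_pM//.
- by rewrite normrN.
- rewrite (le_trans (ler_normD _ _))// (_ : 3 * _ = N ^+ 2 + N * N + N ^+ 2); last by ring.
  rewrite lerD ?normrX ?lerXn2r ?nnegrE ?(ltW N0)// (le_trans (ler_normD _ _))//.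
  by rewrite lerD ?normrX ?lerXn2r ?nnegrE ?(ltW N0)// normrM ler_pM.
- by rewrite (le_trans (ler_normD _ _))// mulrDl mul1r lerD.
Qed.

Lemma cubic_trunc_lip N l : 0 < N -> exists2 K, 0 < K &
  forall w x y, `|cubic_trunc N l w x - cubic_trunc N l w y| <= K * `|x - y|.
Proof.
move=> N0; have [K K0 HK] := cubic_family_lip l N0; exists K => // w x y.
rewrite (le_trans (HK _ _ _ _ _)) ?norm_clip ?(ltW N0)//.
by rewrite ler_wpM2l ?(ltW K0)// clip_lip.
Qed.

Lemma cubic_trunc0 N l w : 0 < N -> cubic_trunc N l w 0 = 0.
Proof.
move=> N0; rewrite cubic_trunc_id ?normr0 ?ltW// /cubic_family.
by rewrite !expr0n/= !mulr0 !addr0.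
Qed.

Lemma continuous_cubic_family l x : continuous (fun w => cubic_family a1 a2 a3 l w x).
Proof.
move=> w; apply: cvgD; [apply: cvgD|].
- by apply: cvgM; [apply: cvgN; exact: (cubic_c3 S)|exact: cvg_cst].
- by apply: cvgM; [exact: (cubic_c2 S)|exact: cvg_cst].
- apply: cvgM; last exact: cvg_cst.
  by apply: cvgD; [exact: (cubic_c1 S)|exact: cvg_cst].
Qed.

Lemma phi_spec N l w x : 0 < N -> phi N l 0 w x = x /\
  forall t, is_derive t (1 : R) (fun t => phi N l t w x)
    (cubic_trunc N l (sigma t w) (phi N l t w x)).
Proof.
move=> N0; have [K K0 HK] := cubic_trunc_lip l N0.
have [u Hu] := @picard_lindelof R (fun t => cubic_trunc N l (sigma t w)) K x K0
  (fun t => HK (sigma t w)) (fun t => cubic_trunc0 l (sigma t w) N0)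
  (fun x => continuous_on_orbit base (w := w) (@continuous_cubic_family l (clip N x))).
rewrite /phi; case: xgetP => [v _ Hv|H]; last by have := H u.
exact: Hv.
Qed.

Lemma phi0 N l w x : 0 < N -> phi N l 0 w x = x.
Proof. by move=> N0; have [] := phi_spec l w x N0. Qed.

Lemma is_derive_phi N l w x t : 0 < N -> is_derive t (1 : R)
  (fun t => phi N l t w x) (cubic_trunc N l (sigma t w) (phi N l t w x)).
Proof. by move=> N0; have [] := phi_spec l w x N0. Qed.

Lemma continuous_phi_time N l w x : 0 < N -> continuous (fun t => phi N l t w x).
Proof.
by move=> N0 t; exact: is_derive_continuous (is_derive_phi l w x t N0).
Qed.

Lemma phi_uniq N l w x (u : R -> R) t : 0 < N -> u 0 = x ->
  (forall s, Num.min 0 t <= s <= Num.max 0 t ->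
    is_derive s (1 : R) u (cubic_trunc N l (sigma s w) (u s))) ->
  u t = phi N l t w x.
Proof.
move=> N0 u0 ud; have [K K0 HK] := cubic_trunc_lip l N0.
apply/eqP; rewrite -subr_eq0; apply/eqP.
apply: (@derive_eq0_between _ (fun s => u s - phi N l s w x)
  (fun s => cubic_trunc N l (sigma s w) (u s)
    - cubic_trunc N l (sigma s w) (phi N l s w x)) K).
- by rewrite phi0// u0 subrr.
- by move=> s st; apply: is_derive_subf (ud _ st) (is_derive_phi l w x s N0).
- by move=> s _; exact: HK.
Qed.

Lemma phiD N l s t w x : 0 < N ->
  phi N l (s + t) w x = phi N l t (sigma s w) (phi N l s w x).
Proof.
move=> N0.
apply: (@phi_uniq _ _ _ _ (fun t => phi N l (s + t) w x)); rewrite ?addr0// => u _.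
have := is_derive_translate (is_derive_phi l w x (u + s) N0).
rewrite addrC -(flowD (base_flow base)) (addrC u s).
by congr is_derive; apply/funext => v; rewrite addrC.
Qed.

Lemma phiK N l t w x : 0 < N -> phi N l (- t) (sigma t w) (phi N l t w x) = x.
Proof. by move=> N0; rewrite -phiD// subrr phi0. Qed.

Lemma phiNK N l t w x : 0 < N ->
  phi N l t (sigma (- t) w) (phi N l (- t) w x) = x.
Proof. by move=> N0; rewrite -phiD// addNr phi0. Qed.

Lemma phi_inj N l t w x y : 0 < N -> phi N l t w x = phi N l t w y -> x = y.
Proof. by move=> N0 e; rewrite -(phiK l t w x N0) e phiK. Qed.

Lemma phi_at0 N l t w : 0 < N -> phi N l t w 0 = 0.
Proof.
move=> N0; apply/esym; apply: (@phi_uniq _ _ _ _ (fun=> 0)) => // s _.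
by rewrite cubic_trunc0//; exact: is_derive_cstf.
Qed.

Lemma phi_le_ge0 N l t w x y : 0 < N -> 0 <= t -> x <= y ->
  phi N l t w x <= phi N l t w y.
Proof.
move=> N0 t0 xy; have [K K0 HK] := cubic_trunc_lip l N0.
rewrite -subr_ge0.
apply: (@comparison _ (fun s => phi N l s w y - phi N l s w x)
  (fun s => cubic_trunc N l (sigma s w) (phi N l s w y)
    - cubic_trunc N l (sigma s w) (phi N l s w x)) K 0 t) => //.
- by rewrite !phi0// subr_ge0.
- by move=> s _; apply: is_derive_subf; exact: is_derive_phi.
- move=> s _; have := HK (sigma s w) (phi N l s w y) (phi N l s w x).
  by rewrite ler_norml mulNr => /andP[].
Qed.

Lemma phi_lt N l t w x y : 0 < N -> x < y -> phi N l t w x < phi N l t w y.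
Proof.
move=> N0 xy.
have [t0|t0] := leP 0 t.
  rewrite lt_neqAle (phi_le_ge0 l w N0 t0 (ltW xy)) andbT.
  by apply/eqP => /(phi_inj N0) e; rewrite e ltxx in xy.
rewrite ltNge; apply/negP => yx.
have Nt0 : 0 <= - t by rewrite oppr_ge0 ltW.
have := phi_le_ge0 l (sigma t w) N0 Nt0 yx.
by rewrite !phiK// leNgt xy.
Qed.

Lemma phi_le N l t w x y : 0 < N -> x <= y -> phi N l t w x <= phi N l t w y.
Proof.
move=> N0; rewrite le_eqVlt => /orP[/eqP ->//|xy].
by apply: ltW; exact: phi_lt.
Qed.

(** Gronwall is applied to [D^2 + d^2] because [|D|] need not be differentiable at its zeros; [d]
    bounds both the initial gap and the change of the vector field, so the sum grows at rate at most
    [2 K + 1]. *)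
Lemma near_phi N l t w x (e : R) : 0 < N -> 0 <= t -> 0 < e ->
  \forall p \near (w, x), `|phi N l t p.1 p.2 - phi N l t w x| < e.
Proof.
move=> N0 t0 e0; have [K K0 HK] := cubic_trunc_lip l N0.
pose C := expR ((2 * K + 1) * t).
have C0 : 0 < C by exact: expR_gt0.
(* With this [d] the final bound [2 d^2 C] is below [e^2 = (2 d C)^2], as [C >= 1]. *)
pose d := e / (2 * C).
have d0 : 0 < d by rewrite divr_gt0// mulr_gt0.
have C1 : 1 <= C by rewrite (le_trans _ (expR_ge1Dx _))// lerDl mulr_ge0// addr_ge0// mulr_ge0// ltW.
(* The three coefficients multiply powers of a clipped value [q] with [|q| <= N], so variations
   below [d1] change the field by at most [d]. *)
pose d1 := d / (N ^+ 3 + N ^+ 2 + N).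
have P0 : 0 < N ^+ 3 + N ^+ 2 + N by rewrite !addr_gt0// exprn_gt0.
have d10 : 0 < d1 by rewrite divr_gt0.
have A1 := near_along_flow base w t (cubic_c1 S) d10.
have A2 := near_along_flow base w t (cubic_c2 S) d10.
have A3 := near_along_flow base w t (cubic_c3 S) d10.
have Aw : \forall w' \near w, forall s, 0 <= s <= t -> forall z,
    `|cubic_trunc N l (sigma s w') z - cubic_trunc N l (sigma s w) z| <= d.
  move: A1 A2 A3; apply: filterS3 => w' H1 H2 H3 s /andP[s0 st] z.
  have sn : `|s| <= t by rewrite ger0_norm.
  rewrite /cubic_trunc; set q := clip N z.
  have qN : `|q| <= N by rewrite norm_clip// ltW.
  rewrite (_ : _ - _ = (a3 (sigma s w) - a3 (sigma s w')) * q ^+ 3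
    + (a2 (sigma s w') - a2 (sigma s w)) * q ^+ 2
    + (a1 (sigma s w') - a1 (sigma s w)) * q); last by rewrite /cubic_family; ring.
  rewrite -[leRHS](divfK (lt0r_neq0 P0)) -/d1 !mulrDr.
  rewrite (le_trans (ler_normD _ _))// lerD//; last first.
    by rewrite normrM ler_pM// ltW// H1.
  rewrite (le_trans (ler_normD _ _))// lerD// normrM ler_pM//.
  - by rewrite distrC ltW// H3.
  - by rewrite normrX lerXn2r ?nnegrE ?(ltW N0).
  - by rewrite ltW// H2.
  - by rewrite normrX lerXn2r ?nnegrE ?(ltW N0).
have Ax : \forall x' \near x, `|x' - x| < d.
  by apply: (filterS _ (nbhsx_ballx x _ d0)) => x'; rewrite /ball/= distrC.
exists ([set w' | forall s, 0 <= s <= t -> forall z,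
    `|cubic_trunc N l (sigma s w') z - cubic_trunc N l (sigma s w) z| <= d],
    [set x' | `|x' - x| < d]) => // -[w' x'] [/= Hw Hx].
pose D s := phi N l s w' x' - phi N l s w x.
pose D' s := cubic_trunc N l (sigma s w') (phi N l s w' x')
  - cubic_trunc N l (sigma s w) (phi N l s w x).
have Dd s : is_derive s (1 : R) D (D' s).
  by apply: is_derive_subf; exact: is_derive_phi.
have D'K s : 0 <= s <= t -> `|D' s| <= K * `|D s| + d.
  move=> st; rewrite (_ : D' s = (cubic_trunc N l (sigma s w') (phi N l s w' x')
      - cubic_trunc N l (sigma s w') (phi N l s w x))
    + (cubic_trunc N l (sigma s w') (phi N l s w x)
      - cubic_trunc N l (sigma s w) (phi N l s w x))); last by rewrite /D'; ring.
  by rewrite (le_trans (ler_normD _ _))// lerD// Hw.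
have : D t * D t + d * d <= (D 0 * D 0 + d * d) * expR ((2 * K + 1) * (t - 0)).
  apply: (@gronwall_const_le _ (fun s => D s * D s + d * d)
    (fun s => (D' s * D s + D s * D' s) + 0)) => // s st.
    exact: is_derive_addf (is_derive_mulf (Dd s) (Dd s)) (is_derive_cstf (d * d) s).
  have h1 : D' s * D s <= (K * `|D s| + d) * `|D s|.
    by rewrite (le_trans (ler_norm _))// normrM ler_wpM2r// D'K.
  have h2 : `|D s| * `|D s| = D s * D s by rewrite -normrM ger0_norm// -expr2 sqr_ge0.
  have h3 : 0 <= (`|D s| - d) * (`|D s| - d) by rewrite -expr2 sqr_ge0.
  have h4 : 0 <= K * (d * d) by rewrite mulr_ge0 ?(ltW K0)// mulr_ge0 ?(ltW d0).
  by rewrite addr0 (mulrC (D s) (D' s)); nra.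
rewrite subr0 -/C => Dt.
have D0 : D 0 * D 0 <= d * d.
  rewrite /D !phi0// -expr2 -(ger0_norm (sqr_ge0 _)) normrX -expr2.
  by rewrite lerXn2r ?nnegrE// ltW.
rewrite -/(D t) -(@ltr_pXn2r _ 2) ?nnegrE ?(ltW e0)//.
rewrite -normrX (ger0_norm (sqr_ge0 _)) expr2.
have eE : e = 2 * d * C by rewrite /d; field; rewrite gt_eqF.
have dd0 : 0 < d * d by rewrite mulr_gt0.
have Dt2 : D t * D t <= 2 * (d * d) * C.
  apply: (@le_trans _ _ ((D 0 * D 0 + d * d) * C)); first by move: Dt; rewrite /C; lra.
  by rewrite ler_wpM2r ?(ltW C0)// mulr_natl mulr2n lerD2r.
apply: le_lt_trans Dt2 _; rewrite eE.
rewrite (_ : (2 * d * C) ^+ 2 = 2 * (d * d) * C * (2 * C)); last by ring.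
by rewrite ltr_pMr; [lra|rewrite mulr_gt0// mulr_gt0].
Qed.

End TruncatedFlow.

(** * Maximal solutions *)

Section MaximalSolutions.
Context {R : realType} {Omega : pointedMetricType R}.
Variables (sigma : R -> Omega -> Omega) (a1 a2 a3 : Omega -> R).
Local Notation Phi := (phi sigma a1 a2 a3).
Hypothesis S : cubic_setting sigma a1 a2 a3.
Implicit Types (l N x y t s : R) (w : Omega) (I J : set R) (u v : R -> R).

Lemma between0 I t s : is_interval I -> I 0 -> I t ->
  Num.min 0 t <= s <= Num.max 0 t -> I s.
Proof.
by move=> Ii I0 It; case: (leP 0 t) => _ st; [exact: (Ii 0 t)|exact: (Ii t 0)].
Qed.

Lemma bounded_between u t : (forall s, Num.min 0 t <= s <= Num.max 0 t ->
    {for s, continuous u}) ->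
  exists2 N, 0 < N & forall s, Num.min 0 t <= s <= Num.max 0 t -> `|u s| <= N.
Proof.
move=> uc; have mM : Num.min 0 t <= Num.max 0 t by case: (leP 0 t) => // /ltW.
have [|c _ cmax] := @EVT_max _ (fun s => `|u s|) _ _ mM.
  apply: continuous_in_subspaceT => s; rewrite inE/= in_itv/= => st.
  by apply: cvg_norm; exact: uc.
exists (`|u c| + 1) => [|s st]; first by rewrite ltr_wpDl.
by have := cmax s; rewrite in_itv/= => /(_ st); lra.
Qed.

Lemma solution_phi N l w x I u t : 0 < N ->
  solution sigma (cubic_family a1 a2 a3 l) w x I u -> I t ->
  (forall s, Num.min 0 t <= s <= Num.max 0 t -> `|u s| <= N) ->
  u t = Phi N l t w x.
Proof.
move=> N0 [_ Ii I0 u0 ud] It uN; apply: (phi_uniq S) => // s st.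
by rewrite cubic_trunc_id ?uN//; apply: ud; exact: between0 st.
Qed.

(** Between 0 and [t] both solutions are bounded, hence both are the clipped solution for one common
    level. *)
Lemma solution_uniq l w x I u J v t :
  solution sigma (cubic_family a1 a2 a3 l) w x I u ->
  solution sigma (cubic_family a1 a2 a3 l) w x J v -> I t -> J t -> u t = v t.
Proof.
move=> su sv It Jt.
have [|Nu Nu0 uN] := @bounded_between u t.
  move=> s st; apply: is_derive_continuous; apply: (sol_ode su).
  exact: between0 (sol_itv su) (sol_dom0 su) It st.
have [|Nv Nv0 vN] := @bounded_between v t.
  move=> s st; apply: is_derive_continuous; apply: (sol_ode sv).
  exact: between0 (sol_itv sv) (sol_dom0 sv) Jt st.
have N0 : 0 < Nu + Nv by rewrite addr_gt0.
rewrite (solution_phi N0 su It) ?(solution_phi N0 sv Jt)// => s st.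
  by rewrite (le_trans (vN s st))// lerDr ltW.
by rewrite (le_trans (uN s st))// lerDl ltW.
Qed.

(** By uniqueness all local solutions glue, and their union is the maximal one. A value of [flow_at]
    may therefore be certified by any solution on any interval. *)
Lemma flow_atP l t w x y : flow_at sigma (cubic_family a1 a2 a3 l) t w x y <->
  exists I u, [/\ solution sigma (cubic_family a1 a2 a3 l) w x I u, I t & u t = y].
Proof.
split=> [[I [u [[su _] It uy]]]|[I [u [su It uy]]]]; first by exists I, u.
pose J : set R := [set s | exists K v,
  solution sigma (cubic_family a1 a2 a3 l) w x K v /\ K s].
pose ext s := xget 0 [set z | exists K v,
  [/\ solution sigma (cubic_family a1 a2 a3 l) w x K v, K s & v s = z]].
have extE K v s : solution sigma (cubic_family a1 a2 a3 l) w x K v -> K s ->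
    ext s = v s.
  move=> sv Ks; rewrite /ext; case: xgetP => [z _ [K' [v' [sv' Ks' <-]]]|H].
    exact: solution_uniq sv' sv Ks' Ks.
  by exfalso; apply: (H (v s)); exists K, v.
exists J, ext; split; last by rewrite (extE I u).
- split.
    split.
    + rewrite openE => s [K [v [sv Ks]]].
      have := sol_open sv; rewrite openE => /(_ s Ks).
      by apply: filterS => r Kr; exists K, v.
    + move=> p q [K [v [sv Kp]]] [K' [v' [sv' Kq]]] r /andP[pr rq].
      have [r0|r0] := leP 0 r.
        exists K', v'; split => //; apply: (sol_itv sv' (sol_dom0 sv') Kq).
        by rewrite r0.
      exists K, v; split => //; apply: (sol_itv sv Kp (sol_dom0 sv)).
      by rewrite pr ltW.
    + by exists I, u; split => //; exact: sol_dom0 su.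
    + by rewrite (extE I u)//; [exact: sol_init su|exact: sol_dom0 su].
    + move=> s [K [v [sv Ks]]]; rewrite (extE K v)//.
      apply: near_eq_is_derive (sol_ode sv Ks).
      have := sol_open sv; rewrite openE => /(_ s Ks).
      by apply: filterS => r Kr; rewrite (extE K v).
  by move=> K v sv _ _ s Ks; exists K, v.
- by exists I, u.
Qed.

Lemma flow_at_uniq l t w x y y' : flow_at sigma (cubic_family a1 a2 a3 l) t w x y ->
  flow_at sigma (cubic_family a1 a2 a3 l) t w x y' -> y = y'.
Proof.
move=> /flow_atP[I [u [su It <-]]] /flow_atP[J [v [sv Jt <-]]].
exact: solution_uniq su sv It Jt.
Qed.

(** The strict bound leaves a margin by continuity: the clipped solution still solves the cubic
    equation on an open interval containing 0 and [t], as [solution] demands. *)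
Lemma flow_at_phi N l t w x : 0 < N ->
  (forall s, Num.min 0 t <= s <= Num.max 0 t ->
    `|Phi N l s w x| < N) ->
  flow_at sigma (cubic_family a1 a2 a3 l) t w x (Phi N l t w x).
Proof.
move=> N0 lt_N; apply/flow_atP.
pose u s := Phi N l s w x.
have near_in s0 : `|u s0| < N -> exists2 e, 0 < e &
    forall s, `|s0 - s| < e -> `|u s| < N.
  move=> us0; have uc : {for s0, continuous (fun s => `|u s|)}.
    by apply: cvg_norm; exact: (continuous_phi_time S).
  have : \forall s \near s0, `|u s| < N by exact: (cvgr_lt _ uc).
  by move=> /nbhs_ballP[e /= e0 eu]; exists e => // s ss; exact: eu.
have mem0 : Num.min 0 t <= 0 <= Num.max 0 t.
  by case: (leP 0 t) => [->|/ltW ->]; rewrite lexx.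
have memt : Num.min 0 t <= t <= Num.max 0 t.
  by case: (leP 0 t) => [->|/ltW ->]; rewrite lexx.
have [e0 e00 ue0] := near_in 0 (lt_N 0 mem0).
have [et et0 uet] := near_in t (lt_N t memt).
pose e := Num.min e0 et.
have e_gt0 : 0 < e by rewrite lt_min e00.
have ee0 : e <= e0 by rewrite ge_min lexx.
have eet : e <= et by rewrite ge_min lexx orbT.
exists `]Num.min 0 t - e, Num.max 0 t + e[%classic, u.
have uN s : `]Num.min 0 t - e, Num.max 0 t + e[%classic s -> `|u s| < N.
  rewrite /= in_itv/= => /andP[s1 s2].
  have [sm|sm] := leP (Num.min 0 t) s; have [sM|sM] := leP s (Num.max 0 t).
  - by apply: lt_N; rewrite sm.
  - move: sM s2 {sm s1}; case: (leP 0 t) => _ sM s2; [apply: uet|apply: ue0];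
      by rewrite distrC ger0_norm ?subr_ge0 1?ltW//; lra.
  - move: sm s1 {sM s2}; case: (leP 0 t) => _ sm s1; [apply: ue0|apply: uet];
      by rewrite ger0_norm ?subr_ge0 1?ltW//; lra.
  - have : Num.min 0 t <= Num.max 0 t by case: (leP 0 t) => // /ltW.
    by lra.
split => //; last first.
  by rewrite /= in_itv/=; case/andP: memt => m1 m2; apply/andP; split; lra.
split.
- exact: itv_open.
- exact: interval_is_interval.
- by rewrite /= in_itv/=; case/andP: mem0 => m1 m2; apply/andP; split; lra.
- exact: (phi0 S).
- move=> s Is; rewrite -(@cubic_trunc_id _ _ _ _ _ N) ?ltW ?uN//.
  exact: (is_derive_phi S).
Qed.

(** Here the bound is not strict, so the open interval is taken from a solution already known to
    exist; this serves orbits of compact invariant sets and orbits given by hyperbolicity. *)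
Lemma flow_at_le_phi N l t w x : 0 < N ->
  (forall s, Num.min 0 t <= s <= Num.max 0 t ->
    exists2 y, flow_at sigma (cubic_family a1 a2 a3 l) s w x y & `|y| <= N) ->
  flow_at sigma (cubic_family a1 a2 a3 l) t w x (Phi N l t w x).
Proof.
move=> N0 H.
have memt : Num.min 0 t <= t <= Num.max 0 t.
  by case: (leP 0 t) => [->|/ltW ->]; rewrite lexx.
have [y /flow_atP[I [u [su It uy]]] _] := H t memt.
rewrite -(solution_phi N0 su It); first by apply/flow_atP; exists I, u.
move=> s st; have [z zs zN] := H s st.
suff -> : u s = z by [].
apply: flow_at_uniq zs; apply/flow_atP; exists I, u; split => //.
exact: between0 (sol_itv su) (sol_dom0 su) It st.
Qed.

Lemma complete_flow_at l w (u : R -> R) t :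
  (forall s, is_derive s (1 : R) u (cubic_family a1 a2 a3 l (sigma s w) (u s))) ->
  flow_at sigma (cubic_family a1 a2 a3 l) t w (u 0) (u t).
Proof.
move=> ud; apply/flow_atP; exists setT, u; split => //; split => //.
exact: openT.
Qed.

Lemma flow_at_opp l t w x y : flow_at sigma (cubic_family a1 a2 a3 l) t w x y ->
  exists I u, [/\ solution sigma (cubic_family a1 (fun w => - a2 w) a3 l) w (- x) I u,
    I t & u t = - y].
Proof.
move=> /flow_atP[I [u [[Io Ii I0 u0 ud] It uy]]].
exists I, (fun s => - u s); split; rewrite ?uy//; split; rewrite ?u0// => s Is.
apply: is_derive_eq (is_derive_oppf (ud s Is)) _.
by rewrite /cubic_family; ring.
Qed.

End MaximalSolutions.

Lemma cubic_setting_opp {R : realType} {Omega : pointedMetricType R}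
  (sigma : R -> Omega -> Omega) (a1 a2 a3 : Omega -> R) :
  cubic_setting sigma a1 a2 a3 -> cubic_setting sigma a1 (fun w => - a2 w) a3.
Proof. by case=> b c1 c2 c3 p; split => //; exact: continuous_oppf. Qed.

Lemma flow_at_reflect {R : realType} {Omega : pointedMetricType R}
  (sigma : R -> Omega -> Omega) (a1 a2 a3 : Omega -> R) l t w x y :
  cubic_setting sigma a1 a2 a3 ->
  flow_at sigma (cubic_family a1 (fun w => - a2 w) a3 l) t w (- x) (- y) <->
  flow_at sigma (cubic_family a1 a2 a3 l) t w x y.
Proof.
move=> S; have S' := cubic_setting_opp S; split=> H.
  apply/(flow_atP S); have := flow_at_opp S' H; rewrite !opprK.
  by rewrite (_ : (fun w => - - a2 w) = a2)//; apply/funext => v; rewrite opprK.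
by apply/(flow_atP S'); exact: flow_at_opp H.
Qed.

(** * The upper boundary of the attractor *)

Section UpperBoundary.
Context {R : realType} {Omega : pointedMetricType R}.
Variables (sigma : R -> Omega -> Omega) (a1 a2 a3 : Omega -> R).
Local Notation Phi := (phi sigma a1 a2 a3).
Implicit Types (l N M x y t s : R) (w : Omega).

Definition dissipative l M := 0 < M /\ exists2 eta, 0 < eta &
  forall w x, M <= `|x| -> cubic_rate a1 a2 a3 l w x <= - eta.

Definition radius l : R := xget 1 (dissipative l).

(** Pullback: the value at [w] of the solution started on the absorbing level [radius l] a time [t]
    earlier. It does not increase with [t], so the infimum [upper] is its limit. *)
Definition upper_at l t w : R :=
  Phi (radius l + 1) l t (sigma (- t) w) (radius l).

Definition upper l w : R := inf [set upper_at l t w | t in [set t | 0 <= t]].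

Hypothesis S : cubic_setting sigma a1 a2 a3.
Let base := cubic_base S.

Lemma radius_dissipative l : dissipative l (radius l).
Proof.
rewrite /radius; case: xgetP => [M _ //|H]; exfalso.
have [B B0 HB] := coefficient_bound S.
have [r r0 ar] := leading_coefficient_gap S.
pose C := B + `|l|.
have C0 : 0 < C by rewrite ltr_pwDl.
(* Chosen so that [r M = r + 2 C], which leaves the rate [- r] once the linear and constant terms of
   the rate are absorbed. *)
pose M := 1 + 2 * C / r.
have Cr : 0 < C / r by rewrite divr_gt0.
have M0 : 1 <= M by rewrite /M; lra.
apply: (H M); split; first by lra.
exists r => // w x Mx.
have [h1 h2 h3] := HB w; have r3 := ar w.
set z := `|x| in Mx; have zz : x ^+ 2 = z ^+ 2 by rewrite real_normK// num_real.
have z1 : 1 <= z by lra.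
have rz : r * z >= r + 2 * C.
  have : r * M <= r * z by rewrite ler_wpM2l// ltW.
  by rewrite (_ : r * M = r + 2 * C)// /M; field; rewrite gt_eqF.
have e1 : a2 w * x <= C * z.
  rewrite (le_trans (ler_norm _))// normrM ler_wpM2r//.
  by rewrite (le_trans h2)// /C lerDl.
have e2 : a1 w + l <= C.
  by rewrite (le_trans (ler_norm _))// (le_trans (ler_normD _ _))// /C lerD2r.
have e3 : r * z ^+ 2 <= a3 w * x ^+ 2 by rewrite zz ler_wpM2r// sqr_ge0.
have e4 : (r + 2 * C) * z <= r * z ^+ 2.
  by rewrite expr2 mulrA ler_wpM2r// (le_trans ler01).
have e5 : (r + C) * 1 <= (r + C) * z by rewrite ler_wpM2l// addr_ge0// ltW.
by rewrite /cubic_rate mulNr; lra.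
Qed.

Lemma radius_gt0 l : 0 < radius l.
Proof. by have [] := radius_dissipative l. Qed.

Lemma radius1_gt0 l : 0 < radius l + 1.
Proof. by rewrite addr_gt0// radius_gt0. Qed.

Lemma trunc_compare N l w (u u' v v' : R -> R) t : 0 < N -> 0 <= t ->
  (forall s, 0 <= s <= t -> is_derive s (1 : R) u (u' s)) ->
  (forall s, 0 <= s <= t -> is_derive s (1 : R) v (v' s)) ->
  (forall s, 0 <= s <= t -> cubic_trunc a1 a2 a3 N l (sigma s w) (u s) <= u' s) ->
  (forall s, 0 <= s <= t -> v' s <= cubic_trunc a1 a2 a3 N l (sigma s w) (v s)) ->
  v 0 <= u 0 -> v t <= u t.
Proof.
move=> N0 t0 ud vd uu vv; have [K K0 HK] := cubic_trunc_lip S l N0.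
move=> uv0; rewrite -subr_ge0.
have {}uv0 : 0 <= u 0 - v 0 by rewrite subr_ge0.
apply: (@comparison _ (fun s => u s - v s) (fun s => u' s - v' s) K 0 t) => // s st.
  by apply: is_derive_subf; [exact: ud|exact: vd].
have := HK (sigma s w) (u s) (v s); rewrite ler_norml mulNr => /andP[h _].
by apply: (le_trans h); rewrite lerB ?uu ?vv.
Qed.

Lemma trunc_const_le N l w X : 0 < X -> X <= N ->
  cubic_rate a1 a2 a3 l w X <= 0 -> cubic_trunc a1 a2 a3 N l w X <= 0.
Proof.
move=> X0 XN h; rewrite cubic_trunc_id ?gtr0_norm// cubic_familyE.
by rewrite pmulr_lle0.
Qed.

Lemma phi_barrier N l X t w x : 0 < X -> X <= N -> 0 <= t ->
  (forall w, cubic_rate a1 a2 a3 l w X <= 0) -> x <= X ->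
  Phi N l t w x <= X.
Proof.
move=> X0 XN t0 rX xX; have N0 : 0 < N by exact: lt_le_trans XN.
apply: (@trunc_compare N l w (fun=> X) (fun=> 0)
  (fun s => Phi N l s w x)
  (fun s => cubic_trunc a1 a2 a3 N l (sigma s w) (Phi N l s w x)) t)
  => //.
- by move=> s _; exact: (is_derive_phi S).
- by move=> s _; exact: trunc_const_le.
- by rewrite (phi0 S).
Qed.

(** A solution that ends above [X] was above [X] all the time, since that level cannot be crossed
    upward; so the rate [- eta] acts on the whole of [[0, t]]. *)
Lemma phi_decay N l X eta B t w x : 0 < X -> X <= N -> 0 < eta -> 0 <= t ->
  (forall w x, X <= x -> cubic_rate a1 a2 a3 l w x <= - eta) ->
  0 <= B -> x <= B -> x <= N ->
  Phi N l t w x <= Num.max X (B * expR (- eta * t)).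
Proof.
move=> X0 XN eta0 t0 rX B0 xB xN; have N0 : 0 < N by exact: lt_le_trans XN.
have rate_le0 y : X <= y -> forall w, cubic_rate a1 a2 a3 l w y <= 0.
  by move=> Xy v; rewrite (le_trans (rX _ _ Xy))// oppr_le0 ltW.
pose u s := Phi N l s w x.
have [utX|Xut] := leP (u t) X; first by rewrite le_max utX.
have uX s : 0 <= s <= t -> X < u s.
  move=> /andP[s0 st]; rewrite ltNge; apply/negP => usX.
  move: Xut; rewrite ltNge => /negP; apply.
  rewrite /u -(subrK s t) addrC (phiD S)//.
  by apply: phi_barrier; rewrite ?subr_ge0//; exact: rate_le0.
have uN s : 0 <= s -> u s <= N.
  by move=> s0; apply: phi_barrier => //; exact: rate_le0.
rewrite le_max; apply/orP; right.
apply: (@le_trans _ _ (u 0 * expR (- eta * (t - 0)))); last first.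
  by rewrite subr0 /u (phi0 S)// ler_wpM2r ?expR_ge0.
apply: (@gronwall_const_le _ u (fun s => cubic_trunc a1 a2 a3 N l (sigma s w) (u s))).
- exact: t0.
- by move=> s _; exact: (is_derive_phi S).
- move=> s st; have Xu := uX s st; have u0 := lt_trans X0 Xu.
  case/andP: (st) => s0 _.
  rewrite cubic_trunc_id ?gtr0_norm ?uN// cubic_familyE ler_wpM2r ?(ltW u0)//.
  by apply: rX; exact: ltW.
Qed.

Lemma rate_radius_le0 l y w : radius l <= y -> cubic_rate a1 a2 a3 l w y <= 0.
Proof.
have [r0 [eta eta0 H]] := radius_dissipative l => ry.
apply: le_trans (H w y (le_trans ry (ler_norm y))) _.
by rewrite oppr_le0 ltW.
Qed.

Lemma rate_radiusN_le0 l y w : radius l <= y -> cubic_rate a1 a2 a3 l w (- y) <= 0.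
Proof.
have [r0 [eta eta0 H]] := radius_dissipative l => ry.
apply: le_trans (H w (- y) _) _; last by rewrite oppr_le0 ltW.
by rewrite normrN (le_trans ry)// ler_norm.
Qed.

Lemma phi_bounded N l X t w x : radius l <= X -> X <= N -> 0 <= t ->
  `|x| <= X -> `|Phi N l t w x| <= X.
Proof.
move=> rX XN t0; rewrite !ler_norml => /andP[x1 x2].
have X0 : 0 < X by exact: lt_le_trans (radius_gt0 l) rX.
have N0 : 0 < N by exact: lt_le_trans XN.
apply/andP; split; last first.
  by apply: phi_barrier => // v; exact: rate_radius_le0.
apply: (@trunc_compare N l w (fun s => Phi N l s w x)
  (fun s => cubic_trunc a1 a2 a3 N l (sigma s w) (Phi N l s w x))
  (fun=> - X) (fun=> 0) t) => //.
- by move=> s _; exact: (is_derive_phi S).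
- move=> s _; rewrite cubic_trunc_id ?normrN ?gtr0_norm// cubic_familyE.
  by rewrite mulrN oppr_ge0 pmulr_lle0// rate_radiusN_le0.
- by rewrite (phi0 S).
Qed.

Lemma flow_at_forward N l X t w x : radius l <= X -> X < N -> 0 <= t -> `|x| <= X ->
  flow_at sigma (cubic_family a1 a2 a3 l) t w x (Phi N l t w x).
Proof.
move=> rX XN t0 xX; apply: (flow_at_phi S).
  exact: lt_trans (lt_le_trans (radius_gt0 l) rX) XN.
move=> s; rewrite min_l// => /andP[s0 _].
exact: le_lt_trans (phi_bounded w rX (ltW XN) s0 xX) XN.
Qed.

Lemma phi_trunc_indep N N' l X t w x : radius l <= X -> X <= N -> X <= N' -> 0 <= t ->
  `|x| <= X -> Phi N l t w x = Phi N' l t w x.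
Proof.
move=> rX XN XN' t0 xX; have X0 := lt_le_trans (radius_gt0 l) rX.
apply: (@phi_uniq _ _ _ _ _ _ S _ _ _ _ (fun t => Phi N l t w x)).
- exact: lt_le_trans XN'.
- by rewrite (phi0 S)//; exact: lt_le_trans XN.
move=> s; rewrite min_l// => /andP[s0 _].
have uX := phi_bounded w rX XN s0 xX.
rewrite cubic_trunc_id ?(le_trans uX)//.
rewrite -(cubic_trunc_id a1 a2 a3 l _ (le_trans uX XN)).
by apply: (is_derive_phi S); exact: lt_le_trans XN.
Qed.

Lemma norm_radius l : `|radius l| <= radius l.
Proof. by rewrite gtr0_norm// radius_gt0. Qed.

Lemma radius_le_trunc l : radius l <= radius l + 1.
Proof. by rewrite lerDl. Qed.

Lemma upper_at_ge0 l t w : 0 <= upper_at l t w.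
Proof.
rewrite -[leLHS](phi_at0 S l t (sigma (- t) w) (radius1_gt0 l)).
by apply: (phi_le S); [exact: radius1_gt0|exact: ltW (radius_gt0 l)].
Qed.

Lemma upper_at_le_radius l t w : 0 <= t -> upper_at l t w <= radius l.
Proof.
move=> t0; apply: le_trans (ler_norm _) _.
exact: phi_bounded (radius_le_trunc l) t0 (norm_radius l).
Qed.

Lemma upper_at_shift l s t w : upper_at l (t + s) (sigma s w)
  = Phi (radius l + 1) l s w (upper_at l t w).
Proof.
have e : sigma (- (t + s)) (sigma s w) = sigma (- t) w.
  by rewrite -(flowD (base_flow base)) opprD subrK.
by rewrite /upper_at e (phiD S) ?radius1_gt0// (sigmaNK base).
Qed.

(** The solution that started earlier on the absorbing level is at or below that level at the later
    starting time; order preservation does the rest. *)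
Lemma upper_at_nonincreasing l s t w : 0 <= s -> s <= t ->
  upper_at l t w <= upper_at l s w.
Proof.
move=> s0 st; have := upper_at_shift l s 0 (sigma (- s) w).
have := upper_at_shift l s (t - s) (sigma (- s) w).
rewrite subrK add0r (sigmaNK base) => -> ->.
apply: (phi_le S); first exact: radius1_gt0.
rewrite /upper_at oppr0 (phi0 S) ?radius1_gt0//.
by apply: upper_at_le_radius; rewrite subr_ge0.
Qed.

Lemma has_inf_upper_at l w : has_inf [set upper_at l t w | t in [set t | 0 <= t]].
Proof.
split; first by exists (upper_at l 0 w); exists 0 => //=.
by exists 0 => _ [t _ <-]; exact: upper_at_ge0.
Qed.

Lemma upper_le_at l t w : 0 <= t -> upper l w <= upper_at l t w.
Proof. by move=> t0; apply: (ge_inf (has_inf_upper_at l w).2); exists t. Qed.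

Lemma upper_greatest l w z : (forall t, 0 <= t -> z <= upper_at l t w) -> z <= upper l w.
Proof.
move=> H; apply: lb_le_inf => [|_ [t t0 <-]]; [exact: (has_inf_upper_at l w).1|exact: H].
Qed.

Lemma upper_lt l w z : upper l w < z -> exists2 t, 0 <= t & upper_at l t w < z.
Proof.
move=> uz; apply: contrapT => H.
move: uz; rewrite ltNge => /negP; apply; apply: upper_greatest => t t0.
by rewrite leNgt; apply/negP => h; apply: H; exists t.
Qed.

Lemma upper_ge0 l w : 0 <= upper l w.
Proof. by apply: upper_greatest => t _; exact: upper_at_ge0. Qed.

Lemma upper_le_radius l w : upper l w <= radius l.
Proof. exact: le_trans (upper_le_at l w (lexx 0)) (upper_at_le_radius l w (lexx 0)). Qed.

Lemma norm_upper l w : `|upper l w| <= radius l.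
Proof. by rewrite ger0_norm ?upper_ge0// upper_le_radius. Qed.

(** For the second inequality a strict gap is carried back by the inverse flow, where it puts some
    [upper_at l t w] below the preimage of [upper l (sigma s w)]; carrying this forward contradicts
    the infimum at [sigma s w]. *)
Lemma phi_upper_ge0 l s w : 0 <= s ->
  Phi (radius l + 1) l s w (upper l w) = upper l (sigma s w).
Proof.
move=> s0; have N0 := radius1_gt0 l; apply: le_anti; apply/andP; split.
  apply: upper_greatest => t t0.
  apply: le_trans (upper_at_nonincreasing l _ t0 (_ : t <= t + s)); last by rewrite lerDl.
  by rewrite upper_at_shift; apply: (phi_le S) => //; exact: upper_le_at.
rewrite leNgt; apply/negP => lt.
have := phi_lt S l (- s) (sigma s w) N0 lt; rewrite (phiK S)// => /upper_lt[t t0].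
move=> /(phi_lt S l s w N0); rewrite -upper_at_shift.
rewrite -{2}(sigmaK base s w) (phiNK S)// ltNge upper_le_at//.
by rewrite addr_ge0.
Qed.

Lemma phi_upper l s w :
  Phi (radius l + 1) l s w (upper l w) = upper l (sigma s w).
Proof.
have [s0|s0] := leP 0 s; first exact: phi_upper_ge0.
have Ns0 : 0 <= - s by rewrite oppr_ge0 ltW.
have := phi_upper_ge0 l (sigma s w) Ns0; rewrite (sigmaK base) => <-.
have := phiK S l (- s) (sigma s w) (upper l (sigma s w)) (radius1_gt0 l).
by rewrite opprK (sigmaK base).
Qed.

Lemma is_derive_upper l w t : is_derive t (1 : R) (fun t => upper l (sigma t w))
  (cubic_family a1 a2 a3 l (sigma t w) (upper l (sigma t w))).
Proof.
have -> : (fun t => upper l (sigma t w))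
  = (fun t => Phi (radius l + 1) l t w (upper l w)).
  by apply/funext => s; rewrite phi_upper.
rewrite -(@cubic_trunc_id _ _ _ _ _ (radius l + 1)); last first.
  exact: le_trans (norm_upper _ _) (radius_le_trunc l).
by rewrite -phi_upper; apply: (is_derive_phi S); exact: radius1_gt0.
Qed.

Lemma equilibrium_upper l : equilibrium sigma (cubic_family a1 a2 a3 l) (upper l).
Proof.
move=> w t; have := @complete_flow_at _ _ _ _ _ _ S l w (fun t => upper l (sigma t w)) t.
by rewrite (flow0 (base_flow base)); apply => s; exact: is_derive_upper.
Qed.

Lemma near_upper_at l t w x : 0 <= t -> upper_at l t w < x ->
  \forall p \near (w, x), upper_at l t p.1 < p.2.
Proof.
move=> t0 ux; pose e := (x - upper_at l t w) / 2.
have e0 : 0 < e by rewrite divr_gt0// subr_gt0.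
have [[P Q] /= [Pw Qx] PQ] := near_phi S l (sigma (- t) w) (radius l) (radius1_gt0 l) t0 e0.
have xe : \forall x' \near x, x - e < x'.
  by apply: lt_nbhsr; rewrite gtrBl.
exists (sigma (- t) @^-1` P, [set x' | x - e < x']).
  by split => //=; exact: (continuous_time_map base (t := - t)).
move=> [w' x'] [/= Pw' ex'].
have := PQ (sigma (- t) w', radius l) (conj Pw' (nbhs_singleton Qx)).
rewrite /= -!/(upper_at _ _ _) ltr_norml => /andP[_ h].
by apply: lt_trans ex'; rewrite /e in h *; lra.
Qed.

Lemma near_upper_pair l w x : upper l w < x ->
  \forall p \near (w, x), upper l p.1 < p.2.
Proof.
move=> /upper_lt[t t0 /(near_upper_at t0)]; apply: filterS => p.
by apply: le_lt_trans; exact: upper_le_at.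
Qed.

Lemma near_upper l w x : upper l w < x -> \forall w' \near w, upper l w' < x.
Proof.
move=> /upper_lt[t t0 /(near_upper_at t0)[[P Q] /= [Pw Qx] PQ]].
apply: filterS Pw => w' Pw'; apply: le_lt_trans (upper_le_at _ _ t0) _.
exact: (PQ (w', x) (conj Pw' (nbhs_singleton Qx))).
Qed.

(** [T] is long enough for a solution starting at [L] to come down to the radius, by
    [1 + x <= exp x]; from then on it lies below the one started on the radius. *)
Lemma absorb l L : exists2 T, 0 <= T & forall N t w, radius l <= N -> L <= N -> 0 <= t ->
  Phi N l (T + t) (sigma (- (T + t)) w) L <= upper_at l t w.
Proof.
have [r0 [eta eta0 H]] := radius_dissipative l.
pose T := `|L| / (eta * radius l).
have T0 : 0 <= T by rewrite divr_ge0// mulr_ge0 ?ltW.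
exists T => [//|N t w rN LN t0].
have N0 : 0 < N by exact: lt_le_trans rN.
rewrite (phiD S)// -(flowD (base_flow base)) opprD addrA addrN add0r.
rewrite /upper_at (@phi_trunc_indep (radius l + 1) N l (radius l))//; last 2 first.
- exact: radius_le_trunc.
- exact: norm_radius.
apply: (phi_le S) => //.
apply: (le_trans (@phi_decay N l (radius l) eta `|L| T _ L _ _ _ _ _ _ _ _)) => //.
- by move=> v x rx; apply: H; rewrite (le_trans rx)// ler_norm.
- exact: ler_norm.
rewrite ge_max lexx/= mulNr expRN ler_pdivrMr ?expR_gt0//.
apply: (@le_trans _ _ (radius l * (1 + eta * T))).
  rewrite (_ : _ * _ = radius l + `|L|) ?lerDr ?ltW//.
  by rewrite /T; field; rewrite !gt_eqF.
by rewrite ler_wpM2l ?(ltW r0)// expR_ge1Dx.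
Qed.

(** The pointwise half of attraction: a pair above the graph is unreachable from a bounded set after
    a time that serves a whole neighbourhood, which is the form a covering argument needs. *)
Lemma upper_escape l w x L : upper l w < x ->
  exists T, \forall p \near (w, x), forall t, T <= t -> forall x0 y, `|x0| <= L ->
    flow_at sigma (cubic_family a1 a2 a3 l) t (sigma (- t) p.1) x0 y -> y < p.2.
Proof.
move=> /upper_lt[s s0 us]; have [T T0 HT] := absorb l L.
exists (T + s); apply: filterS (near_upper_at s0 us) => -[w' x'] /= h t Tt x0 y xL.
pose X := Num.max (radius l) L.
have rX : radius l <= X by rewrite le_max lexx.
have LX : L <= X by rewrite le_max lexx orbT.
have X1 : X < X + 1 by rewrite ltrDl.
have t0 : 0 <= t by rewrite (le_trans _ Tt)// addr_ge0.
have xX : `|x0| <= X by exact: le_trans LX.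
have /(flow_at_uniq S) := flow_at_forward (sigma (- t) w') rX X1 t0 xX.
move=> /[apply] <-; apply: le_lt_trans h.
have N0 : 0 < X + 1 by rewrite (lt_trans _ X1)// (lt_le_trans (radius_gt0 l)).
apply: le_trans (phi_le S l t (sigma (- t) w') N0 (le_trans (ler_norm _) xL)) _.
have tT0 : 0 <= t - T by rewrite subr_ge0 (le_trans _ Tt)// lerDl.
have := HT (X + 1) (t - T) w' (le_trans rX (ltW X1)) (le_trans LX (ltW X1)) tT0.
rewrite (addrC T) subrK => /le_trans; apply; apply: upper_at_nonincreasing => //.
by rewrite lerBrDr addrC.
Qed.

(** At every past time [v] is below [B], and the solution started at [B] is absorbed into the
    pullback family; comparison carries this to time 0. Constants, orbits of invariant sets and
    boundaries for smaller parameters are all placed below [upper] in this way. *)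
Lemma lower_solution_le_upper l w (v v' : R -> R) B :
  (forall t, is_derive t (1 : R) v (v' t)) -> (forall t, 0 <= v t <= B) ->
  (forall t, v' t <= cubic_family a1 a2 a3 l (sigma t w) (v t)) ->
  v 0 <= upper l w.
Proof.
move=> vd vB vv; have [T T0 HT] := absorb l B.
apply: upper_greatest => t t0; pose N := Num.max (radius l) B.
have rN : radius l <= N by rewrite le_max lexx.
have BN : B <= N by rewrite le_max lexx orbT.
have N0 : 0 < N by exact: lt_le_trans (radius_gt0 l) rN.
apply: le_trans (HT N t w rN BN t0).
pose s0 := - (T + t).
rewrite -[0](addNr (T + t)) -/s0 addrC.
have Tt0 : 0 <= T + t by rewrite addr_ge0.
apply: (@trunc_compare N l (sigma s0 w)
  (fun s => Phi N l s (sigma s0 w) B)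
  (fun s => cubic_trunc a1 a2 a3 N l (sigma s (sigma s0 w))
    (Phi N l s (sigma s0 w) B))
  (fun s => v (s + s0)) (fun s => v' (s + s0)) (T + t)) => //.
- by move=> s _; exact: (is_derive_phi S).
- by move=> s _; apply: is_derive_translate.
- move=> s _; rewrite -(flowD (base_flow base)) cubic_trunc_id ?vv//.
  by have /andP[v0 vB'] := vB (s + s0); rewrite ger0_norm// (le_trans vB').
- by rewrite add0r (phi0 S)//; case/andP: (vB s0).
Qed.

End UpperBoundary.

(** * The global attractor *)

Section Attractor.
Context {R : realType} {Omega : pointedMetricType R}.
Variables (sigma : R -> Omega -> Omega) (a1 a2 a3 : Omega -> R).
Local Notation Phi := (phi sigma a1 a2 a3).
Implicit Types (l N M x y t s : R) (w : Omega).

Definition lower l w : R := - upper sigma a1 (fun w => - a2 w) a3 l w.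

Definition attractor_set l : set (Omega * R) :=
  [set p | lower l p.1 <= p.2 <= upper sigma a1 a2 a3 l p.1].

Hypothesis S : cubic_setting sigma a1 a2 a3.
Let base := cubic_base S.
Let S' := cubic_setting_opp S.
Let up := upper sigma a1 a2 a3.
Let h := cubic_family a1 a2 a3.

Lemma lower_le0 l w : lower l w <= 0.
Proof. by rewrite oppr_le0 (upper_ge0 S'). Qed.

Lemma is_derive_lower l w t : is_derive t (1 : R) (fun t => lower l (sigma t w))
  (h l (sigma t w) (lower l (sigma t w))).
Proof.
apply: is_derive_eq (is_derive_oppf (is_derive_upper S' l w t)) _.
by rewrite /h /lower /cubic_family; ring.
Qed.

Lemma near_lower_pair l w x : x < lower l w ->
  \forall p \near (w, x), p.2 < lower l p.1.
Proof.
rewrite ltrNr => /(near_upper_pair S')[[P Q] /= [Pw Qx] H].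
exists (P, -%R @^-1` Q) => /=; first by split => //; exact: (cvgN (@cvg_id _ (nbhs x)) Qx).
by move=> [w' x'] [/= Pw' Qx']; rewrite ltrNr; exact: (H (w', - x')).
Qed.

Lemma equilibrium_lower l : equilibrium sigma (h l) (lower l).
Proof.
by move=> w t; apply/(flow_at_reflect _ _ _ _ _ S); rewrite !opprK; exact: equilibrium_upper.
Qed.

Lemma lower_escape l w x L : x < lower l w ->
  exists T, \forall p \near (w, x), forall t, T <= t -> forall x0 y, `|x0| <= L ->
    flow_at sigma (h l) t (sigma (- t) p.1) x0 y -> p.2 < y.
Proof.
rewrite ltrNr => /(upper_escape S' L)[T [[P Q] /= [Pw Qx] H]].
exists T, (P, -%R @^-1` Q) => /=.
  by split => //; exact: (cvgN (@cvg_id _ (nbhs x)) Qx).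
move=> [w' x'] [/= Pw' Qx'] t Tt x0 y x0L /(flow_at_reflect _ _ _ _ _ S) f.
have := H (w', - x') (conj Pw' Qx') t Tt (- x0) (- y).
by rewrite normrN /= ltrN2; apply.
Qed.

Definition outer_bound l : R :=
  Num.max (radius a1 a2 a3 l) (radius a1 (fun w => - a2 w) a3 l).

Lemma outer_bound_gt0 l : 0 < outer_bound l.
Proof. by rewrite lt_max (radius_gt0 S). Qed.

Lemma attractor_set_bounded l w x : attractor_set l (w, x) -> `|x| <= outer_bound l.
Proof.
move=> /andP[/= x1 x2]; rewrite ler_norml; apply/andP; split.
  rewrite (le_trans _ x1)// lerN2 (le_trans (upper_le_radius S' _ _))//.
  by rewrite le_max lexx orbT.
by rewrite (le_trans x2)// (le_trans (upper_le_radius S _ _))// le_max lexx.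
Qed.

Lemma bounded_complete_phi N l w (u : R -> R) t : 0 < N ->
  (forall s, is_derive s (1 : R) u (h l (sigma s w) (u s))) ->
  (forall s, `|u s| <= N) -> u t = Phi N l t w (u 0).
Proof.
move=> N0 ud uN; apply: (phi_uniq S) => // s _.
by rewrite cubic_trunc_id ?uN.
Qed.

Lemma attractor_set_phi l w x t : attractor_set l (w, x) ->
  attractor_set l (sigma t w, Phi (outer_bound l + 1) l t w x).
Proof.
move=> Ax; set N := outer_bound l + 1.
have N0 : 0 < N by rewrite addr_gt0// outer_bound_gt0.
have memA s : lower l (sigma s w) <= up l (sigma s w).
  exact: le_trans (lower_le0 _ _) (upper_ge0 S _ _).
have bN y : `|y| <= outer_bound l -> `|y| <= N by move=> /le_trans; apply; rewrite lerDl.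
have upE : up l (sigma t w) = Phi N l t w (up l w).
  have := @bounded_complete_phi N l w (fun t => up l (sigma t w)) t N0
    (is_derive_upper S l w).
  rewrite (flow0 (base_flow base)); apply => s; apply: bN.
  by apply: (@attractor_set_bounded l (sigma s w)); rewrite /attractor_set/= lexx memA.
have loE : lower l (sigma t w) = Phi N l t w (lower l w).
  have := @bounded_complete_phi N l w (fun t => lower l (sigma t w)) t N0
    (is_derive_lower l w).
  rewrite (flow0 (base_flow base)); apply => s; apply: bN.
  by apply: (@attractor_set_bounded l (sigma s w)); rewrite /attractor_set/= lexx memA.
case/andP: Ax => /= x1 x2.
by rewrite /attractor_set/= -/up upE loE !(phi_le S).
Qed.

Lemma attractor_set_invariant l : invariant_set sigma (h l) (attractor_set l).
Proof.
move=> w x Ax t; exists (Phi (outer_bound l + 1) l t w x); last exact: attractor_set_phi.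
apply: (flow_at_phi S); first by rewrite addr_gt0// outer_bound_gt0.
move=> s _; apply: le_lt_trans (attractor_set_bounded (attractor_set_phi s Ax)) _.
by rewrite ltrDl.
Qed.

Lemma compact_strip M : compact [set p : Omega * R | `|p.2| <= M].
Proof.
have -> : [set p : Omega * R | `|p.2| <= M] = [set: Omega] `*` `[- M, M].
  by apply/seteqP; split => -[w x] /=; rewrite in_itv/= -ler_norml => // -[].
by apply: compact_setX; [exact: base_compact base|exact: segment_compact].
Qed.

Lemma attractor_set_compact l : compact (attractor_set l).
Proof.
apply: (subclosed_compact _ (@compact_strip (outer_bound l))); last first.
  by move=> [w x] /attractor_set_bounded.
rewrite -openC openE => -[w x] /= /negP; rewrite negb_and -!ltNge => /orP[] H.
  by apply: filterS (near_lower_pair H) => p lt /andP[]; rewrite leNgt lt.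
by apply: filterS (near_upper_pair S H) => p lt /andP[_]; rewrite leNgt lt.
Qed.

(** A pair in the strip either belongs to the attractor, and its neighbours are [e]-close to it, or
    is unreachable from [B] after some time, together with its neighbours; covering the compact
    strip gives one time for all. *)
Lemma attractor_set_attracts l (B : set (Omega * R)) : bounded_in_ball B ->
  attracts sigma (h l) (attractor_set l) B.
Proof.
move=> [[w0 x0] [M BM]] e e0; pose L := `|x0| + `|M|.
have BL w x : B (w, x) -> `|x| <= L.
  move=> /BM[_]; rewrite /ball/= => x0x.
  rewrite -[x](subrK x0) addrC (le_trans (ler_normD _ _))// lerD2l distrC.
  by rewrite (le_trans (ltW x0x))// ler_norm.
have L0 : 0 <= L by rewrite addr_ge0.
pose X := outer_bound l + L.
have rX : radius a1 a2 a3 l <= X.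
  by rewrite (le_trans (_ : _ <= outer_bound l)) ?lerDl// le_max lexx.
have LX : L <= X by rewrite lerDr ltW// outer_bound_gt0.
have cov := (compact_near_coveringP _).1 (@compact_strip X).
pose good t (p : Omega * R) := (exists2 q, attractor_set l q & ball q e p) \/
  forall z y, `|z| <= L -> flow_at sigma (h l) t (sigma (- t) p.1) z y -> y <> p.2.
have : \forall t \near +oo, [set p : Omega * R | `|p.2| <= X] `<=` good t.
  apply: (cov _ (+oo : set_system R) good) => -[w x] _.
  have [Ax|/negP] := boolP (lower l w <= x <= up l w).
    exists (ball (w, x) e, setT) => //=.
      by split; [exact: nbhsx_ballx|exact: filterT].
    by move=> [p t] [/= bp _]; left; exists (w, x).
  move=> /negP; rewrite negb_and -!ltNge => /orP[] H.
    have [T HT] := lower_escape L H.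
    exists ([set p | forall t, T <= t -> forall z y, `|z| <= L ->
      flow_at sigma (h l) t (sigma (- t) p.1) z y -> p.2 < y], [set t | T <= t]) => /=.
      by split => //; exact: (nbhs_pinfty_ge (num_real T)).
    move=> [p t] [/= Hp Tt]; right => z y zL f e1.
    by have := Hp t Tt z y zL f; rewrite e1 ltxx.
  have [T HT] := upper_escape S L H.
  exists ([set p | forall t, T <= t -> forall z y, `|z| <= L ->
    flow_at sigma (h l) t (sigma (- t) p.1) z y -> y < p.2], [set t | T <= t]) => /=.
    by split => //; exact: (nbhs_pinfty_ge (num_real T)).
  move=> [p t] [/= Hp Tt]; right => z y zL f e1.
  by have := Hp t Tt z y zL f; rewrite e1 ltxx.
move=> [T0 [_ HT0]]; exists (Num.max 0 (T0 + 1)) => t; rewrite ge_max => /andP[t0 Tt] w x Bx.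
have X1 : X < X + 1 by rewrite ltrDl.
have xX := le_trans (BL _ _ Bx) LX.
have f := flow_at_forward S w rX X1 t0 xX.
exists (Phi (X + 1) l t w x) => //.
have T0t : T0 < t by rewrite (lt_le_trans _ Tt)// ltrDl.
have yX : `|Phi (X + 1) l t w x| <= X.
  exact: (phi_bounded S w rX (ltW X1) t0 xX).
have [[q Aq bq]|bad] := HT0 t T0t (sigma t w, Phi (X + 1) l t w x) yX.
  by exists q.
by case: (bad x _ (BL _ _ Bx) _ erefl); rewrite /= (sigmaK base).
Qed.

Lemma upper_semicontinuity l : lower_semicontinuous (fun w => (- up l w)%:E).
Proof.
move=> w x; rewrite lte_fin ltrNr => /(near_upper S) h'.
exists [set w' | up l w' < - x] => // w' /= lt.
by rewrite lte_fin ltrNr.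
Qed.

Lemma attractor_bounds l : attractor_with_bounds sigma (h l) (attractor_set l)
  (lower l) (up l).
Proof.
split => //.
- split; [exact: attractor_set_compact|exact: attractor_set_invariant|].
  exact: attractor_set_attracts.
- exact: lower_le0.
- exact: (upper_ge0 S).
- exact: equilibrium_lower.
- exact: equilibrium_upper.
- move=> w x; rewrite lte_fin ltrNr => /(near_upper S') h'.
  exists [set w' | x < lower l w'] => [|w' /= lt]; last by rewrite lte_fin.
  by apply: filterS h' => w' /=; rewrite ltrNr.
- exact: upper_semicontinuity.
Qed.

End Attractor.

(** * Compact invariant sets *)

Lemma prod_hausdorff (T U : topologicalType) :
  hausdorff_space T -> hausdorff_space U -> hausdorff_space (T * U)%type.
Proof.
move=> hT hU [x y] [x' y'] clu; congr pair.
  apply: hT => A B Ax Bx.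
  have [||[z z'] [/= Az Bz]] := clu (fst @^-1` A) (fst @^-1` B).
  - by exists (A, setT) => [|[? ?] []] //; split => //; exact: filterT.
  - by exists (B, setT) => [|[? ?] []] //; split => //; exact: filterT.
  by exists z.
apply: hU => A B Ax Bx.
have [||[z z'] [/= Az Bz]] := clu (snd @^-1` A) (snd @^-1` B).
- by exists (setT, A) => [|[? ?] []] //; split => //; exact: filterT.
- by exists (setT, B) => [|[? ?] []] //; split => //; exact: filterT.
by exists z'.
Qed.

Definition positive_set {R : realType} {Omega : Type} (K : set (Omega * R)) :=
  forall w x, K (w, x) -> 0 < x.

Definition reflect_set {R : realType} {Omega : Type} (K : set (Omega * R)) :
  set (Omega * R) := [set p | K (p.1, - p.2)].

Lemma reflect_setK {R : realType} {Omega : Type} : involutive (@reflect_set R Omega).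
Proof.
by move=> K; apply/seteqP; split => -[w x] /=; rewrite /reflect_set/= opprK.
Qed.

Section CompactInvariant.
Context {R : realType} {Omega : pointedMetricType R}.
Variables (sigma : R -> Omega -> Omega) (a1 a2 a3 : Omega -> R).
Local Notation Phi := (phi sigma a1 a2 a3).
Hypothesis S : cubic_setting sigma a1 a2 a3.
Implicit Types (l N M x y t s : R) (w : Omega) (K : set (Omega * R)).
Let base := cubic_base S.
Let h := cubic_family a1 a2 a3.

Lemma state_hausdorff : hausdorff_space (Omega * R)%type.
Proof. by apply: prod_hausdorff; [exact: metric_hausdorff|exact: Rhausdorff]. Qed.

Lemma continuous_snd_oppr : continuous (fun p : Omega * R => (p.1, - p.2)).
Proof.
move=> [w x]; exact: (cvg_pair cvg_fst (cvgN cvg_snd)).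
Qed.

Lemma compact_reflect K : compact K -> compact (reflect_set K).
Proof.
move=> cK; have -> : reflect_set K = (fun p : Omega * R => (p.1, - p.2)) @` K.
  apply/seteqP; split => [[w x] /= Kp|_ [[w x] Kp <-]].
    by exists (w, - x) => //=; rewrite opprK.
  by rewrite /reflect_set/= opprK.
apply: continuous_compact => //; apply: continuous_subspaceT.
exact: continuous_snd_oppr.
Qed.

Lemma compact_invariant_bounded K : compact K ->
  exists2 B, 0 < B & forall w x, K (w, x) -> `|x| <= B.
Proof.
move=> cK; have cS : compact (snd @` K).
  by apply: continuous_compact => //; apply: continuous_subspaceT => p; exact: cvg_snd.
have /compact_bounded[M [Mr HM]] := cS.
exists (`|M| + 1) => [|w x Kx]; first by rewrite ltr_wpDl.
apply: (HM (`|M| + 1)); last by exists (w, x).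
by rewrite (le_lt_trans (ler_norm M))// ltrDl.
Qed.

Lemma compact_invariant_complete l K B w x : 0 < B -> invariant_set sigma (h l) K ->
  (forall w x, K (w, x) -> `|x| <= B) -> K (w, x) ->
  exists u : R -> R, [/\ u 0 = x, forall t, K (sigma t w, u t),
    forall t, is_derive t (1 : R) u (h l (sigma t w) (u t)) & forall t, `|u t| <= B].
Proof.
move=> B0 Kinv KB Kx.
have f t : flow_at sigma (h l) t w x (Phi B l t w x).
  apply: (flow_at_le_phi S) => // s _.
  by have [y fy Ky] := Kinv w x Kx s; exists y => //; exact: KB Ky.
have Kphi t : K (sigma t w, Phi B l t w x).
  by have [y fy Ky] := Kinv w x Kx t; rewrite (flow_at_uniq S (f t) fy).
exists (fun t => Phi B l t w x); split => //.
- exact: (phi0 S).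
- move=> t; rewrite /h -(cubic_trunc_id a1 a2 a3 l _ (KB _ _ (Kphi t))).
  exact: (is_derive_phi S).
- by move=> t; exact: KB (Kphi t).
Qed.

(** The projection to the base is closed and contains an orbit, which is dense. *)
Lemma compact_invariant_fibers l K : compact_invariant sigma (h l) K ->
  forall w, exists x, K (w, x).
Proof.
move=> [[[w0 x0] K0] cK Kinv] w.
pose P := fst @` K.
have cP : closed P.
  apply: compact_closed; first exact: metric_hausdorff.
  by apply: continuous_compact => //; apply: continuous_subspaceT => p; exact: cvg_fst.
suff : P w by move=> [[v x] Kx <-]; exists x.
apply: contrapT => nPw.
have oP : open (~` P) by rewrite openC.
have [v [nPv [t _ tv]]] := base_minimal base w0 (ex_intro _ w nPw) oP.
apply: nPv; rewrite -tv; have [y _ Ky] := Kinv w0 x0 K0 t.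
by exists (sigma t w0, y).
Qed.

Lemma compact_invariantI l K K' : compact_invariant sigma (h l) K ->
  compact_invariant sigma (h l) K' -> K `&` K' !=set0 ->
  compact_invariant sigma (h l) (K `&` K').
Proof.
move=> [_ cK iK] [_ cK' iK'] n0; split => //.
  by apply: compact_closedI => //; apply: compact_closed cK'; exact: state_hausdorff.
move=> w x [Kx Kx'] t; have [y fy Ky] := iK w x Kx t; have [y' fy' Ky'] := iK' w x Kx' t.
by exists y => //; split => //; rewrite (flow_at_uniq S fy fy').
Qed.

Lemma minimal_sets_meet l K K' : minimal_set sigma (h l) K -> minimal_set sigma (h l) K' ->
  K `&` K' !=set0 -> K = K'.
Proof.
move=> [cK mK] [cK' mK'] n0; have cI := compact_invariantI cK cK' n0.
by rewrite -(mK _ cI)//; rewrite -[RHS](mK' _ cI).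
Qed.

(** A compact invariant subset meets every fibre, and the fibres of a graph are points. *)
Lemma minimal_graph l (b : Omega -> R) : continuous b ->
  equilibrium sigma (h l) b -> minimal_set sigma (h l) (graph_of b).
Proof.
move=> bc be; split.
  split; first by exists (point, b point).
    have -> : graph_of b = (fun w => (w, b w)) @` setT.
      apply/seteqP; split => [[w x]|_ [w _ <-]] //; rewrite /graph_of/= => ->.
      by exists w.
    apply: continuous_compact; last exact: base_compact base.
    by apply: continuous_subspaceT => w; exact: (cvg_pair cvg_id (bc w)).
  by move=> w x; rewrite /graph_of/= => -> t; exists (b (sigma t w)).
move=> K' cK' K'b; apply/seteqP; split => // -[w x]; rewrite /graph_of/= => ->.
have [y Ky] := compact_invariant_fibers cK' w.
by have := K'b _ Ky; rewrite /graph_of/= => <-.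
Qed.

Lemma minimal_M0 l : minimal_set sigma (h l) M0.
Proof.
apply: minimal_graph => [w|w t]; first exact: cvg_cst.
apply: (@complete_flow_at _ _ _ _ _ _ S l w (fun=> 0) t) => s.
rewrite cubic_familyE mulr0; exact: is_derive_cstf.
Qed.

Lemma minimal_nonzero l K : minimal_set sigma (h l) K -> K <> M0 ->
  forall w x, K (w, x) -> x != 0.
Proof.
move=> mK K0 w x Kx; apply/eqP => x0; apply: K0.
by apply: minimal_sets_meet mK (minimal_M0 l) _; exists (w, x).
Qed.

(** The zero solution cannot be crossed, so the part of [K] in [x >= 0] is again compact and
    invariant; if nonempty, it is all of [K] by minimality. *)
Lemma minimal_trichotomy l K : minimal_set sigma (h l) K ->
  [\/ K = M0, positive_set K | positive_set (reflect_set K)].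
Proof.
move=> mK; have [->|K0] := pselect (K = M0); first by constructor 1.
have nz := minimal_nonzero mK K0; have [[_ cK iK] min] := mK.
have [[[w x] [Kx x0]]|np] := pselect (K `&` [set p | 0 <= p.2] !=set0); last first.
  constructor 3 => w x Kx; rewrite -oppr_lt0 ltNge; apply/negP => x0.
  by apply: np; exists (w, - x).
constructor 2 => v y Ky.
have Kp : compact_invariant sigma (h l) (K `&` [set p | 0 <= p.2]).
  split; first by exists (w, x).
    apply: compact_closedI => //.
    have snd_c : continuous (snd : Omega * R -> R) by move=> p; exact: cvg_snd.
    have /continuous_closedP/(_ [set y : R | 0 <= y]) := snd_c.
    by apply; exact: closed_ge.
  move=> u z [Kz z0] t; have [B B0 KB] := compact_invariant_bounded cK.
  have [U [U0 KU Ud UB]] := compact_invariant_complete B0 iK KB Kz.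
  exists (U t); first by rewrite -U0; apply: (complete_flow_at S).
  split => //=; rewrite (@bounded_complete_phi _ _ _ _ _ _ S B l u U)//.
  rewrite -[leLHS](phi_at0 S l t u B0); apply: (phi_le S) => //.
  by rewrite U0.
have := min _ Kp (@subIsetl _ _ _) => e.
have : (K `&` [set p | 0 <= p.2]) (v, y) by rewrite e.
move=> [_ /=]; rewrite le_eqVlt => /orP[/eqP y0|//].
by have := nz v y Ky; rewrite -y0 eqxx.
Qed.

Lemma positive_compact_gap K : compact K -> K !=set0 -> positive_set K ->
  exists2 kap, 0 < kap & forall w x, K (w, x) -> kap <= x.
Proof.
move=> cK K0 Kp.
have sc : {within K, continuous (snd : Omega * R -> R)}.
  by apply: continuous_subspaceT => p; exact: cvg_snd.
have [[w0 x0] K0' minx] := compact_EVT_min K0 cK sc.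
exists x0; first by apply: (Kp w0); rewrite inE in K0'.
by move=> w x Kx; apply: (minx (w, x)); rewrite inE.
Qed.

(** The orbits of [K] are bounded global solutions, hence below [upper], and through every fibre
    passes one at height at least the minimum of [K]. *)
Lemma positive_invariant_upper l K : compact_invariant sigma (h l) K -> positive_set K ->
  exists2 kap, 0 < kap & forall w, kap <= upper sigma a1 a2 a3 l w.
Proof.
move=> cK Kp; have [K0 cK' iK] := cK.
have [kap kap0 Kkap] := positive_compact_gap cK' K0 Kp.
have [B B0 KB] := compact_invariant_bounded cK'.
exists kap => // w; have [x Kx] := compact_invariant_fibers cK w.
have [U [U0 KU Ud UB]] := compact_invariant_complete B0 iK KB Kx.
apply: (le_trans (Kkap w x Kx)); rewrite -U0.
apply: (lower_solution_le_upper S Ud (B := B)) => // t.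
rewrite (le_trans (ltW kap0) (Kkap _ _ (KU t)))/=.
exact: le_trans (ler_norm _) (UB t).
Qed.

(** In [1 / x] the linear coefficient only changes sign, while the quadratic and cubic terms become
    [- a2] and [a3 x], bounded along bounded solutions. *)
Lemma is_derive_inv_solution l w (u : R -> R) t : u t != 0 ->
  is_derive t (1 : R) u (h l (sigma t w) (u t)) ->
  is_derive t (1 : R) (fun s => (u s)^-1) (a3 (sigma t w) * u t - a2 (sigma t w)
    - (a1 (sigma t w) + l) / u t).
Proof.
move=> u0 ud; apply: is_derive_eq (is_derive_invf u0 ud) _.
by rewrite /h /cubic_family; field.
Qed.

Lemma compact_fiber_gap K K' : compact K -> compact K' -> K `&` K' = set0 ->
  exists2 d, 0 < d & forall w x y, K (w, x) -> K' (w, y) -> d <= `|x - y|.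
Proof.
move=> cK cK' KK'.
have cov := (compact_near_coveringP _).1 cK.
pose P (d : R) (p : Omega * R) := forall y, K' (p.1, y) -> d <= `|p.2 - y|.
have : \forall d \near 0^'+, K `<=` P d.
  apply: (cov _ (0^'+) P) => p Kp.
  have oK' : open (~` K') by rewrite openC; apply: compact_closed cK'; exact: state_hausdorff.
  have nK'p : (~` K') p by move=> K'p; have : (K `&` K') p by []; rewrite KK'.
  have /nbhs_ballP[e /= e0 eK'] : nbhs p (~` K') by exact: open_nbhs_nbhs.
  have e2 : 0 < e / 2 by rewrite divr_gt0.
  exists (ball p (e / 2), [set d | d < e / 2]) => /=.
    by split; [exact: nbhsx_ballx|exact: nbhs_right_lt].
  move=> [[w x] d] [/= [b1 b2] de] y K'y /=; rewrite leNgt; apply/negP => xy.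
  apply: (eK' (w, y)) => //; split => /=.
    by apply: le_ball b1; rewrite ler_pdivrMr// ler_pMr// ler1n.
  move: b2; rewrite /ball/= => b2.
  rewrite (_ : p.2 - y = (p.2 - x) + (x - y)); last by ring.
  by rewrite (le_lt_trans (ler_normD _ _))// (splitr e) ltrD// (lt_trans xy).
move=> H; have : \forall d \near 0^'+, 0 < d /\ K `<=` P d.
  by near=> d; split; [near: d; exact: nbhs_right_gt|near: d].
move=> /(@filter_ex _ _ _)[d [d0 Hd]]; exists d => // w x y Kx K'y.
exact: (Hd (w, x)).
Unshelve. all: by end_near. Qed.

(* The difference of the reciprocals of two positive solutions is multiplied by
   exp of minus the integral of [a1 + l + a3 * x * y]. *)
Lemma positive_minimal_unique l K K' : ~ decaying sigma (fun w => a1 w + l) ->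
  minimal_set sigma (h l) K -> minimal_set sigma (h l) K' ->
  positive_set K -> positive_set K' -> K = K'.
Proof.
move=> ndec mK mK' Kp Kp'; have [[K0 cK iK] _] := mK; have [[K0' cK' iK'] _] := mK'.
have [e|/eqP/set0P n0] := pselect (K `&` K' = set0); last first.
  exact: minimal_sets_meet mK mK' n0.
exfalso; apply: ndec.
have [d d0 Hd] := compact_fiber_gap cK cK' e.
have [k1 k10 Kk] := positive_compact_gap cK K0 Kp.
have [k2 k20 Kk'] := positive_compact_gap cK' K0' Kp'.
have [B1 B10 KB] := compact_invariant_bounded cK.
have [B2 B20 KB'] := compact_invariant_bounded cK'.
have [r r0 ar] := leading_coefficient_gap S.
(* [|D|] stays above [d'] because the two sets are disjoint, compact and bounded, and starts below
   [D0]; the exponential law for [D] then forces [a1 + l] to decay at rate [r k1 k2]. *)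
pose d' := d / (B1 * B2).
have d'0 : 0 < d' by rewrite divr_gt0// mulr_gt0.
pose D0 := k1^-1 + k2^-1.
have D00 : 0 < D0 by rewrite addr_gt0// invr_gt0.
have cc : continuous (fun w => a1 w + l) by apply: continuous_addc; exact: cubic_c1 S.
exists (ln (D0 ^+ 2 / d' ^+ 2) / 2), (r * (k1 * k2)); split; first by rewrite !mulr_gt0.
move=> w t t0.
have [[x Kx] [y Ky]] : (exists x, K (w, x)) /\ exists y, K' (w, y).
  by split; [apply: (compact_invariant_fibers mK.1)|apply: (compact_invariant_fibers mK'.1)].
have [U [U0 KU Ud UB]] := compact_invariant_complete B10 iK KB Kx.
have [V [V0 KV Vd VB]] := compact_invariant_complete B20 iK' KB' Ky.
have Up s : 0 < U s by exact: Kp (KU s).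
have Vp s : 0 < V s by exact: Kp' (KV s).
pose D s := (U s)^-1 - (V s)^-1.
pose D' s := - (a1 (sigma s w) + l + a3 (sigma s w) * (U s * V s)) * D s.
have Dd s : is_derive s (1 : R) D (D' s).
  have := is_derive_subf (is_derive_inv_solution (lt0r_neq0 (Up s)) (Ud s))
    (is_derive_inv_solution (lt0r_neq0 (Vp s)) (Vd s)).
  move=> h'; apply: is_derive_eq h' _; rewrite /D' /D; field.
  by rewrite !gt_eqF ?Up ?Vp.
have Dlow s : d' <= `|D s|.
  have -> : D s = (V s - U s) / (U s * V s).
    by rewrite /D; field; rewrite !gt_eqF ?Up ?Vp.
  rewrite normrM distrC (ger0_norm (_ : 0 <= (U s * V s)^-1)); last first.
    by rewrite invr_ge0 mulr_ge0// ltW.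
  apply: ler_pM; [exact: ltW|by rewrite invr_ge0 mulr_ge0// ltW|exact: Hd (KU s) (KV s)|].
  rewrite lef_pV2 ?posrE ?mulr_gt0//; apply: ler_pM; try exact: ltW.
    exact: le_trans (ler_norm _) (UB s).
  exact: le_trans (ler_norm _) (VB s).
have Dup : `|D 0| <= D0.
  rewrite (le_trans (ler_normB _ _))// !ger0_norm ?invr_ge0 ?(ltW (Up 0)) ?(ltW (Vp 0))//.
  by apply: lerD; rewrite lef_pV2 ?posrE ?Up ?Vp//; [exact: Kk (KU 0)|exact: Kk' (KV 0)].
pose eta := r * (k1 * k2).
pose P s := - 2 * (orbit_int sigma (fun w => a1 w + l) w s + eta * s).
have := @gronwall_le _ (fun s => D s * D s) (fun s => D' s * D s + D s * D' s) P
  (fun s => - 2 * (a1 (sigma s w) + l + eta)) 0 t t0.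
move=> /(_ _ _ _) H.
have {}H : D t * D t <= D 0 * D 0 * expR (P t - P 0).
  apply: H => s _.
  - exact: is_derive_mulf.
  - apply: is_derive_scalef; apply: is_derive_addf; last exact: is_derive_linear.
    exact: (is_derive_orbit_int base).
  - have UV : k1 * k2 <= U s * V s.
      by apply: ler_pM; rewrite ?(ltW k10) ?(ltW k20)//; [exact: Kk (KU s)|exact: Kk' (KV s)].
    have aUV : eta <= a3 (sigma s w) * (U s * V s).
      by apply: ler_pM => //; [exact: ltW|rewrite mulr_ge0// ltW].
    have DD : 0 <= D s * D s by rewrite -expr2 sqr_ge0.
    rewrite (_ : D' s * D s + D s * D' s
      = - 2 * (a1 (sigma s w) + l + a3 (sigma s w) * (U s * V s)) * (D s * D s)).
      rewrite ler_wpM2r// !mulNr lerN2 ler_wpM2l//.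
      by rewrite lerD2l.
    by rewrite /D'; ring.
have P0 : P 0 = 0 by rewrite /P orbit_int0; ring.
have q1 : d' ^+ 2 <= D t * D t.
  have -> : D t * D t = `|D t| ^+ 2 by rewrite -normrX ger0_norm ?sqr_ge0// expr2.
  by rewrite lerXn2r ?nnegrE// ltW.
have q2 : D 0 * D 0 <= D0 ^+ 2.
  have -> : D 0 * D 0 = `|D 0| ^+ 2 by rewrite -normrX ger0_norm ?sqr_ge0// expr2.
  by rewrite lerXn2r ?nnegrE// ltW.
have q3 : d' ^+ 2 <= D0 ^+ 2 * expR (P t).
  apply: (le_trans q1); apply: (le_trans H).
  by rewrite P0 subr0 ler_wpM2r ?expR_ge0.
have dd : 0 < d' ^+ 2 by rewrite exprn_gt0.
have : expR (- P t) <= D0 ^+ 2 / d' ^+ 2.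
  by rewrite expRN ler_pdivlMr// mulrC ler_pdivrMr ?expR_gt0.
rewrite -[X in _ <= X]lnK ?posrE ?divr_gt0 ?exprn_gt0// ler_expR /P /eta.
by lra.
Qed.

End CompactInvariant.

(** * Hyperbolicity of the upper boundary above a strictly lower one *)

Section UpperHyperbolic.
Context {R : realType} {Omega : pointedMetricType R}.
Variables (sigma : R -> Omega -> Omega) (a1 a2 a3 : Omega -> R).
Local Notation Phi := (phi sigma a1 a2 a3).
Hypothesis S : cubic_setting sigma a1 a2 a3.
Implicit Types (x y t s : R) (w : Omega).
Let base := cubic_base S.
Let h := cubic_family a1 a2 a3.
Let up := upper sigma a1 a2 a3.

Lemma cubic_family_le l l' w x : l <= l' -> 0 <= x -> h l w x <= h l' w x.
Proof. by move=> ll' x0; rewrite /h /cubic_family lerD2l ler_wpM2r// lerD2l. Qed.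

Lemma upper_le l l' w : l <= l' -> up l w <= up l' w.
Proof.
move=> ll'; have := @lower_solution_le_upper _ _ _ _ _ _ S l' w
  (fun t => up l (sigma t w)) _ (radius a1 a2 a3 l) (is_derive_upper S l w).
rewrite (flow0 (base_flow base)); apply=> t.
  by rewrite (upper_ge0 S) (upper_le_radius S).
by apply: cubic_family_le => //; exact: (upper_ge0 S).
Qed.

Variables (mu l kap : R).
Hypotheses (mu_lt : mu < l) (kap_gt0 : 0 < kap) (kap_le : forall w, kap <= up mu w).

Let N := radius a1 a2 a3 l + 1.
Let N_gt0 : 0 < N. Proof. exact: (radius1_gt0 S l). Qed.
Let rN : radius a1 a2 a3 l <= N. Proof. by rewrite lerDl. Qed.
Let b := up mu.
Let be := up l.
Let b_gt0 w : 0 < b w. Proof. exact: lt_le_trans (kap_le w). Qed.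
Let b_le w : b w <= be w. Proof. by apply: upper_le; exact: ltW. Qed.
Let be_gt0 w : 0 < be w. Proof. exact: lt_le_trans (b_le w). Qed.
Let be_leN w : be w <= N. Proof. exact: le_trans (upper_le_radius S _ _) rN. Qed.
Let kap_le_be w : kap <= be w. Proof. exact: le_trans (kap_le w) (b_le w). Qed.

Definition recip_gap w : R := (b w)^-1 - (be w)^-1.

Lemma recip_gap_le w : recip_gap w <= kap^-1.
Proof.
have h1 : (b w)^-1 <= kap^-1 by rewrite lef_pV2 ?posrE ?b_gt0 ?kap_le.
have h2 : 0 <= (be w)^-1 by rewrite invr_ge0 (ltW (be_gt0 w)).
by rewrite /recip_gap; lra.
Qed.

Lemma recip_gap_ge0 w : 0 <= recip_gap w.
Proof. by rewrite subr_ge0 lef_pV2 ?posrE ?be_gt0 ?b_gt0 ?b_le. Qed.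

Lemma is_derive_recip_gap w t : is_derive t (1 : R) (fun s => recip_gap (sigma s w))
  (- (a1 (sigma t w) + l + a3 (sigma t w) * b (sigma t w) * be (sigma t w))
    * recip_gap (sigma t w) + (l - mu) / b (sigma t w)).
Proof.
have bd := is_derive_inv_solution (u := fun s => b (sigma s w))
  (lt0r_neq0 (b_gt0 (sigma t w))) (is_derive_upper S mu w t).
have bed := is_derive_inv_solution (u := fun s => be (sigma s w))
  (lt0r_neq0 (be_gt0 (sigma t w))) (is_derive_upper S l w t).
apply: is_derive_eq (is_derive_subf bd bed) _.
by rewrite /recip_gap; field; rewrite !gt_eqF ?b_gt0 ?be_gt0.
Qed.

(** The gap is nonnegative and is fed at rate at least [m = (l - mu) / N] against a damping of at
    most [K]; one unit of time already produces [(m / K) (1 - exp (- K))]. *)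
Lemma recip_gap_bounded_below : exists2 E0, 0 < E0 & forall w, E0 <= recip_gap w.
Proof.
have [B B0 HB] := coefficient_bound S.
pose K := B + `|l| + B * N * N.
have K0 : 0 < K by rewrite ltr_pwDl ?ltr_pwDl ?mulr_ge0 ?(ltW B0) ?(ltW N_gt0).
pose m := (l - mu) / N.
have m0 : 0 < m by rewrite divr_gt0// subr_gt0.
have e1 : expR (- K) < 1 by rewrite expR_lt1 oppr_lt0.
exists (m / K * (1 - expR (- K))) => [|w].
  by rewrite mulr_gt0 ?divr_gt0// subr_gt0.
pose v := sigma (- 1) w.
(* Subtracting [m / K] turns the affine inequality into the linear one [- K G <= G']. *)
pose G s := recip_gap (sigma s v) - m / K.
pose G' s := - (a1 (sigma s v) + l + a3 (sigma s v) * b (sigma s v) * be (sigma s v))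
    * recip_gap (sigma s v) + (l - mu) / b (sigma s v).
have Gd s : is_derive s (1 : R) G (G' s).
  by apply: is_derive_eq (is_derive_subf (is_derive_recip_gap v s) (is_derive_cstf _ s)) _;
    rewrite subr0.
have : G 0 * expR (- K * (1 - 0)) <= G 1.
  apply: (@gronwall_const_ge _ G G') => // s _.
  have [h1 h2 h3] := HB (sigma s v); set u := sigma s v in h1 h2 h3 *.
  have p1 : a1 u + l + a3 u * b u * be u <= K.
    apply: lerD.
      by rewrite (le_trans (ler_norm _))// (le_trans (ler_normD _ _))// lerD2r.
    apply: ler_pM; rewrite ?(ltW (be_gt0 u)) ?be_leN//.
      by rewrite mulr_ge0 ?(ltW (b_gt0 u))// ltW// (cubic_a3_gt0 S).
    apply: ler_pM; rewrite ?(ltW (b_gt0 u))//; first by rewrite ltW// (cubic_a3_gt0 S).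
      exact: le_trans (ler_norm _) h3.
    exact: le_trans (b_le u) (be_leN u).
  have p2 : m <= (l - mu) / b u.
    rewrite ler_pM2l ?subr_gt0// lef_pV2 ?posrE//.
    exact: le_trans (b_le u) (be_leN u).
  have p3 := ler_wpM2r (recip_gap_ge0 u) p1.
  have -> : - K * G s = - (K * recip_gap u) + m.
    by rewrite /G -/u; field; rewrite gt_eqF.
  by rewrite /G' -/u mulNr; lra.
rewrite subr0 mulr1 /G (flow0 (base_flow base)) /v (sigmaNK base) -/v.
have p4 : 0 <= recip_gap v * expR (- K) by rewrite mulr_ge0 ?recip_gap_ge0 ?expR_ge0.
by rewrite mulrBl; lra.
Qed.

Lemma phi_above_lower w x t : b w <= x -> `|x| <= N -> 0 <= t ->
  b (sigma t w) <= Phi N l t w x.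
Proof.
move=> bx xN t0.
apply: (@trunc_compare _ _ _ _ _ _ S N l w (fun s => Phi N l s w x)
  (fun s => cubic_trunc a1 a2 a3 N l (sigma s w) (Phi N l s w x))
  (fun s => b (sigma s w)) (fun s => h mu (sigma s w) (b (sigma s w))) t) => //.
- by move=> s _; exact: (is_derive_phi S).
- by move=> s _; exact: (is_derive_upper S).
- move=> s _; rewrite cubic_trunc_id; last first.
    by rewrite ger0_norm ?(ltW (b_gt0 _))//; exact: le_trans (b_le _) (be_leN _).
  by apply: cubic_family_le; exact: ltW.
- by rewrite (phi0 S)// (flow0 (base_flow base)).
Qed.

(* The quotient of [1/be - 1/x] by [1/b - 1/be] decays at rate [l - mu] along
   the flow, for every solution [x] above [b]. *)
Lemma contraction : exists2 k, 0 < k & forall w x t, b w <= x -> `|x| <= N -> 0 <= t ->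
  `|Phi N l t w x - be (sigma t w)|
    <= k * expR (- (l - mu) * t) * `|x - be w|.
Proof.
have [E0 E00 HE] := recip_gap_bounded_below.
(* [|u - be|] equals [|Q| E u be], and [E u be] lies between [E0 kap^2] and [N^2 / kap]; [k] is the
   quotient of these bounds. *)
pose k := N ^+ 2 / (kap ^+ 3 * E0).
have k0 : 0 < k by rewrite divr_gt0 ?mulr_gt0 ?exprn_gt0.
exists k => // w x t bx xN t0.
pose u s := Phi N l s w x.
have bu s : 0 <= s -> b (sigma s w) <= u s by move=> s0; exact: phi_above_lower.
have u0 s : 0 <= s -> 0 < u s by move=> s0; exact: lt_le_trans (bu s s0).
have uN s : 0 <= s -> `|u s| <= N by move=> s0; exact: (phi_bounded S w rN (lexx N)).
have ud s : 0 <= s -> is_derive s (1 : R) u (h l (sigma s w) (u s)).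
  by move=> s0; rewrite /h -(cubic_trunc_id a1 a2 a3 l _ (uN s s0)); exact: (is_derive_phi S).
pose D s := (be (sigma s w))^-1 - (u s)^-1.
pose D' s := - (a1 (sigma s w) + l + a3 (sigma s w) * be (sigma s w) * u s) * D s.
have Dd s : 0 <= s -> is_derive s (1 : R) D (D' s).
  move=> s0.
  have bed := is_derive_inv_solution (u := fun s => be (sigma s w))
    (lt0r_neq0 (be_gt0 (sigma s w))) (is_derive_upper S l w s).
  have uid := @is_derive_inv_solution _ _ sigma a1 a2 a3 l w u s
    (lt0r_neq0 (u0 s s0)) (ud s s0).
  apply: is_derive_eq (is_derive_subf bed uid) _.
  by rewrite /D' /D; field; rewrite !gt_eqF ?u0 ?be_gt0.
pose E s := recip_gap (sigma s w).
pose E' s := - (a1 (sigma s w) + l + a3 (sigma s w) * b (sigma s w) * be (sigma s w))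
    * E s + (l - mu) / b (sigma s w).
have Ed s : is_derive s (1 : R) E (E' s) by exact: is_derive_recip_gap.
have Ep s : 0 < E s by exact: lt_le_trans (HE _).
pose Q s := D s * (E s)^-1.
pose p s := - a3 (sigma s w) * be (sigma s w) * (u s - b (sigma s w))
  - (l - mu) / (b (sigma s w) * E s).
have Qd s : 0 <= s -> is_derive s (1 : R) Q (p s * Q s).
  move=> s0; apply: is_derive_eq
    (is_derive_mulf (Dd s s0) (is_derive_invf (lt0r_neq0 (Ep s)) (Ed s))) _.
  rewrite /p /Q /D' /E'; move: (Ep s) (b_gt0 (sigma s w)).
  move: (D s) (E s) (b _) (be _) (u s) => z1 z2 z3 z4 z5 n2 n3.
  by field; rewrite !gt_eqF.
(* The first term of [p] is nonpositive because the solution stays above [b]; in the second,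
   [b E = 1 - b / be <= 1]. *)
have ple s : 0 <= s -> p s <= - (l - mu).
  move=> s0; rewrite /p mulNr mulNr -opprD lerN2.
  apply: (@le_trans _ _ (0 + (l - mu) / 1)); first by rewrite divr1 add0r.
  apply: lerD.
    by rewrite !mulr_ge0 ?(ltW (be_gt0 _)) ?subr_ge0 ?bu// ltW// (cubic_a3_gt0 S).
  rewrite ler_pM2l ?subr_gt0// lef_pV2 ?posrE ?mulr_gt0//.
  have -> : b (sigma s w) * E s = 1 - b (sigma s w) / be (sigma s w).
    by rewrite /E /recip_gap; field; rewrite !gt_eqF ?b_gt0 ?be_gt0.
  by rewrite gerBl divr_ge0// ltW.
have : Q t * Q t <= Q 0 * Q 0 * expR (- 2 * (l - mu) * (t - 0)).
  apply: (@gronwall_const_le _ (fun s => Q s * Q s)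
    (fun s => p s * Q s * Q s + Q s * (p s * Q s))) => // s /andP[s0 _].
    by apply: is_derive_mulf; exact: Qd.
  rewrite (_ : p s * Q s * Q s + _ = 2 * p s * (Q s * Q s)); last by ring.
  rewrite ler_wpM2r -?expr2 ?sqr_ge0// mulNr -mulrN ler_wpM2l// ple//.
rewrite subr0 => HQ.
have {}HQ : `|Q t| <= `|Q 0| * expR (- (l - mu) * t).
  rewrite -(@ler_pXn2r _ 2) ?nnegrE ?mulr_ge0 ?expR_ge0//.
  rewrite exprMn -!normrX !ger0_norm ?sqr_ge0// !expr2 (le_trans HQ)//.
  by rewrite -expRD ler_wpM2l -?expr2 ?sqr_ge0// ler_expR; lra.
have uE s : 0 <= s -> u s - be (sigma s w) = Q s * (E s * (u s * be (sigma s w))).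
  move=> s0; rewrite /Q /D; move: (Ep s) (u0 s s0) (be_gt0 (sigma s w)).
  by move=> n1 n2 n3; field; rewrite !gt_eqF.
have X0 : u 0 - be w = Q 0 * (E 0 * (u 0 * be w)).
  by rewrite -[in LHS](flow0 (base_flow base) w) uE// (flow0 (base_flow base)).
have u0x : u 0 = x by exact: (phi0 S).
have x0 : 0 < x by exact: lt_le_trans bx.
have EQ0 : `|Q 0| * (E0 * kap ^+ 2) <= `|x - be w|.
  rewrite -u0x X0 (normrM (Q 0)) ler_wpM2l// ger0_norm; last first.
    by rewrite !mulr_ge0 ?(ltW (Ep 0)) ?(ltW (u0 0 _)) ?(ltW (be_gt0 w)).
  rewrite expr2; apply: ler_pM; rewrite ?(ltW E00) ?mulr_ge0 ?(ltW kap_gt0)//; first exact: HE.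
  by apply: ler_pM; rewrite ?(ltW kap_gt0)// u0x (le_trans _ bx).
rewrite -/(u t) uE// (normrM (Q t)) (ger0_norm (_ : 0 <= E t * _)); last first.
  by rewrite !mulr_ge0 ?(ltW (Ep t)) ?(ltW (u0 t _)) ?(ltW (be_gt0 _)).
have EN : E t * (u t * be (sigma t w)) <= kap^-1 * N ^+ 2.
  rewrite expr2; apply: ler_pM; rewrite ?(ltW (Ep t)) ?recip_gap_le//.
    by rewrite mulr_ge0 ?(ltW (u0 t _)) ?(ltW (be_gt0 _)).
  apply: ler_pM; rewrite ?(ltW (u0 t _)) ?(ltW (be_gt0 _)) ?be_leN//.
  exact: le_trans (ler_norm _) (uN t t0).
apply: (@le_trans _ _ (`|Q 0| * expR (- (l - mu) * t) * (kap^-1 * N ^+ 2))).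
  apply: ler_pM => //.
  by rewrite !mulr_ge0 ?(ltW (Ep t)) ?(ltW (u0 t _)) ?(ltW (be_gt0 _)).
have -> : `|Q 0| * expR (- (l - mu) * t) * (kap^-1 * N ^+ 2)
  = k * expR (- (l - mu) * t) * (`|Q 0| * (E0 * kap ^+ 2)).
  by rewrite /k; field; rewrite !gt_eqF.
by rewrite ler_wpM2l// mulr_ge0 ?expR_ge0// ltW.
Qed.

Lemma exp_decay_small (C g e : R) : 0 < g -> 0 < e -> exists2 t, 0 <= t & C * expR (- g * t) < e.
Proof.
move=> g0 e0; pose t := `|C| / (g * e).
have t0 : 0 <= t by rewrite divr_ge0// ltW// mulr_gt0.
exists t => //; rewrite mulNr expRN ltr_pdivrMr ?expR_gt0//.
apply: (@lt_le_trans _ _ (e * (1 + g * t))); last first.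
  by rewrite ler_wpM2l ?(ltW e0)// expR_ge1Dx.
rewrite (_ : e * _ = e + `|C|); first by rewrite (le_lt_trans (ler_norm C))// ltrDr.
by rewrite /t; field; rewrite !gt_eqF.
Qed.

Lemma continuous_upper_at t : 0 <= t -> continuous (upper_at sigma a1 a2 a3 l t).
Proof.
move=> t0 w; apply/cvgrPdist_lt => e e0.
have [[P Q] /= [Pw Qx] PQ] := near_phi S l (sigma (- t) w) (radius a1 a2 a3 l) N_gt0 t0 e0.
have nP : nbhs w (sigma (- t) @^-1` P) by exact: (continuous_time_map base (t := - t) Pw).
apply: filterS nP => w' Pw'; rewrite distrC.
exact: (PQ (sigma (- t) w', radius a1 a2 a3 l) (conj Pw' (nbhs_singleton Qx))).
Qed.

(** The contraction, applied from [sigma (- t) w] to the starting level [radius l], shows that [be]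
    is the uniform limit of the continuous functions [upper_at l t]. *)
Lemma continuous_upper : continuous be.
Proof.
have [k k0 Hk] := contraction.
have g0 : 0 < l - mu by rewrite subr_gt0.
have near_at w t : 0 <= t ->
    `|upper_at sigma a1 a2 a3 l t w - be w| <= k * expR (- (l - mu) * t) * N.
  move=> t0; have := Hk (sigma (- t) w) (radius a1 a2 a3 l) t.
  rewrite (sigmaNK base) => H; apply: (le_trans (H _ _ t0)).
  - exact: le_trans (b_le _) (upper_le_radius S _ _).
  - by rewrite (le_trans (norm_radius S l)).
  rewrite ler_wpM2l ?mulr_ge0 ?expR_ge0 ?(ltW k0)//.
  by rewrite ger0_norm ?subr_ge0 ?(upper_le_radius S)// (le_trans _ rN)// gerBl ltW.
move=> w; apply/cvgrPdist_lt => e e0.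
have e3 : 0 < e / 3 by rewrite divr_gt0.
have [t t0 small] := exp_decay_small (k * N) g0 e3.
have {}small v : `|upper_at sigma a1 a2 a3 l t v - be v| < e / 3.
  by rewrite (le_lt_trans (near_at v t t0))// mulrAC.
set g := upper_at sigma a1 a2 a3 l t in small.
have nw : \forall w' \near w, `|g w - g w'| < e / 3.
  exact: (cvgr_dist_lt g (g w) (@continuous_upper_at t t0 w) _ e3).
apply: filterS nw => w' ww'.
rewrite (_ : be w - be w' = (be w - g w) + (g w - g w') + (g w' - be w')); last by ring.
rewrite (le_lt_trans (ler_normD _ _))// (_ : e = e / 3 + e / 3 + e / 3); last by field.
rewrite ltrD// (le_lt_trans (ler_normD _ _))// ltrD//.
by rewrite distrC.
Qed.

Lemma minimal_graph_upper : minimal_set sigma (h l) (graph_of be).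
Proof. by apply: (minimal_graph S); [exact: continuous_upper|exact: (equilibrium_upper S)]. Qed.

Lemma hyperbolic_graph_upper : hyperbolic_attractive sigma (h l) (graph_of be).
Proof.
have [k k0 Hk] := contraction.
have [E0 E00 HE] := recip_gap_bounded_below.
(* The bound 1 keeps [x] within the clipping level; the other keeps it above [b], because [be - b =
   recip_gap * b * be >= E0 * kap^2]. *)
pose rho := Num.min 1 (E0 * kap ^+ 2).
have rho0 : 0 < rho by rewrite lt_min ltr01/= mulr_gt0// exprn_gt0.
exists rho, (k + 1), (l - mu); split => //; first by rewrite lerDr ltW.
  by rewrite subr_gt0.
move=> w x0 x; rewrite /graph_of/= => -> xrho t t0.
have xN : `|x| <= N.
  rewrite -[x](subrK (be w)) (le_trans (ler_normD _ _))// /N addrC lerD//.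
    exact: norm_upper.
  by rewrite (le_trans (ltW xrho))// ge_min lexx.
have bx : b w <= x.
  have gap : E0 * kap ^+ 2 <= be w - b w.
    rewrite (_ : be w - b w = recip_gap w * (b w * be w)); last first.
      by rewrite /recip_gap; field; rewrite !gt_eqF ?b_gt0 ?be_gt0.
    rewrite expr2; apply: ler_pM; rewrite ?(ltW E00) ?mulr_ge0 ?(ltW kap_gt0)//.
    by apply: ler_pM; rewrite ?(ltW kap_gt0).
  have : `|x - be w| < E0 * kap ^+ 2 by rewrite (lt_le_trans xrho)// ge_min lexx orbT.
  by rewrite ltr_norml => /andP[]; lra.
have N1 : N < N + 1 by rewrite ltrDl.
exists (be (sigma t w)), (Phi (N + 1) l t w x); split.
- exact: (equilibrium_upper S).
- exact: flow_at_forward rN N1 t0 xN.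
rewrite (@phi_trunc_indep _ _ _ _ _ _ S (N + 1) N l N)//; last exact: ltW.
apply: (le_trans (Hk w x t bx xN t0)); rewrite ler_wpM2r// ler_wpM2r ?expR_ge0//.
by rewrite lerDl.
Qed.

End UpperHyperbolic.

(** * Linearization along the zero solution *)

Section Reciprocal.
Context {R : realType}.
Implicit Types (y C c : R -> R) (K k d T : R).

(** Variation of constants: with the weight [exp (C s - C T)], the term [A exp (d (s - T))]
    dominates the accumulated forcing [K], so [z] is nonincreasing. *)
Lemma recip_bound y y' C c K k d T : 0 <= T -> 0 < d -> 0 <= K ->
  (forall s, 0 <= s <= T -> is_derive s (1 : R) y (y' s)) ->
  (forall s, 0 <= s <= T -> is_derive s (1 : R) C (c s)) ->
  (forall s, 0 <= s <= T -> y' s <= K - c s * y s) ->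
  (forall s, 0 <= s <= T -> d * (T - s) - k <= C T - C s) -> 0 <= y 0 ->
  y T <= expR k * (y 0 + K / d).
Proof.
move=> T0 d0 K0 yd Cd yK CT y0.
pose A := K * expR k / d.
pose z s := y s * expR (C s - C T) - A * expR (d * s - d * T).
pose z' s := (y' s * expR (C s - C T) + y s * (c s * expR (C s - C T)))
  - A * (d * expR (d * s - d * T)).
have : z T <= z 0.
  apply: (@derive_nonincreasing _ z z' 0 T) => // s sT.
    apply: is_derive_subf.
      apply: is_derive_mulf; first exact: yd.
      apply: is_derive_expf; rewrite -[X in is_derive _ _ _ X]subr0.
      exact: is_derive_subf (Cd _ sT) (is_derive_cstf (C T) s).
    apply: is_derive_scalef; apply: is_derive_expf.
    rewrite -[X in is_derive _ _ _ X]subr0.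
    exact: is_derive_subf (is_derive_linear d s) (is_derive_cstf (d * T) s).
  have e1 : expR (C s - C T) <= expR k * expR (d * s - d * T).
    by rewrite -expRD ler_expR; have := CT s sT; lra.
  have e2 : (y' s + c s * y s) * expR (C s - C T) <= K * expR (C s - C T).
    by rewrite ler_wpM2r ?expR_ge0//; have := yK s sT; lra.
  have e3 : K * expR (C s - C T) <= K * (expR k * expR (d * s - d * T)).
    by rewrite ler_wpM2l.
  have e4 : A * (d * expR (d * s - d * T)) = K * (expR k * expR (d * s - d * T)).
    by rewrite /A; field; rewrite gt_eqF.
  by rewrite /z' e4; lra.
rewrite /z !subrr expR0 !mulr1 => zT.
have e5 : y 0 * expR (C 0 - C T) <= y 0 * expR k.
  rewrite ler_wpM2l// ler_expR; have := CT 0; rewrite lexx T0 => /(_ isT).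
  by have := mulr_ge0 (ltW d0) T0; lra.
have A0 : 0 <= A by rewrite divr_ge0 ?mulr_ge0 ?expR_ge0// ltW.
have e6 : 0 <= A * expR (d * 0 - d * T) by rewrite mulr_ge0 ?expR_ge0.
have -> : expR k * (y 0 + K / d) = y 0 * expR k + A by rewrite /A; field; rewrite gt_eqF.
by lra.
Qed.

(** The same device from below: as [C] decays, the total contribution of the forcing is at most
    [K exp k / d]. *)
Lemma recip_growth y y' C c K k d T : 0 <= T -> 0 < d -> 0 <= K -> C 0 = 0 ->
  (forall s, 0 <= s <= T -> is_derive s (1 : R) y (y' s)) ->
  (forall s, 0 <= s <= T -> is_derive s (1 : R) C (c s)) ->
  (forall s, 0 <= s <= T -> - K - c s * y s <= y' s) ->
  (forall s, 0 <= s <= T -> C s <= k - d * s) ->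
  y 0 - K * expR k / d <= y T * expR (C T).
Proof.
move=> T0 d0 K0 C0 yd Cd yK CT.
pose A := K * expR k / d.
have A0 : 0 <= A by rewrite divr_ge0 ?mulr_ge0 ?expR_ge0// ltW.
pose z s := y s * expR (C s) - A * expR (- d * s).
pose z' s := (y' s * expR (C s) + y s * (c s * expR (C s)))
  - A * (- d * expR (- d * s)).
have : z 0 <= z T.
  apply: (@derive_nondecreasing _ z z' 0 T) => // s sT.
    apply: is_derive_subf.
      by apply: is_derive_mulf; [exact: yd|apply: is_derive_expf; exact: Cd].
    by apply: is_derive_scalef; apply: is_derive_expf; exact: is_derive_linear.
  have e1 : expR (C s) <= expR k * expR (- d * s).
    by rewrite -expRD ler_expR; have := CT s sT; lra.
  have e2 : - K * expR (C s) <= (y' s + c s * y s) * expR (C s).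
    by rewrite ler_wpM2r ?expR_ge0//; have := yK s sT; lra.
  have e3 : K * expR (C s) <= K * (expR k * expR (- d * s)) by rewrite ler_wpM2l.
  have e4 : A * (- d * expR (- d * s)) = - (K * (expR k * expR (- d * s))).
    by rewrite /A; field; rewrite gt_eqF.
  by rewrite /z' e4; lra.
rewrite /z C0 expR0 mulr0 expR0 !mulr1 -/A.
have : 0 <= A * expR (- d * T) by rewrite mulr_ge0 ?expR_ge0.
by lra.
Qed.

End Reciprocal.

Section ZeroSolution.
Context {R : realType} {Omega : pointedMetricType R}.
Variables (sigma : R -> Omega -> Omega) (a1 a2 a3 : Omega -> R).
Local Notation C1 l := (orbit_int sigma (fun w => a1 w + l)).
Hypothesis S : cubic_setting sigma a1 a2 a3.
Implicit Types (l x t s k d : R) (w : Omega).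
Let base := cubic_base S.
Let h := cubic_family a1 a2 a3.
Let up := upper sigma a1 a2 a3.

Lemma continuous_linear_coef l : continuous (fun w => a1 w + l).
Proof. by apply: continuous_addc; exact: cubic_c1 S. Qed.

(** The reciprocal of the pulled back solution satisfies [y' <= K - (a1 + l) y], where [K] bounds
    [a3 u - a2]; since [a1 + l] accumulates growth, [y] has a bound independent of the starting
    time. *)
Lemma upper_bounded_below l : decaying sigma (fun w => - (a1 w + l)) ->
  exists2 kap, 0 < kap & forall w, kap <= up l w.
Proof.
move=> [k [d [d0 H]]]; have cc := @continuous_linear_coef l.
have [B B0 HB] := coefficient_bound S.
have r0 := radius_gt0 S l; set M := radius a1 a2 a3 l in r0.
pose K := B * M + B.
have K0 : 0 <= K by rewrite addr_ge0 ?mulr_ge0// ltW.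
pose Y := expR k * (M^-1 + K / d).
have Y0 : 0 < Y by rewrite mulr_gt0 ?expR_gt0// ltr_pwDl ?invr_gt0// divr_ge0// ltW.
exists Y^-1 => [|w]; first by rewrite invr_gt0.
apply: (upper_greatest S) => T T0; pose v := sigma (- T) w.
pose u s := phi sigma a1 a2 a3 (M + 1) l s v M.
have N0 : 0 < M + 1 by rewrite addr_gt0.
have u0 s : 0 < u s.
  by rewrite -(phi_at0 S l s v N0); exact: phi_lt.
have uM s : 0 <= s -> u s <= M.
  move=> s0; apply: le_trans (ler_norm _) _.
  exact: (phi_bounded S v (lexx M) (radius_le_trunc a1 a2 a3 l) s0 (norm_radius S l)).
have ud s : 0 <= s -> is_derive s (1 : R) u (h l (sigma s v) (u s)).
  move=> s0; rewrite /h -(@cubic_trunc_id _ _ _ _ _ (M + 1)); first exact: (is_derive_phi S).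
  by rewrite gtr0_norm// (le_trans (uM s s0))// lerDl.
pose y' s := a3 (sigma s v) * u s - a2 (sigma s v) - (a1 (sigma s v) + l) / u s.
have yd s : 0 <= s -> is_derive s (1 : R) (fun s => (u s)^-1) (y' s).
  by move=> s0; exact: (@is_derive_inv_solution _ _ sigma a1 a2 a3 l v u s
    (lt0r_neq0 (u0 s)) (ud s s0)).
have := @recip_bound _ (fun s => (u s)^-1) y' (orbit_int sigma (fun w => a1 w + l) v)
  (fun s => a1 (sigma s v) + l) K k d T T0 d0 K0.
have -> : (u 0)^-1 = M^-1 by rewrite /u (phi0 S).
move=> /(_ _ _ _ _ _) H'.
have : (u T)^-1 <= Y.
  apply: H' => [s /andP[s0 _]|s _|s /andP[s0 sT]|s /andP[s0 sT]|].
  - exact: yd.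
  - exact: (is_derive_orbit_int base v s cc).
  - have [h1 h2 h3] := HB (sigma s v).
    have e1 : a3 (sigma s v) * u s <= B * M.
      apply: ler_pM; [exact: ltW (cubic_a3_gt0 S _)|exact: ltW| |exact: uM].
      exact: le_trans (ler_norm _) h3.
    have e2 : - a2 (sigma s v) <= B by rewrite (le_trans _ h2)// -normrN ler_norm.
    by rewrite /K /y' (mulrC (_ + l)); lra.
  - have := H (sigma s v) (T - s); rewrite subr_ge0 => /(_ sT).
    rewrite (orbit_int_opp base)//.
    have := orbit_intD base v s (T - s) cc; rewrite addrC subrK => ->.
    by lra.
  - by rewrite invr_ge0 ltW.
move=> uY; rewrite -[upper_at _ _ _ _ _ _ _]invrK lef_pV2 ?posrE ?invr_gt0//.
exact: u0.
Qed.

(** The quadratic estimate is wanted for all [x]: beyond the clipping level, the clipped field and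
    the linear term are each at most a multiple of [x^2]. *)
Lemma trunc_linearization l N : 0 < N -> exists2 K, 0 < K &
  forall w x, `|cubic_trunc a1 a2 a3 N l w x - (a1 w + l) * x| <= K * x ^+ 2.
Proof.
move=> N0; have [B B0 HB] := coefficient_bound S.
pose c0 := B + `|l|.
have c00 : 0 < c0 by rewrite ltr_pwDl.
pose G0 := B * N ^+ 3 + B * N ^+ 2 + c0 * N.
have G00 : 0 < G0 by rewrite !addr_gt0// mulr_gt0// exprn_gt0.
exists (B * N + B + (G0 / N ^+ 2 + c0 / N)) => [|w x].
  by apply: addr_gt0; apply: addr_gt0 => //; [exact: mulr_gt0|apply: divr_gt0 => //; exact: exprn_gt0|exact: divr_gt0].
have [h1 h2 h3] := HB w.
have hc : `|a1 w + l| <= c0 by rewrite (le_trans (ler_normD _ _))// lerD2r.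
have NN : 0 < N ^+ 2 by rewrite exprn_gt0.
have x2 : x ^+ 2 = `|x| ^+ 2 by rewrite real_normK// num_real.
have [xN|Nx] := leP `|x| N.
  rewrite cubic_trunc_id//.
  rewrite (_ : _ - _ = (- a3 w * x + a2 w) * x ^+ 2); last by rewrite /cubic_family; ring.
  rewrite normrM (ger0_norm (sqr_ge0 x)) ler_wpM2r ?sqr_ge0//.
  rewrite -[leLHS]addr0 lerD//.
    rewrite (le_trans (ler_normD _ _))// lerD//.
    by rewrite normrM normrN ler_pM.
  by rewrite addr_ge0// divr_ge0// ltW.
set q := clip N x; have qN : `|q| <= N by rewrite norm_clip// ltW.
have g1 : `|cubic_trunc a1 a2 a3 N l w x| <= G0 / N ^+ 2 * x ^+ 2.
  apply: (@le_trans _ _ G0); last first.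
    rewrite mulrAC ler_pdivlMr// ler_wpM2l ?(ltW G00)// x2.
    by rewrite lerXn2r ?nnegrE ?(ltW N0)// ltW.
  rewrite /cubic_trunc -/q /cubic_family (le_trans (ler_normD _ _))// lerD//; last first.
    by rewrite normrM ler_pM.
  rewrite (le_trans (ler_normD _ _))// lerD// normrM ler_pM// ?normrN//.
    by rewrite normrX lerXn2r ?nnegrE ?(ltW N0).
  by rewrite normrX lerXn2r ?nnegrE ?(ltW N0).
have g2 : `|(a1 w + l) * x| <= c0 / N * x ^+ 2.
  rewrite normrM x2 expr2 mulrA ler_wpM2r// (le_trans hc)//.
  by rewrite mulrAC ler_pdivlMr// ler_wpM2l ?(ltW c00)// ltW.
apply: le_trans (ler_normB _ _) _; apply: le_trans (lerD g1 g2) _.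
rewrite -mulrDl ler_wpM2r ?sqr_ge0// lerDr.
by rewrite addr_ge0 ?(ltW B0)// mulr_ge0 ?(ltW B0) ?(ltW N0).
Qed.

(* [e] is the direction of time: 1 for the future and -1 for the past. *)
Section Direction.
Variables (e l : R).
Hypothesis e_sign : e = 1 \/ e = - 1.

Let N := radius a1 a2 a3 l + 1.
Let N_gt0 : 0 < N. Proof. exact: radius1_gt0 S l. Qed.

Lemma is_derive_scaled (f : R -> R) t df : is_derive (e * t) (1 : R) f df ->
  is_derive t (1 : R) (fun s => f (e * s)) (e * df).
Proof.
case: e_sign => ->.
  by under eq_fun do rewrite mul1r; rewrite !mul1r.
under eq_fun do rewrite mulN1r; rewrite !mulN1r => fd.
exact: is_derive_reverse.
Qed.

Lemma is_derive_orbit_int_dir w t : is_derive t (1 : R)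
  (fun s => C1 l w (e * s))
  (e * (a1 (sigma (e * t) w) + l)).
Proof.
apply: (is_derive_scaled (f := C1 l w)).
apply: (is_derive_orbit_int base); exact: continuous_linear_coef.
Qed.

Lemma is_derive_phi_dir w x t : is_derive t (1 : R)
  (fun s => phi sigma a1 a2 a3 N l (e * s) w x)
  (e * cubic_trunc a1 a2 a3 N l (sigma (e * t) w) (phi sigma a1 a2 a3 N l (e * t) w x)).
Proof.
apply: (is_derive_scaled (f := fun s => phi sigma a1 a2 a3 N l s w x)).
exact: (is_derive_phi S).
Qed.

Lemma linearization_dir : exists2 K, 0 < K & forall w x,
  `|e * cubic_trunc a1 a2 a3 N l w x - e * (a1 w + l) * x| <= K * x ^+ 2.
Proof.
have [K K0 HK] := trunc_linearization l N_gt0; exists K => // w x.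
rewrite -mulrA -mulrBr normrM (_ : `|e| = 1) ?mul1r//.
by case: e_sign => ->; rewrite ?normrN normr1.
Qed.

Lemma between0_dir t s : 0 <= t ->
  Num.min 0 (e * t) <= s <= Num.max 0 (e * t) -> exists2 r, 0 <= r <= t & s = e * r.
Proof.
move=> t0; case: e_sign => ->.
  by rewrite mul1r min_l// max_r// => st; exists s; rewrite ?mul1r.
rewrite mulN1r => st; exists (- s); last by rewrite mulN1r opprK.
by move: st; rewrite min_r ?max_l ?oppr_le0// => /andP[h1 h2]; apply/andP; split; lra.
Qed.

(** Along a positive solution, [1 / u] follows the linear equation up to a forcing of at most [K];
    for [x < rho] its total effect [K exp k / d] is at most half of [1 / x], so [u] decays like the
    linear solution. *)
Lemma small_decay k d : 0 < d ->
  (forall w s, 0 <= s -> C1 l w (e * s) <= k - d * s) ->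
  exists rho k', [/\ 0 < rho, 1 <= k' &
    forall w x s, 0 < x -> x < rho -> 0 <= s -> exists y,
      [/\ flow_at sigma (h l) (e * s) w x y, 0 <= y & y <= k' * expR (- d * s) * x]].
Proof.
move=> d0 H; have [K K0 HK] := linearization_dir.
have k1 : 1 <= expR `|k| by rewrite (le_trans _ (expR_ge1Dx _))// lerDl.
pose k' := 2 * expR `|k|.
have k'0 : 0 < k' by rewrite mulr_gt0 ?expR_gt0.
(* The second bound gives [k' x < N], which keeps the solution within the clipping level. *)
pose rho := Num.min (d / (2 * K * expR k)) (N / k').
have rho0 : 0 < rho by rewrite lt_min !divr_gt0// !mulr_gt0// expR_gt0.
exists rho, k'; split => //; first by rewrite /k'; lra.
move=> w x s x0 xr s0.
pose u s := phi sigma a1 a2 a3 N l (e * s) w x.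
have u0 r : 0 < u r by rewrite -(phi_at0 S l (e * r) w N_gt0); exact: phi_lt.
have bound r : 0 <= r -> u r <= k' * expR (- d * r) * x.
  move=> r0.
  have := @recip_growth _ (fun s => (u s)^-1)
    (fun s => - (e * cubic_trunc a1 a2 a3 N l (sigma (e * s) w) (u s)) / (u s) ^+ 2)
    (fun s => C1 l w (e * s))
    (fun s => e * (a1 (sigma (e * s) w) + l)) K k d r r0 d0 (ltW K0).
  rewrite mulr0 (orbit_int0 sigma) => /(_ erefl _ _ _ _) G.
  have {}G : (u 0)^-1 - K * expR k / d
      <= (u r)^-1 * expR (C1 l w (e * r)).
    apply: G => [t _|t _|t _|t /andP[t0 _]].
    - by apply: is_derive_invf; [exact: lt0r_neq0|exact: is_derive_phi_dir].
    - exact: is_derive_orbit_int_dir.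
    - set g := e * cubic_trunc _ _ _ _ _ _ _; set c := e * (_ + l).
      have : g <= c * u t + K * (u t) ^+ 2.
        have := HK (sigma (e * t) w) (u t); rewrite -/g -/c => /(le_trans (ler_norm _)).
        by lra.
      move=> gle; have uu : 0 < (u t) ^+ 2 by rewrite exprn_gt0.
      rewrite ler_pdivlMr// (_ : _ * _ = - (c * u t + K * (u t) ^+ 2)) ?lerN2//.
      by field; rewrite gt_eqF.
    - exact: H.
  have ux : u 0 = x by rewrite /u mulr0 (phi0 S).
  rewrite ux in G.
  have xK : K * expR k / d <= x^-1 / 2.
    have xd : x <= d / (2 * K * expR k) by rewrite (le_trans (ltW xr))// ge_min lexx.
    have : (d / (2 * K * expR k))^-1 <= x^-1.
      by rewrite lef_pV2 ?posrE// divr_gt0// mulr_gt0 ?expR_gt0// mulr_gt0.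
    by rewrite invf_div (_ : 2 * K * expR k / d = 2 * (K * expR k / d)); [lra|ring].
  have G2 : x^-1 / 2 <= (u r)^-1 * expR (C1 l w (e * r)).
    by lra.
  have G3 : (u r)^-1 * expR (C1 l w (e * r))
      <= (u r)^-1 * (expR `|k| * expR (- d * r)).
    rewrite ler_wpM2l ?invr_ge0 ?(ltW (u0 r))// -expRD ler_expR.
    by have := H w r r0; have := ler_norm k; lra.
  have xu0 : 0 <= 2 * x * u r by rewrite !mulr_ge0// ltW.
  have := ler_wpM2l xu0 (le_trans G2 G3).
  rewrite (_ : 2 * x * u r * (x^-1 / 2) = u r); last by field; rewrite gt_eqF.
  move=> /le_trans; apply; rewrite le_eqVlt; apply/orP; left; apply/eqP.
  by rewrite /k'; field; rewrite gt_eqF.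
exists (u s); split; [|exact: ltW|exact: bound].
apply: (flow_at_phi S) => // t /(between0_dir s0)[r /andP[r0 _] ->].
rewrite gtr0_norm; last exact: u0.
apply: le_lt_trans (bound r r0) _.
have : x < N / k' by rewrite (lt_le_trans xr)// ge_min lexx orbT.
rewrite ltr_pdivlMr// => xk.
apply: le_lt_trans xk; rewrite mulrC ler_wpM2l ?(ltW x0)//.
by rewrite ler_piMr ?(ltW k'0)// -expR0 ler_expR mulNr oppr_le0 mulr_ge0// ltW.
Qed.

(** Along a solution of size at most [k x], the relative growth differs from the linear one by at
    most [K k x <= g / 2]; half of the nonlinear decay rate therefore passes to the linear
    equation. *)
Lemma decay_linear rho k g : 0 < rho -> 1 <= k -> 0 < g ->
  (forall w x s, `|x| < rho -> 0 <= s -> exists2 y,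
    flow_at sigma (h l) (e * s) w x y & `|y| <= k * expR (- g * s) * `|x|) ->
  forall w s, 0 <= s ->
    C1 l w (e * s) <= ln k - g / 2 * s.
Proof.
move=> rho0 k1 g0 H w s s0; have [K K0 HK] := linearization_dir.
have k0 : 0 < k by exact: lt_le_trans k1.
pose x := Num.min (rho / 2) (Num.min (N / k) (g / (2 * K * k))).
have x0 : 0 < x by rewrite !lt_min !divr_gt0// !mulr_gt0.
have xrho : `|x| < rho.
  rewrite gtr0_norm// (@le_lt_trans _ _ (rho / 2)) ?ge_min ?lexx//.
  by rewrite ltr_pdivrMr// ltr_pMr// ltr1n.
have xN : k * x <= N by rewrite mulrC -ler_pdivlMr// !ge_min lexx !orbT.
have xg : K * (k * x) <= g / 2.
  have : x <= g / (2 * K * k) by rewrite !ge_min lexx !orbT.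
  rewrite ler_pdivlMr ?mulr_gt0//; lra.
have small r : 0 <= r -> exists2 y, flow_at sigma (h l) (e * r) w x y &
    `|y| <= k * x * expR (- g * r).
  by move=> r0; have [y fy yk] := H w x r xrho r0; exists y => //;
    rewrite (le_trans yk)// (gtr0_norm x0) mulrAC.
have expg r : 0 <= r -> expR (- g * r) <= 1.
  by move=> r0; rewrite -expR0 ler_expR mulNr oppr_le0 mulr_ge0// ltW.
have kx0 : 0 <= k * x by rewrite mulr_ge0// ltW.
pose u r := phi sigma a1 a2 a3 N l (e * r) w x.
have fu r : 0 <= r -> flow_at sigma (h l) (e * r) w x (u r).
  move=> r0; apply: (flow_at_le_phi S) => // t /(between0_dir r0)[q /andP[q0 _] ->].
  have [y fy yk] := small q q0; exists y => //; rewrite (le_trans yk)// (le_trans _ xN)//.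
  by rewrite ler_piMr// expg.
have ub r : 0 <= r -> `|u r| <= k * x * expR (- g * r).
  by move=> r0; have [y fy yk] := small r r0; rewrite (flow_at_uniq S (fu r r0) fy).
have u0 r : 0 < u r by rewrite -(phi_at0 S l (e * r) w N_gt0); exact: phi_lt.
have := @gronwall_ge _ u
  (fun r => e * cubic_trunc a1 a2 a3 N l (sigma (e * r) w) (u r))
  (fun r => C1 l w (e * r) - g / 2 * r)
  (fun r => e * (a1 (sigma (e * r) w) + l) - g / 2) 0 s s0.
move=> /(_ _ _ _) G.
have {}G : u 0 * expR (C1 l w (e * s) - g / 2 * s
    - (C1 l w (e * 0) - g / 2 * 0)) <= u s.
  apply: G => [r _|r _|r /andP[r0 _]].
  - exact: is_derive_phi_dir.
  - by apply: is_derive_subf; [exact: is_derive_orbit_int_dir|exact: is_derive_linear].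
  - set gg := e * cubic_trunc _ _ _ _ _ _ _; set c := e * (_ + l).
    have : c * u r - K * (u r) ^+ 2 <= gg.
      have := HK (sigma (e * r) w) (u r); rewrite -/gg -/c ler_norml => /andP[]; lra.
    have ukx : u r <= k * x.
      rewrite (le_trans (ler_norm _))// (le_trans (ub r r0))// ler_piMr// expg//.
    have : K * (u r) ^+ 2 <= g / 2 * u r.
      rewrite expr2 mulrA ler_wpM2r ?(ltW (u0 r))// (le_trans _ xg)//.
      by rewrite ler_wpM2l ?(ltW K0).
    by rewrite mulrBl; lra.
move: G; rewrite !mulr0 (orbit_int0 sigma) !subr0.
have -> : u 0 = x by rewrite /u mulr0 (phi0 S).
set A := orbit_int _ _ _ _ - _ => G.
have : expR A <= k * expR (- g * s).
  rewrite -(ler_pM2l x0) (le_trans G)// (le_trans (ler_norm _))// (le_trans (ub s s0))//.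
  by rewrite mulrA (mulrC k).
rewrite -{1}(lnK (x := k)) ?posrE// -expRD ler_expR /A.
by lra.
Qed.

End Direction.

End ZeroSolution.

(** * Hyperbolicity of the zero solution *)

Section ZeroHyperbolic.
Context {R : realType} {Omega : pointedMetricType R}.
Variables (sigma : R -> Omega -> Omega) (a1 a2 a3 : Omega -> R).
Local Notation C1 l := (orbit_int sigma (fun w => a1 w + l)).
Hypothesis S : cubic_setting sigma a1 a2 a3.
Implicit Types (l x t s k d : R) (w : Omega).
Let base := cubic_base S.
Let h := cubic_family a1 a2 a3.

Lemma flow_at_zero l t w : flow_at sigma (h l) t w 0 0.
Proof.
apply: (@complete_flow_at _ _ _ _ _ _ S l w (fun=> 0) t) => s.
by rewrite cubic_familyE mulr0; exact: is_derive_cstf.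
Qed.

Lemma small_decay_norm e l k d : e = 1 \/ e = - 1 -> 0 < d ->
  (forall w s, 0 <= s -> C1 l w (e * s) <= k - d * s) ->
  exists rho k', [/\ 0 < rho, 1 <= k' &
    forall w x s, `|x| < rho -> 0 <= s -> exists2 y,
      flow_at sigma (h l) (e * s) w x y & `|y| <= k' * expR (- d * s) * `|x|].
Proof.
move=> e1 d0 H.
have [r1 [k1 [r10 k11 H1]]] := small_decay S e1 d0 H.
have [r2 [k2 [r20 k21 H2]]] := small_decay (cubic_setting_opp S) e1 d0 H.
have k12 : k1 <= k1 + k2 by rewrite lerDl (le_trans ler01).
have k22 : k2 <= k1 + k2 by rewrite lerDr (le_trans ler01).
exists (Num.min r1 r2), (k1 + k2); split; first by rewrite lt_min r10.
  exact: le_trans k12.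
have grow k3 w x s y : k3 <= k1 + k2 -> y <= k3 * expR (- d * s) * x -> 0 <= x ->
    y <= (k1 + k2) * expR (- d * s) * x.
  by move=> kk yk x0; rewrite (le_trans yk)// ler_wpM2r// ler_wpM2r ?expR_ge0.
move=> w x s; rewrite lt_min => /andP[xr1 xr2] s0.
have [x0|x0|->] := ltgtP x 0; last 1 first.
- by exists 0; [exact: flow_at_zero|rewrite normr0 mulr0].
- have Nx : 0 < - x by rewrite oppr_gt0.
  have xr2' : - x < r2 by rewrite -ltr0_norm.
  have [y [fy y0 yk]] := H2 w _ s Nx xr2' s0.
  exists (- y); first by apply/(flow_at_reflect _ _ _ _ _ S); rewrite opprK.
  rewrite normrN ger0_norm// ltr0_norm//.
  by apply: (grow k2) => //; exact: ltW.
- have xr1' : x < r1 by rewrite -(gtr0_norm x0).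
  have [y [fy y0 yk]] := H1 w x s x0 xr1' s0.
  by exists y => //; rewrite ger0_norm// gtr0_norm//; apply: (grow k1) => //; exact: ltW.
Qed.

Lemma decaying_backward l : decaying sigma (fun w => - (a1 w + l)) <->
  exists k d, 0 < d /\ forall w s, 0 <= s ->
    C1 l w (- 1 * s) <= k - d * s.
Proof.
have cc := continuous_linear_coef S (l := l).
split=> -[k [d [d0 H]]]; exists k, d; split => // w s s0.
  rewrite mulN1r (orbit_intN base)//.
  by have := H (sigma (- s) w) s s0; rewrite (orbit_int_opp base).
rewrite (orbit_int_opp base)//; have := H (sigma s w) s s0.
by rewrite mulN1r (orbit_intN base)// (sigmaK base).
Qed.

Lemma M0_attractiveP l :
  hyperbolic_attractive sigma (h l) M0 <-> decaying sigma (fun w => a1 w + l).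
Proof.
split=> [[rho [k [g [rho0 k1 g0 H]]]]|[k [d [d0 H]]]].
  exists (ln k), (g / 2); split => [|w s s0]; first by rewrite divr_gt0.
  rewrite -[s in leLHS]mul1r.
  apply: (decay_linear S (or_introl erefl) rho0 k1 g0) => // v x r xr r0.
  have [|y0 [y [f0 f yy]]] := H v 0 x erefl _ r r0; first by rewrite subr0.
  rewrite (flow_at_uniq S f0 (flow_at_zero l r v)) !subr0 in yy.
  by exists y; rewrite ?mul1r.
have [|rho [k' [rho0 k1 H']]] := @small_decay_norm 1 l k d (or_introl erefl) d0.
  by move=> w s s0; rewrite mul1r; exact: H.
exists rho, k', d; split => // w x0 x; rewrite /M0 /graph_of/= => ->.
rewrite subr0 => xr t t0; have [y fy yk] := H' w x t xr t0.
exists 0, y; split; [exact: flow_at_zero|by rewrite mul1r in fy|].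
by rewrite subr0.
Qed.

Lemma M0_repulsiveP l :
  hyperbolic_repulsive sigma (h l) M0 <-> decaying sigma (fun w => - (a1 w + l)).
Proof.
split=> [[rho [k [g [rho0 k1 g0 H]]]]|/decaying_backward[k [d [d0 H]]]].
  apply/decaying_backward.
  exists (ln k), (g / 2); split => [|w s s0]; first by rewrite divr_gt0.
  apply: (decay_linear S (or_intror erefl) rho0 k1 g0) => // v x r xr r0.
  have Nr0 : - r <= 0 by rewrite oppr_le0.
  have [|y0 [y [f0 f yy]]] := H v 0 x erefl _ (- r) Nr0; first by rewrite subr0.
  rewrite (flow_at_uniq S f0 (flow_at_zero l (- r) v)) !subr0 mulrN -mulNr in yy.
  by exists y; rewrite ?mulN1r.
have [rho [k' [rho0 k1 H']]] := @small_decay_norm (- 1) l k d (or_intror erefl) d0 H.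
exists rho, k', d; split => // w x0 x; rewrite /M0 /graph_of/= => ->.
rewrite subr0 => xr t t0; have Nt0 : 0 <= - t by rewrite oppr_ge0.
have [y fy yk] := H' w x (- t) xr Nt0.
exists 0, y; split; [exact: flow_at_zero|by rewrite mulN1r opprK in fy|].
by rewrite subr0; rewrite mulrNN in yk.
Qed.

End ZeroHyperbolic.

(** * Positive solutions on the negative half-line *)

Section BackwardBounded.
Context {R : realType} {Omega : pointedMetricType R}.
Variables (sigma : R -> Omega -> Omega) (a1 a2 a3 : Omega -> R).
Local Notation C1 l := (orbit_int sigma (fun w => a1 w + l)).
Hypothesis S : cubic_setting sigma a1 a2 a3.
Implicit Types (l x t s k d : R) (w : Omega).
Let base := cubic_base S.
Let h := cubic_family a1 a2 a3.
Let up := upper sigma a1 a2 a3.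

(* The backward semiorbit of [w] is dense, so a bound along it propagates to the
   whole base. *)
Lemma backward_orbit_int_bound (b : Omega -> R) w k : continuous b ->
  (forall s t, s <= t <= 0 -> - k <= orbit_int sigma b w t - orbit_int sigma b w s) ->
  forall v T, 0 <= T -> - k - 1 <= orbit_int sigma b v T.
Proof.
move=> bc H v T T0.
have [U [[oU Uv] HU]] : exists U, open_nbhs v U /\ forall w', U w' ->
    orbit_int sigma b w' T < orbit_int sigma b v T + 1.
  have nv : nbhs v [set w' | orbit_int sigma b w' T < orbit_int sigma b v T + 1].
    exact: (@near_orbit_int _ _ _ base b v T 1 bc ltr01 T0).
  by move: nv; rewrite nbhsE/= => -[U Uv UH]; exists U.
have [T1 T10 visit] := visits base oU (ex_intro _ v Uv).
(* The start is so far back that [U] is visited at a time [s <= - T], and the window [[s, s + T]]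
   stays in the past. *)
have [t /andP[t0 tT] Ut] := visit (sigma (- (T + T1)) w).
pose s := t - (T + T1).
have Us : U (sigma s w) by move: Ut; rewrite -(flowD (base_flow base)).
have sT : s <= s + T <= 0 by rewrite lerDl T0/= /s; lra.
have := H _ _ sT; rewrite (orbit_intD base)// addrAC subrr add0r => h1.
by have := HU _ Us; lra.
Qed.

(** Comparing [v] at two past times bounds the integral of [a1 + l - eta] below by [- ln (B / kap)];
    the margin [eta] becomes the decay rate of [- (a1 + l)]. *)
Lemma backward_solution_decaying l eta kap B w (v v' : R -> R) : 0 < eta -> 0 < kap ->
  (forall t, t <= 0 -> is_derive t (1 : R) v (v' t)) ->
  (forall t, t <= 0 -> kap <= v t <= B) ->
  (forall t, t <= 0 -> v' t <= (a1 (sigma t w) + l - eta) * v t) ->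
  decaying sigma (fun w => - (a1 w + l)).
Proof.
move=> eta0 kap0 vd vB vv.
have cc := continuous_linear_coef S (l := l).
have ce : continuous (fun w => a1 w + l - eta) by exact: continuous_addc.
have B0 : 0 < B by have /andP[h1 h2] := vB 0 (lexx 0); exact: lt_le_trans kap0 (le_trans h1 h2).
have := @backward_orbit_int_bound (fun w => a1 w + l - eta) w (ln (B / kap)) ce.
move=> /(_ _) H; exists (ln (B / kap) + 1), eta; split => // u T T0.
rewrite (orbit_int_opp base)//.
have := H _ u T T0; rewrite (orbit_int_addc base)// => /(_ _) H'.
suff : - ln (B / kap) - 1 <= C1 l u T + - eta * T by lra.
apply: H' => s t /andP[st t0]; rewrite lerNl opprB.
have := @gronwall_le _ v v' (orbit_int sigma (fun w => a1 w + l - eta) w)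
  (fun s => a1 (sigma s w) + l - eta) s t st.
move=> /(_ _ _ _) G.
have {}G : v t <= v s * expR (orbit_int sigma (fun w => a1 w + l - eta) w t
    - orbit_int sigma (fun w => a1 w + l - eta) w s).
  apply: G => r /andP[_ rt]; have r0 := le_trans rt t0.
  - exact: vd.
  - exact: (is_derive_orbit_int base w r ce).
  - exact: vv.
have /andP[kt _] := vB t t0; have /andP[ks sB] := vB s (le_trans st t0).
set X := orbit_int _ _ _ t - _ in G *.
rewrite -opprB -/X -ler_expR lnK ?posrE ?divr_gt0// expRN.
rewrite -[leRHS]invf_div lef_pV2 ?posrE ?expR_gt0 ?divr_gt0// ler_pdivrMr//.
by rewrite mulrC (le_trans kt)// (le_trans G)// ler_wpM2r ?expR_ge0.
Qed.

(** The barrier replaces [a2 u + l] by [lp] in the growth rate, and where [u >= kap] the cubic term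
    contributes the margin [r kap^2]. *)
Lemma not_bounded_below_of_barrier l lp : ~ decaying sigma (fun w => - (a1 w + lp)) ->
  (forall w, a2 w * up l w + l <= lp) ->
  ~ exists w kap, 0 < kap /\ forall t, t <= 0 -> kap <= up l (sigma t w).
Proof.
move=> nd barrier [w [kap [kap0 H]]]; apply: nd.
have [r r0 ar] := leading_coefficient_gap S.
apply: (@backward_solution_decaying lp (r * kap ^+ 2) kap (radius a1 a2 a3 l) w
  (fun t => up l (sigma t w)) (fun t => h l (sigma t w) (up l (sigma t w)))) => //.
- by rewrite mulr_gt0// exprn_gt0.
- by move=> t _; exact: (is_derive_upper S).
- by move=> t t0; rewrite H// (upper_le_radius S).
move=> t t0; set u := up l _; set v := sigma t w; have ku : kap <= u by exact: H.
have u0 : 0 <= u by exact: le_trans (ltW kap0) ku.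
rewrite /h cubic_familyE ler_wpM2r// /cubic_rate.
have e1 : r * kap ^+ 2 <= a3 v * u ^+ 2.
  by apply: ler_pM; rewrite ?(ltW r0) ?sqr_ge0 ?ar// lerXn2r ?nnegrE// ltW.
by have := barrier v; rewrite -/u mulNr; lra.
Qed.

(** If [up l w > 0], the decay of [a1 + l], read backward in the reciprocal variable, keeps [up l]
    away from zero along the whole negative semiorbit, which the barrier forbids. *)
Lemma upper_eq0 l lp : ~ decaying sigma (fun w => - (a1 w + lp)) ->
  (forall w, a2 w * up l w + l <= lp) -> decaying sigma (fun w => a1 w + l) ->
  forall w, up l w = 0.
Proof.
move=> nd barrier [k [d [d0 H]]] w; apply: contrapT => u0; apply: (not_bounded_below_of_barrier nd barrier).
have {u0} u0 : 0 < up l w by rewrite lt_neqAle (upper_ge0 S) andbT eq_sym; apply/eqP.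
have cc := continuous_linear_coef S (l := l).
have [B B0 HB] := coefficient_bound S.
have upos t : 0 < up l (sigma t w).
  rewrite /up -(phi_upper S) -[ltLHS](phi_at0 S l t w (radius1_gt0 S l)).
  by apply: (phi_lt S) => //; exact: radius1_gt0 S l.
pose Y := (up l w)^-1 * expR k + B * expR k / d.
have Y0 : 0 < Y by rewrite ltr_pwDl ?mulr_gt0 ?invr_gt0 ?expR_gt0// divr_ge0 ?mulr_ge0 ?expR_ge0// ltW.
exists w, Y^-1; split => [|t t0]; first by rewrite invr_gt0.
pose v := sigma t w; pose T := - t; have T0 : 0 <= T by rewrite oppr_ge0.
pose u s := up l (sigma s v).
have ud s := is_derive_upper S l v s.
pose y' s := a3 (sigma s v) * u s - a2 (sigma s v) - (a1 (sigma s v) + l) / u s.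
have us s : 0 < u s by rewrite /u /v -(flowD (base_flow base)).
have yd s : is_derive s (1 : R) (fun s => (u s)^-1) (y' s).
  exact: (@is_derive_inv_solution _ _ sigma a1 a2 a3 l v u s (lt0r_neq0 (us s)) (ud s)).
have := @recip_growth _ (fun s => (u s)^-1) y' (C1 l v)
  (fun s => a1 (sigma s v) + l) B k d T T0 d0 (ltW B0) (orbit_int0 sigma _ _).
move=> /(_ _ _ _ _) G.
have {}G : (u 0)^-1 - B * expR k / d
    <= (u T)^-1 * expR (C1 l v T).
  apply: G => s /andP[s0 sT].
  - exact: (is_derive_orbit_int base v s cc).
  - have [h1 h2 h3] := HB (sigma s v).
    have e1 : 0 <= a3 (sigma s v) * u s by rewrite mulr_ge0// ltW// (cubic_a3_gt0 S).
    have e2 : a2 (sigma s v) <= B by rewrite (le_trans _ h2)// ler_norm.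
    by rewrite /y' (mulrC (_ + l)); lra.
  - exact: H.
have uT : u T = up l w by rewrite /u /v /T (sigmaK base).
have u0E : u 0 = up l v by rewrite /u (flow0 (base_flow base)).
rewrite uT u0E in G.
have : (up l v)^-1 <= Y.
  have : (up l w)^-1 * expR (C1 l v T)
      <= (up l w)^-1 * expR k.
    rewrite ler_wpM2l ?invr_ge0 ?(ltW u0)// ler_expR (le_trans (H _ _ T0))//.
    by rewrite gerBl mulr_ge0// ltW.
  by rewrite /Y; lra.
by move=> vY; rewrite -[leRHS]invrK lef_pV2 ?posrE// invr_gt0 upos.
Qed.

End BackwardBounded.

(** * Collision with zero *)

Section Collision.
Context {R : realType} {Omega : pointedMetricType R}.
Variables (sigma : R -> Omega -> Omega) (a1 a2 a3 : Omega -> R).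
Hypothesis S : cubic_setting sigma a1 a2 a3.
Implicit Types (l x t s : R) (w : Omega).
Let base := cubic_base S.
Let h := cubic_family a1 a2 a3.
Let up := upper sigma a1 a2 a3.

Lemma constant_le_upper l x w : 0 <= x ->
  (forall w, 0 <= cubic_rate a1 a2 a3 l w x) -> x <= up l w.
Proof.
move=> x0 H; apply: (@lower_solution_le_upper _ _ _ _ _ _ S l w (fun=> x) (fun=> 0) x).
- by move=> t; rewrite x0 lexx.
- by move=> t; rewrite cubic_familyE mulr_ge0.
Qed.

(** The orbit of the boundary was below the radius a time [T] ago, and the rate [- eta] has since
    brought it below [x]. *)
Lemma upper_le_barrier l x eta : 0 < x -> 0 < eta ->
  (forall w y, x <= y -> cubic_rate a1 a2 a3 l w y <= - eta) ->
  forall w, up l w <= x.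
Proof.
move=> x0 eta0 H w; have [T T0 small] := exp_decay_small (radius a1 a2 a3 l) eta0 x0.
pose N := x + radius a1 a2 a3 l; have r0 := radius_gt0 S l.
have N0 : 0 < N by rewrite addr_gt0.
have rN : radius a1 a2 a3 l <= N by rewrite lerDr ltW.
pose v := sigma (- T) w.
have := @bounded_complete_phi _ _ _ _ _ _ S N l v (fun t => up l (sigma t v)) T N0
  (is_derive_upper S l v).
rewrite /v (sigmaNK base) (flow0 (base_flow base)) -/v => ->; last first.
  by move=> s; rewrite (le_trans (norm_upper S _ _)).
apply: (le_trans (@phi_decay _ _ _ _ _ _ S N l x eta (radius a1 a2 a3 l) T v (up l v)
  x0 _ eta0 T0 H (ltW r0) (upper_le_radius S _ _) _)).
- by rewrite lerDl ltW.
- exact: le_trans (upper_le_radius S _ _) rN.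
by rewrite ge_max lexx ltW.
Qed.

Variable lp : R.

(** A Harnack-type estimate: for all these [l] the boundary is confined by the radius for [lp + 1],
    so its relative growth is bounded by one constant. *)
Lemma upper_growth : exists2 C, 0 <= C & forall l w t, lp < l <= lp + 1 -> 0 <= t ->
  up l (sigma t w) <= up l w * expR (C * t) /\
  up l w * expR (- C * t) <= up l (sigma t w).
Proof.
have [B B0 HB] := coefficient_bound S.
pose M := radius a1 a2 a3 (lp + 1); have M0 : 0 < M := radius_gt0 S (lp + 1).
pose C := B * M ^+ 2 + B * M + (B + (`|lp| + 1)).
have C0 : 0 <= C by rewrite !addr_ge0 ?mulr_ge0 ?sqr_ge0 ?(ltW B0) ?(ltW M0).
exists C => // l w t /andP[l1 l2] t0.
have rate_le s : `|cubic_rate a1 a2 a3 l (sigma s w) (up l (sigma s w))| <= C.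
  set u := up l _; set v := sigma s w; have [h1 h2 h3] := HB v.
  have uM : `|u| <= M.
    rewrite ger0_norm; last exact: (upper_ge0 S).
    exact: le_trans (upper_le S _ l2) (upper_le_radius S _ _).
  rewrite /cubic_rate (le_trans (ler_normD _ _))// lerD//; last first.
    rewrite (le_trans (ler_normD _ _))// lerD//.
    have : l <= `|lp| + 1 by have := ler_norm lp; lra.
    have : - (`|lp| + 1) <= l by have := ler_norm (- lp); rewrite normrN; lra.
    by rewrite ler_norml => -> ->.
  rewrite (le_trans (ler_normD _ _))// lerD// normrM ler_pM// ?normrN//.
  by rewrite normrX lerXn2r ?nnegrE ?(ltW M0).
have ud s := is_derive_upper S l w s.
have uu s : 0 <= up l (sigma s w) by exact: (upper_ge0 S).
have w0 : up l w = up l (sigma 0 w) by rewrite (flow0 (base_flow base)).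
rewrite w0 -[in C * t](subr0 t) -[in - C * t](subr0 t); split.
  apply: (@gronwall_const_le _ (fun s => up l (sigma s w))
    (fun s => h l (sigma s w) (up l (sigma s w)))) => // s _.
  by rewrite /h cubic_familyE ler_wpM2r// (le_trans (ler_norm _)).
apply: (@gronwall_const_ge _ (fun s => up l (sigma s w))
  (fun s => h l (sigma s w) (up l (sigma s w)))) => // s _.
rewrite /h cubic_familyE ler_wpM2r//.
by have := rate_le s; rewrite ler_norml => /andP[].
Qed.

Hypothesis lp_bottom : ~ decaying sigma (fun w => - (a1 w + lp)).
Hypothesis a2_le0 : forall w, a2 w <= 0.

Lemma barrier_nonpos l w : l <= lp -> a2 w * up l w + l <= lp.
Proof.
move=> llp; rewrite -[leRHS]add0r lerD// mulr_le0_ge0//.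
exact: (upper_ge0 S).
Qed.

(** For [l] so close to [lp] that [l - lp] uses only half of the cubic margin [r kap^2], the
    boundary would be a solution whose growth is forbidden at the endpoint. *)
Lemma upper_not_uniform kap : 0 < kap ->
  ~ (forall l w, lp < l <= lp + 1 -> kap <= up l w).
Proof.
move=> kap0 H; apply: lp_bottom.
have [r r0 ar] := leading_coefficient_gap S.
pose eta := r * kap ^+ 2; have eta0 : 0 < eta by rewrite mulr_gt0// exprn_gt0.
pose l := lp + Num.min 1 (eta / 2).
have l1 : lp < l <= lp + 1.
  by rewrite ltrDl lt_min ltr01 divr_gt0//= lerD2l ge_min lexx.
have l2 : l <= lp + eta / 2 by rewrite lerD2l ge_min lexx orbT.
have eta20 : 0 < eta / 2 by rewrite divr_gt0.
apply: (@backward_solution_decaying _ _ _ _ _ _ S lp (eta / 2) kap (radius a1 a2 a3 l)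
  point (fun t => up l (sigma t point))
  (fun t => h l (sigma t point) (up l (sigma t point)))) => //.
- by move=> t _; exact: (is_derive_upper S).
- by move=> t _; rewrite H// (upper_le_radius S).
move=> t _; set u := up l _; set v := sigma t point.
have ku : kap <= u by exact: H.
have u0 : 0 <= u by exact: le_trans (ltW kap0) ku.
rewrite /h cubic_familyE ler_wpM2r// /cubic_rate.
have e1 : eta <= a3 v * u ^+ 2.
  by apply: ler_pM; rewrite ?(ltW r0) ?sqr_ge0 ?ar// lerXn2r ?nnegrE// ltW.
have e2 : a2 v * u <= 0 by rewrite mulr_le0_ge0.
by rewrite mulNr; lra.
Qed.

Let small n : set Omega := [set w | exists l, lp < l /\ up l w < n.+1%:R^-1].

Let inv_gt0 n : 0 < n.+1%:R^-1 :> R. Proof. by rewrite invr_gt0. Qed.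

Lemma small_open n : open (small n).
Proof.
rewrite openE => w [l [l1 lw]]; apply: filterS (near_upper S lw) => w' lw'.
by exists l.
Qed.

(** If an open set missed [small n], the boundary would be at least [1 / (n + 1)] on it for every
    [l > lp]; each orbit reaches that set within time [T], so the growth estimate would bound the
    boundary below everywhere, uniformly in [l]. *)
Lemma small_dense n : dense (small n).
Proof.
move=> O O0 oO; apply: contrapT => nO.
have [T T0 visit] := visits base oO O0.
have [C C0 HC] := upper_growth.
apply: (@upper_not_uniform (n.+1%:R^-1 * expR (- C * T))).
  by rewrite mulr_gt0 ?expR_gt0.
move=> l w ll; have [t /andP[t0 tT] Ot] := visit w.
have big : n.+1%:R^-1 <= up l (sigma t w).
  rewrite leNgt; apply/negP => lt; apply: nO; exists (sigma t w); split => //.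
  by exists l; split => //; case/andP: ll.
have [h1 _] := HC l w t ll t0.
apply: (@le_trans _ _ (n.+1%:R^-1 * expR (- C * t))).
  by rewrite ler_wpM2l ?(ltW (inv_gt0 n))// ler_expR !mulNr lerN2 ler_wpM2l.
have := ler_wpM2r (expR_ge0 (- C * t)) (le_trans big h1).
rewrite -mulrA -expRD (_ : C * t + - C * t = 0); last by ring.
by rewrite expR0 mulr1.
Qed.

(** The boundary is nondecreasing in [l], so arbitrarily small values at some [l > lp] amount to
    convergence to 0 as [l] decreases to [lp]. *)
Let limit0 : set Omega := [set w | forall e : R, 0 < e -> exists l, lp < l /\ up l w < e].

Lemma limit0_time w t : limit0 w -> limit0 (sigma t w).
Proof.
move=> w0 e e0; have [C C0 HC] := upper_growth.
have E0 : 0 < e * expR (- C * `|t|) by rewrite mulr_gt0 ?expR_gt0.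
have [l [l1 lw]] := w0 _ E0.
pose l' := Num.min l (lp + 1).
have l'1 : lp < l' <= lp + 1 by rewrite lt_min l1 ltrDl ltr01 ge_min lexx orbT.
have l'w : up l' w < e * expR (- C * `|t|).
  by apply: le_lt_trans lw; apply: (upper_le S); rewrite ge_min lexx.
exists l'; split; first by case/andP: l'1.
suff h' : up l' (sigma t w) <= up l' w * expR (C * `|t|).
  apply: (le_lt_trans h').
  have -> : e = e * expR (- C * `|t|) * expR (C * `|t|).
    rewrite -mulrA -expRD (_ : - C * `|t| + C * `|t| = 0); last by ring.
    by rewrite expR0 mulr1.
  by rewrite ltr_pM2r ?expR_gt0.
have [t0|t0] := leP 0 t.
  by have [h1 _] := HC l' w t l'1 t0; rewrite ger0_norm.
have Nt0 : 0 <= - t by rewrite oppr_ge0 ltW.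
have [_] := HC l' (sigma t w) (- t) l'1 Nt0; rewrite (sigmaK base) ltr0_norm// => h2.
have := ler_wpM2r (expR_ge0 (C * - t)) h2.
rewrite -mulrA -expRD (_ : - C * - t + C * - t = 0); last by ring.
by rewrite expR0 mulr1.
Qed.

Lemma upper_collides : collide_from_right sigma up (fun _ _ => 0) lp.
Proof.
exists limit0; split.
- exists small; first by move=> n; split; [exact: small_open|exact: small_dense].
  move=> w Hw e e0.
  have [n ne] : exists n, n.+1%:R^-1 < e.
    exists (Num.bound e^-1).
    rewrite -[ltRHS]invrK ltf_pV2 ?posrE ?invr_gt0//.
    have e00 : 0 <= e^-1 by rewrite invr_ge0 ltW.
    by rewrite (lt_le_trans (archi_boundP e00))// ler_nat.
  have [l [l1 lw]] := Hw n I.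
  by exists l; split => //; exact: lt_trans ne.
- move=> t; apply/seteqP; split => w /=; last exact: limit0_time.
  by move=> Dw; have := @limit0_time (sigma t w) (- t) Dw; rewrite (sigmaK base).
move=> w Hw; apply/cvgrPdist_lt => e e0; have [l0 [l01 l0w]] := Hw e e0.
have : \forall l \near lp^'+, l < l0 by exact: nbhs_right_lt.
apply: filterS => l ll; rewrite subr0 sub0r normrN ger0_norm ?(upper_ge0 S)//.
by apply: le_lt_trans l0w; apply: (upper_le S); exact: ltW.
Qed.

End Collision.

(** * The reflection [x -> - x] on invariant and minimal sets *)

Section Reflection.
Context {R : realType} {Omega : pointedMetricType R}.
Variables (sigma : R -> Omega -> Omega) (a1 a2 a3 : Omega -> R).
Hypothesis S : cubic_setting sigma a1 a2 a3.
Implicit Types (l x t s : R) (w : Omega) (K : set (Omega * R)).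
Let h := cubic_family a1 a2 a3.
Let h' := cubic_family a1 (fun w => - a2 w) a3.

Lemma compact_invariant_reflect l K : compact_invariant sigma (h l) K ->
  compact_invariant sigma (h' l) (reflect_set K).
Proof.
move=> [[[w x] Kx] cK iK]; split.
- by exists (w, - x); rewrite /reflect_set/= opprK.
- exact: compact_reflect.
move=> v y Ky t; have [z fz Kz] := iK _ _ Ky t; exists (- z).
  by rewrite -[y]opprK; apply/(flow_at_reflect _ _ _ _ _ S).
by rewrite /reflect_set/= opprK.
Qed.

End Reflection.

Section ReflectionMinimal.
Context {R : realType} {Omega : pointedMetricType R}.
Variables (sigma : R -> Omega -> Omega) (a1 a2 a3 : Omega -> R).
Hypothesis S : cubic_setting sigma a1 a2 a3.
Implicit Types (l x t s : R) (w : Omega) (K : set (Omega * R)).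
Let h := cubic_family a1 a2 a3.
Let h' := cubic_family a1 (fun w => - a2 w) a3.

Lemma compact_invariant_reflectV l K : compact_invariant sigma (h' l) K ->
  compact_invariant sigma (h l) (reflect_set K).
Proof.
move=> /(compact_invariant_reflect (cubic_setting_opp S)).
by rewrite (_ : (fun w => - - a2 w) = a2)//; apply/funext => w; rewrite opprK.
Qed.

Lemma minimal_set_reflect l K : minimal_set sigma (h l) K ->
  minimal_set sigma (h' l) (reflect_set K).
Proof.
move=> [cK mK]; split; first exact: compact_invariant_reflect.
move=> K' cK' K'K; rewrite -[K']reflect_setK (mK (reflect_set K'))//.
  exact: compact_invariant_reflectV.
by move=> [w x] /K'K; rewrite /reflect_set/= opprK.
Qed.

Lemma minimal_set_reflectV l K : minimal_set sigma (h' l) K ->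
  minimal_set sigma (h l) (reflect_set K).
Proof.
move=> [cK mK]; split; first exact: compact_invariant_reflectV.
move=> K' cK' K'K; rewrite -[K']reflect_setK (mK (reflect_set K'))//.
  exact: compact_invariant_reflect.
by move=> [w x] /K'K; rewrite /reflect_set/= opprK.
Qed.

Lemma hyperbolic_attractive_reflectV l K : hyperbolic_attractive sigma (h' l) K ->
  hyperbolic_attractive sigma (h l) (reflect_set K).
Proof.
move=> [rho [k [g [rho0 k1 g0 H]]]]; exists rho, k, g; split => // w x0 x Kx xr t t0.
have [|y0 [y [f0 f yy]]] := H w (- x0) (- x) Kx _ t t0.
  by rewrite -opprD normrN.
exists (- y0), (- y); split.
- by apply/(flow_at_reflect _ _ _ _ _ S); rewrite opprK.
- by apply/(flow_at_reflect _ _ _ _ _ S); rewrite opprK.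
- by rewrite -opprD normrN (le_trans yy)// -opprD normrN.
Qed.

Lemma reflect_graph (b : Omega -> R) :
  reflect_set (graph_of b) = graph_of (fun w => - b w).
Proof.
apply/seteqP; split => -[w x]; rewrite /reflect_set /graph_of/=.
  by move=> <-; rewrite opprK.
by move=> ->; rewrite opprK.
Qed.

End ReflectionMinimal.

(** * Bifurcation diagrams *)

Definition upper_positive {R : realType} {Omega : pointedMetricType R}
    (sigma : R -> Omega -> Omega) (a1 a2 a3 : Omega -> R) (l : R) : Prop :=
  exists2 kap, 0 < kap & forall w, kap <= upper sigma a1 a2 a3 l w.

Section UpperSide.
Context {R : realType} {Omega : pointedMetricType R}.
Variables (sigma : R -> Omega -> Omega) (a1 a2 a3 : Omega -> R).
Hypothesis S : cubic_setting sigma a1 a2 a3.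
Variables lm lp : R.
Hypotheses (decay_lm : forall l, decaying sigma (fun w => a1 w + l) <-> l < lm)
  (decay_lp : forall l, decaying sigma (fun w => - (a1 w + l)) <-> lp < l).
Implicit Types (l x mu : R) (w : Omega) (K : set (Omega * R)).
Let base := cubic_base S.
Let h := cubic_family a1 a2 a3.
Let up := upper sigma a1 a2 a3.
Let positive := upper_positive sigma a1 a2 a3.

Lemma positive_above_lp l : lp < l -> exists2 mu, mu < l & positive mu.
Proof.
move=> ll; exists ((lp + l) / 2); first by lra.
by apply: (upper_bounded_below S); apply/decay_lp; lra.
Qed.

Lemma graph_upper_minimal mu l : mu < l -> positive mu ->
  [/\ minimal_set sigma (h l) (graph_of (up l)),
      hyperbolic_attractive sigma (h l) (graph_of (up l)) &
      positive_set (graph_of (up l))].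
Proof.
move=> ml [kap kap0 H]; split.
- exact: (minimal_graph_upper S ml kap0 H).
- exact: (hyperbolic_graph_upper S ml kap0 H).
move=> w x; rewrite /graph_of/= => ->; apply: lt_le_trans kap0 (le_trans (H w) _).
by apply: (upper_le S); exact: ltW.
Qed.

Lemma positive_minimal_is_graph mu l K : lm <= l -> mu < l -> positive mu ->
  minimal_set sigma (h l) K -> positive_set K -> K = graph_of (up l).
Proof.
move=> ll ml pm mK Kp; have [mG _ Gp] := graph_upper_minimal ml pm.
apply: (positive_minimal_unique S _ mK mG Kp Gp).
by move/decay_lm; rewrite ltNge ll.
Qed.

Lemma positive_minimal_positive l K :
  minimal_set sigma (h l) K -> positive_set K -> positive l.
Proof. by move=> [cK _] Kp; exact: (positive_invariant_upper S cK Kp). Qed.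

Lemma not_decay_lp : ~ decaying sigma (fun w => - (a1 w + lp)).
Proof. by move/decay_lp; rewrite ltxx. Qed.

Lemma not_positive_of_barrier l : (forall w, a2 w * up l w + l <= lp) -> ~ positive l.
Proof.
move=> barrier [kap kap0 H].
apply: (not_bounded_below_of_barrier S not_decay_lp barrier).
by exists point, kap; split => // t _; exact: H.
Qed.

Lemma upper_eq0_of_barrier l : l < lm -> (forall w, a2 w * up l w + l <= lp) ->
  forall w, up l w = 0.
Proof.
move=> ll barrier; apply: (upper_eq0 S not_decay_lp barrier).
exact/decay_lm.
Qed.

(** * Consequences of the two bounds on [a2] *)

Section Window.
Variables (A1 An r1 r2 lo hi X rho : R).
Hypotheses (lm_lp : lm < lp) (A1_lp : 0 < - lp - A1) (lm_An : 0 < An + lm)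
  (a1_bounds : forall w, A1 <= a1 w <= An) (r1_gt0 : 0 < r1)
  (a3_bounds : forall w, r1 <= a3 w <= r2)
  (X_gt0 : 0 < X) (X_def : r1 * X ^+ 2 = lp + An) (hi_X : hi * X = lp - lm)
  (rho_gt0 : 0 < rho) (rho_def : r2 * rho ^+ 2 = - lp - A1)
  (lo_rho : lo * rho = 2 * (- lp - A1))
  (a2_bounds : forall w, lo < a2 w < hi).

(** At height [rho] the value [lo] of [a2] just balances the worst case of the other terms at [lp];
    the uniform excess [e] over [lo] lets the parameter drop by [e rho]. *)
Lemma window_positive : exists2 l, l < lp & positive l.
Proof.
have [e e0 He] := @continuous_lt_gap _ _ _ base a2 lo (cubic_c2 S)
  (fun w => (andP (a2_bounds w)).1).
exists (lp - e * rho); first by rewrite gtrBl mulr_gt0.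
exists rho => // w; apply: (constant_le_upper S w (ltW rho_gt0)) => v.
have /andP[h1 _] := a1_bounds v; have /andP[_ h3] := a3_bounds v; have h2 := He v.
have e1 : a3 v * rho ^+ 2 <= - lp - A1 by rewrite -rho_def ler_wpM2r// sqr_ge0.
have e2 : (lo + e) * rho <= a2 v * rho by rewrite ler_wpM2r// ltW.
rewrite mulrDl lo_rho in e2.
by rewrite /cubic_rate mulNr; move: h1 e1 e2; lra.
Qed.

(** At [lm], with [a2] replaced by [hi], [a1] by [An] and [a3] by [r1], the growth rate vanishes at
    height [X]; so [up l] stays below [X], and [a2 up l <= hi X = lp - lm]. *)
Lemma window_barrier l w : l <= lm -> a2 w * up l w + l <= lp.
Proof.
move=> ll.
have [|e e0 He] := @continuous_lt_gap _ _ _ base (fun w => - a2 w) (- hi)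
  (continuous_oppf (cubic_c2 S)).
  by move=> v; rewrite ltrN2; case/andP: (a2_bounds v).
have hi0 : 0 < hi by rewrite -(pmulr_lgt0 _ X_gt0) hi_X subr_gt0.
have upX : forall w, up l w <= X.
  apply: (upper_le_barrier S (eta := e * X)) => //; first by rewrite mulr_gt0.
  move=> v y Xy; have y0 : 0 < y by exact: lt_le_trans Xy.
  have /andP[_ h1] := a1_bounds v; have /andP[h3 _] := a3_bounds v; have h2 := He v.
  have e1 : r1 * y ^+ 2 <= a3 v * y ^+ 2 by rewrite ler_wpM2r// sqr_ge0.
  have e2 : a2 v * y <= (hi - e) * y by rewrite ler_wpM2r ?(ltW y0)//; lra.
  have e3 : e * X <= e * y by rewrite ler_wpM2l// ltW.
  (* In the scaled height [z >= 1] the required inequality splits into the nonnegative products [e6]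
     and [e7]. *)
  pose z := y / X; have z1 : 1 <= z by rewrite ler_pdivlMr// mul1r.
  have yz : y = X * z by rewrite /z mulrC divfK// gt_eqF.
  have e4 : r1 * y ^+ 2 = (lp + An) * z ^+ 2 by rewrite yz exprMn mulrA X_def.
  have e5 : hi * y = (lp - lm) * z by rewrite yz mulrA hi_X.
  have e6 : 0 <= (lp - lm) * (z * (z - 1)).
    apply: mulr_ge0; first by rewrite subr_ge0 ltW.
    by rewrite mulr_ge0 ?subr_ge0// (le_trans ler01).
  have e7 : 0 <= (An + lm) * ((z - 1) * (z + 1)).
    apply: mulr_ge0; first exact: ltW.
    by rewrite mulr_ge0 ?subr_ge0// addr_ge0// (le_trans ler01).
  have e8 : (lp - lm) * (z * (z - 1)) + (An + lm) * ((z - 1) * (z + 1))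
      = (lp + An) * z ^+ 2 - (lp - lm) * z - (An + lm) by ring.
  rewrite /cubic_rate mulNr.
  have e9 : a2 v * y <= hi * y - e * y by move: e2; rewrite mulrBl.
  have e10 : 0 <= (lp + An) * z ^+ 2 - (lp - lm) * z - (An + lm).
    by rewrite -e8 addr_ge0.
  by rewrite e4 in e1; rewrite e5 in e9; move: h1 ll e1 e3 e9 e10; lra.
have u0 := upper_ge0 S l w.
have g1 : a2 w * up l w <= hi * up l w.
  by rewrite ler_wpM2r// ltW//; case/andP: (a2_bounds w).
have g2 : hi * up l w <= lp - lm by rewrite -hi_X ler_wpM2l// ltW.
by move: g1 g2 ll; lra.
Qed.

(** The threshold is the infimum of the parameters whose boundary is bounded away from zero: the
    barrier excludes those below [lm], and the constant lower solution provides one below [lp]. *)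
Lemma window_threshold : exists l0, [/\ lm <= l0 < lp,
  forall l, l < l0 -> ~ positive l &
  forall l, l0 < l -> exists2 mu, mu < l & positive mu].
Proof.
pose E : set R := [set l | positive l].
have Elm l : E l -> lm <= l.
  by move=> El; rewrite leNgt; apply/negP => ll;
    apply: (not_positive_of_barrier _ El) => w; apply: window_barrier; exact: ltW.
have [l1 l1p El1] := window_positive.
have infE : has_inf E by split; [exists l1|exists lm].
exists (inf E); split.
- apply/andP; split; first by apply: lb_le_inf; [exists l1|].
  by apply: le_lt_trans l1p; apply: (ge_inf infE.2).
- by move=> l ll El; move: ll; rewrite ltNge (ge_inf infE.2).
move=> l ll; have e0 : 0 < l - inf E by rewrite subr_gt0.
have [mu Emu mul] := inf_adherent e0 infE.
by exists mu => //; move: mul; rewrite addrC subrK.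
Qed.

End Window.

End UpperSide.

Section Diagram.
Context {R : realType} {Omega : pointedMetricType R}.
Variables (sigma : R -> Omega -> Omega) (a1 a2 a3 : Omega -> R).
Hypothesis S : cubic_setting sigma a1 a2 a3.
Variables lm lp : R.
Hypotheses (decay_lm : forall l, decaying sigma (fun w => a1 w + l) <-> l < lm)
  (decay_lp : forall l, decaying sigma (fun w => - (a1 w + l)) <-> lp < l).
Hypothesis lm_lp : lm < lp.
Implicit Types (l x mu : R) (w : Omega) (K : set (Omega * R)).
Let S' := cubic_setting_opp S.
Let h := cubic_family a1 a2 a3.
Let up := upper sigma a1 a2 a3.
Let low := lower sigma a1 a2 a3.
Let pos := upper_positive sigma a1 a2 a3.
Let neg := upper_positive sigma a1 (fun w => - a2 w) a3.

Lemma graph_lowerE l : graph_of (low l)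
  = reflect_set (graph_of (upper sigma a1 (fun w => - a2 w) a3 l)).
Proof. by rewrite reflect_graph. Qed.

Lemma graph_lower_minimal mu l : mu < l -> neg mu ->
  [/\ minimal_set sigma (h l) (graph_of (low l)),
      hyperbolic_attractive sigma (h l) (graph_of (low l)) &
      set_below (graph_of (low l)) M0].
Proof.
move=> ml nm; have [m1 m2 m3] := graph_upper_minimal S' ml nm; rewrite graph_lowerE; split.
- exact: (minimal_set_reflectV S).
- exact: (hyperbolic_attractive_reflectV S).
by move=> w x y Kx; rewrite /M0 /graph_of/= => ->; rewrite -oppr_gt0; exact: m3 Kx.
Qed.

Lemma positive_set_below K : positive_set K -> set_below M0 K.
Proof. by move=> Kp w x y; rewrite {1}/M0 /graph_of/= => -> Ky; exact: Kp Ky. Qed.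

Lemma negative_minimal_is_graph mu l K : lm <= l -> mu < l -> neg mu ->
  minimal_set sigma (h l) K -> positive_set (reflect_set K) -> K = graph_of (low l).
Proof.
move=> ll ml nm mK Kn; rewrite graph_lowerE -[K]reflect_setK; congr reflect_set.
apply: (positive_minimal_is_graph S' decay_lm ll ml nm) => //.
exact: (minimal_set_reflect S).
Qed.

Lemma negative_minimal_negative l K :
  minimal_set sigma (h l) K -> positive_set (reflect_set K) -> neg l.
Proof.
move=> mK Kn; apply: (positive_minimal_positive S' (K := reflect_set K)) => //.
exact: (minimal_set_reflect S).
Qed.

Lemma minimal_sets_zero l : ~ pos l -> ~ neg l -> minimal_sets sigma (h l) = [set M0].
Proof.
move=> np nn; apply/seteqP; split => [K mK|_ ->]; last exact: (minimal_M0 S).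
have [//|Kp|Kn] := minimal_trichotomy S mK.
  by case: np; exact: (positive_minimal_positive S mK Kp).
by case: nn; exact: negative_minimal_negative mK Kn.
Qed.

Lemma minimal_sets_upper mu l : lm <= l -> mu < l -> pos mu -> ~ neg l ->
  minimal_sets sigma (h l) = [set M0; graph_of (up l)].
Proof.
move=> ll ml pm nn; apply/seteqP; split => [K mK|_ [->|->]]; last 2 first.
- exact: (minimal_M0 S).
- by have [] := graph_upper_minimal S ml pm.
have [K0|Kp|Kn] := minimal_trichotomy S mK; first by left.
  by right; exact: (positive_minimal_is_graph S decay_lm ll ml pm mK Kp).
by case: nn; exact: negative_minimal_negative mK Kn.
Qed.

Lemma minimal_sets_lower mu l : lm <= l -> mu < l -> neg mu -> ~ pos l ->
  minimal_sets sigma (h l) = [set graph_of (low l); M0].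
Proof.
move=> ll ml nm np; apply/seteqP; split => [K mK|_ [->|->]]; last 2 first.
- by have [] := graph_lower_minimal ml nm.
- exact: (minimal_M0 S).
have [K0|Kp|Kn] := minimal_trichotomy S mK; first by right.
  by case: np; exact: (positive_minimal_positive S mK Kp).
by left; exact: (negative_minimal_is_graph ll ml nm mK Kn).
Qed.

Lemma pitchfork_common_holds :
  pitchfork_common sigma h lm lp (attractor_set sigma a1 a2 a3) low up.
Proof.
split.
- by move=> l; exact: (attractor_bounds S).
- by move=> l; exact: (minimal_M0 S).
- by move=> l ll; apply/(M0_attractiveP S)/decay_lm.
- move=> l /andP[l1 l2]; split.
    by move/(M0_attractiveP S)/decay_lm; rewrite ltNge l1.
  by move/(M0_repulsiveP S)/decay_lp; rewrite ltNge l2.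
- by move=> l ll; apply/(M0_repulsiveP S)/decay_lp.
move=> l ll; have lml : lm <= l by rewrite ltW// (lt_trans lm_lp).
have [mu1 ml1 p1] := positive_above_lp S decay_lp ll.
have [mu2 ml2 p2] := positive_above_lp S' decay_lp ll.
have [m1 h1 b1] := graph_upper_minimal S ml1 p1.
have [m2 h2 b2] := graph_lower_minimal ml2 p2.
exists (graph_of (low l)), (graph_of (up l)); split => //; last first.
  by split => //; exact: positive_set_below.
apply/seteqP; split => [K mK|_ [[->|->]|->]] //; last exact: (minimal_M0 S).
have [K0|Kp|Kn] := minimal_trichotomy S mK; first by left; right.
  by right; exact: (positive_minimal_is_graph S decay_lm lml ml1 p1 mK Kp).
by left; left; exact: (negative_minimal_is_graph lml ml2 p2 mK Kn).
Qed.

Lemma attractor_zero l : (forall w, up l w = 0) -> (forall w, low l w = 0) ->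
  attractor_set sigma a1 a2 a3 l = M0.
Proof.
move=> u0 l0; apply/seteqP; split => -[w x]; rewrite /attractor_set /M0 /graph_of/=.
  by rewrite -/(up l w) -/(low l w) u0 l0 => /le_anti.
by move=> ->; rewrite -/(up l w) -/(low l w) u0 l0 lexx.
Qed.

(** For [0 <= a2] the reflected equation has a nonpositive quadratic coefficient, so its barrier
    holds up to [lp]: there is no negative minimal set for [l <= lp], and the collision happens on
    the negative side. *)
Lemma GP_alpha_of_threshold l0 : (forall w, 0 <= a2 w) -> lm <= l0 < lp ->
  (forall l, l < l0 -> ~ pos l) -> (forall l, l0 < l -> exists2 mu, mu < l & pos mu) ->
  (forall l w, l < lm -> up l w = 0) -> GP_alpha sigma h lm lp.
Proof.
move=> a20 /andP[l01 l02] below above zero.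
have Na20 w : - a2 w <= 0 by rewrite oppr_le0.
have barrier l w : l <= lp ->
    - a2 w * upper sigma a1 (fun w => - a2 w) a3 l w + l <= lp.
  exact: (barrier_nonpos S' Na20).
have nneg l : l <= lp -> ~ neg l.
  by move=> ll; apply: (not_positive_of_barrier S' decay_lp) => w; exact: barrier.
exists (attractor_set sigma a1 a2 a3), low, up; split.
- exact: pitchfork_common_holds.
- exact: lm_lp.
- have [D [D1 D2 D3]] := upper_collides S' (not_decay_lp decay_lp) Na20.
  exists D; split => // w Dw; apply/cvgrPdist_lt => e e0.
  have near_lp : \forall l \near lp^'+,
      `|0 - (upper sigma a1 (fun w => - a2 w) a3 l w - 0)| < e.
    exact: (cvgr_dist_lt _ _ (D3 w Dw) e e0).
  apply: filterS near_lp => l.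
  by rewrite !subr0 !sub0r /low /lower !normrN.
exists l0; split.
- by rewrite l01.
- move=> l ll; apply: minimal_sets_zero; first exact: below.
  by apply: nneg; rewrite ltW// (lt_trans ll).
- move=> l ll; apply: attractor_zero => w; first exact: zero.
  rewrite /low /lower (upper_eq0_of_barrier S' decay_lm decay_lp ll) ?oppr0// => v.
  by apply: barrier; rewrite ltW// (lt_trans ll).
move=> l /andP[ll lle]; have [mu ml pm] := above l ll.
have [m1 h1 b1] := graph_upper_minimal S ml pm.
exists (graph_of (up l)); split => //.
  apply: (minimal_sets_upper _ ml pm); last exact: nneg.
  by rewrite (le_trans l01)// ltW.
exact: positive_set_below.
Qed.

Lemma GP_beta_of_threshold l0 : (forall w, a2 w <= 0) -> lm <= l0 < lp ->
  (forall l, l < l0 -> ~ neg l) -> (forall l, l0 < l -> exists2 mu, mu < l & neg mu) ->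
  (forall l w, l < lm -> low l w = 0) -> GP_beta sigma h lm lp.
Proof.
move=> a20 /andP[l01 l02] below above zero.
have barrier l w : l <= lp -> a2 w * up l w + l <= lp by exact: (barrier_nonpos S a20).
have npos l : l <= lp -> ~ pos l.
  by move=> ll; apply: (not_positive_of_barrier S decay_lp) => w; exact: barrier.
exists (attractor_set sigma a1 a2 a3), low, up; split.
- exact: pitchfork_common_holds.
- exact: lm_lp.
- by have := upper_collides S (not_decay_lp decay_lp) a20.
exists l0; split.
- by rewrite l01.
- move=> l ll; apply: minimal_sets_zero; last exact: below.
  by apply: npos; rewrite ltW// (lt_trans ll).
- move=> l ll; apply: attractor_zero => w; last exact: zero.
  apply: (upper_eq0_of_barrier S decay_lm decay_lp ll) => v.
  by apply: barrier; rewrite ltW// (lt_trans ll).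
move=> l /andP[ll lle]; have [mu ml nm] := above l ll.
have [m1 h1 b1] := graph_lower_minimal ml nm.
exists (graph_of (low l)); split => //.
apply: (minimal_sets_lower _ ml nm); last exact: npos.
by rewrite (le_trans l01)// ltW.
Qed.

End Diagram.

(** * Decay of the shifted coefficient in terms of the parameter *)

Section Exponents.
Context {R : realType} {Omega : pointedMetricType R}.
Variables (sigma : R -> Omega -> Omega) (a : Omega -> R).
Hypotheses (base : compact_minimal_flow sigma) (ac : continuous a).
Implicit Types l : R.

Lemma decaying_shiftP l :
  decaying sigma (fun w => a w + l) <-> l < - top_exponent sigma a.
Proof.
have := decay_ratesP base (- l) ac.
by under eq_fun do rewrite opprK; rewrite ltrNr.
Qed.

Lemma decaying_opp_shiftP l :
  decaying sigma (fun w => - (a w + l)) <-> top_exponent sigma (fun w => - a w) < l.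
Proof.
have := decay_ratesP base l (continuous_oppf ac).
by under eq_fun do rewrite -opprD.
Qed.

End Exponents.

(** [rho] is where [r2 x + Q / x] attains its minimum [2 sqrt (r2 Q)], and [X] is where
    [r1 x^2 = P]; the square roots of the statement are traded here for these polynomial
    relations. *)
Lemma sqrt_window {R : realType} (r1 r2 P Q d : R) : 0 < r1 -> 0 < r2 -> 0 < P -> 0 < Q ->
  let X := Num.sqrt (P / r1) in let rho := Num.sqrt (Q / r2) in
  [/\ 0 < X, r1 * X ^+ 2 = P, d * Num.sqrt r1 / Num.sqrt P * X = d &
  [/\ 0 < rho, r2 * rho ^+ 2 = Q & 2 * Num.sqrt (r2 * Q) * rho = 2 * Q]].
Proof.
move=> r10 r20 P0 Q0 X rho; split.
- by rewrite sqrtr_gt0 divr_gt0.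
- by rewrite /X sqr_sqrtr ?divr_ge0 ?ltW// mulrC divfK// gt_eqF.
- rewrite /X sqrtrM ?(ltW P0)// sqrtrV ?(ltW r10)//; field.
  by rewrite !gt_eqF ?sqrtr_gt0.
split.
- by rewrite sqrtr_gt0 divr_gt0.
- by rewrite /rho sqr_sqrtr ?divr_ge0 ?ltW// mulrC divfK// gt_eqF.
rewrite -mulrA -sqrtrM ?mulr_ge0 ?ltW//.
have -> : r2 * Q * (Q / r2) = Q ^+ 2 by field; rewrite gt_eqF.
by rewrite sqrtr_sqr ger0_norm// ltW.
Qed.

Section Sides.
Context {R : realType} {Omega : pointedMetricType R}.
Variables (sigma : R -> Omega -> Omega) (a1 a2 a3 : Omega -> R).
Hypothesis S : cubic_setting sigma a1 a2 a3.
Variables lm lp A1 An r1 r2 : R.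
Hypotheses (decay_lm : forall l, decaying sigma (fun w => a1 w + l) <-> l < lm)
  (decay_lp : forall l, decaying sigma (fun w => - (a1 w + l)) <-> lp < l)
  (lm_lp : lm < lp) (A1_lp : A1 < - lp) (lm_An : - lm < An)
  (a1_bounds : forall w, A1 <= a1 w <= An) (r1_gt0 : 0 < r1)
  (a3_bounds : forall w, r1 <= a3 w <= r2).

Let lo := 2 * Num.sqrt (r2 * (- lp - A1)).
Let hi := (lp - lm) * Num.sqrt r1 / Num.sqrt (lp + An).

Lemma window_diagram : (forall w, lo < a2 w < hi) ->
  (forall w, 0 <= a2 w) /\
  exists l0, [/\ lm <= l0 < lp,
    forall l, l < l0 -> ~ upper_positive sigma a1 a2 a3 l,
    forall l, l0 < l -> exists2 mu, mu < l & upper_positive sigma a1 a2 a3 mu &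
    forall l w, l < lm -> upper sigma a1 a2 a3 l w = 0].
Proof.
move=> window; have lo0 : 0 <= lo by rewrite mulr_ge0 ?sqrtr_ge0.
split=> [w|]; first by case/andP: (window w) => lw _; rewrite ltW// (le_lt_trans lo0).
have r20 : 0 < r2 by case/andP: (a3_bounds point) => h1 h2; exact: lt_le_trans (le_trans h1 h2).
have Q0 : 0 < - lp - A1 by rewrite subr_gt0.
have Am0 : 0 < An + lm by rewrite -[lm]opprK subr_gt0.
have P0 : 0 < lp + An by move: Am0 lm_lp; lra.
have [X0 XP hX [rho0 rhoQ lorho]] := sqrt_window (lp - lm) r1_gt0 r20 P0 Q0.
have [l0 [l01 l02 l03]] := window_threshold S decay_lp lm_lp Am0
  a1_bounds a3_bounds X0 XP hX rho0 rhoQ lorho window.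
exists l0; split => // l w ll.
apply: (upper_eq0_of_barrier S decay_lm decay_lp ll) => v.
by apply: (window_barrier S lm_lp Am0 a1_bounds a3_bounds X0 XP hX window); exact: ltW.
Qed.

End Sides.
Theorem proposition4p11 (R : realType) (Omega : pointedMetricType R)
    (sigma : R -> Omega -> Omega)
    (Omega_compact : compact [set: Omega])
    (sigma_flow : continuous_flow sigma)
    (sigma_minimal : minimal_flow sigma)
    (n : nat) (hn : (1 < n)%N)
    (m : 'I_n -> probability (borel Omega) R)
    (m_ergodic : forall i, ergodic_measure sigma (m i))
    (m_distinct : forall i j, i != j -> distinct_measures (m i) (m j))
    (r eps : R) (r_ge1 : 1 <= r) (eps_gt0 : 0 < eps)
    (eps_lt : eps < epsilon1 n r)
    (c : 'I_n -> Omega -> R)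
    (c_continuous : forall i, continuous (c i))
    (c_itv : forall i w, 0 <= c i w <= 1)
    (c_min : forall i, exists w, c i w = 0)
    (c_max : forall i, exists w, c i w = 1)
    (c_disjoint : forall i j, i != j -> forall w, c i w * c j w = 0)
    (c_int_diag : forall i, 1 - eps < \int[m i]_w c i w <= 1)
    (c_int_offdiag : forall i j, i != j -> 0 <= \int[m j]_w c i w < eps)
    (alpha : 'I_n -> R)
    (alpha_nondecreasing : forall i j : 'I_n, (i <= j)%N -> alpha i <= alpha j)
    (alpha_first : alpha (first_idx hn) < 0)
    (alpha_last : 0 < alpha (last_idx hn))
    (a1 : Omega -> R)
    (a1_def : forall w, a1 w = \sum_(i < n) alpha i * c i w) :
  let alpha1 := alpha (first_idx hn) in
  let alphan := alpha (last_idx hn) in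
  eps < n%:R^-1 /\
  (forall w, alpha1 <= a1 w <= alphan) /\
  exists lm lp : R,
    [/\ lm < lp,
        spectrum sigma a1 = `[- lp, - lm]%classic,
        `[- lp, - lm]%classic `<=` `]alpha1, alphan[%classic,
        0 < (lp - lm) ^+ 2 + 4 * r * (lp + alpha1) * (lp + alphan) &
        forall (r1 r2 : R) (a2 a3 : Omega -> R),
          0 < r1 -> r2 = r * r1 ->
          continuous a3 -> (forall w, r1 <= a3 w <= r2) ->
          continuous a2 ->
          let lo := 2 * Num.sqrt (r2 * (- lp - alpha1)) in
          let hi := (lp - lm) * Num.sqrt r1 / Num.sqrt (lp + alphan) in
          (forall w, lo < a2 w < hi) \/ (forall w, - hi < a2 w < - lo) ->
          generalized_pitchfork sigma (cubic_family a1 a2 a3) lm lp].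
Proof.
move=> alpha1 alphan.
have base : compact_minimal_flow sigma by split.
have a1E : a1 = plateau_sum c alpha by apply/funext => w; exact: a1_def.
have m_inv i : invariant_measure sigma (m i) by have [] := m_ergodic i.
have ac : continuous a1 by rewrite a1E; exact: continuous_plateau_sum.
have a1_bounds w : alpha1 <= a1 w <= alphan.
  by rewrite a1E; exact: plateau_sum_bounds.
have [eps1 _] := epsilon1_gap hn r_ge1 eps_gt0 eps_lt.
split.
  rewrite -[ltRHS]mul1r ltr_pdivlMr; first by rewrite mulrC.
  by rewrite ltr0n ltnW.
split=> //.
pose lm := - top_exponent sigma a1; pose lp := top_exponent sigma (fun w => - a1 w).
have [lm_lp A1_lp lm_An gap] : [/\ lm < lp, alpha1 < - lp, - lm < alphan &
    0 < (lp - lm) ^+ 2 + 4 * r * (lp + alpha1) * (lp + alphan)].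
  rewrite /lm /lp a1E.
  exact: (band_endpoints base m_inv r_ge1 eps_gt0 eps_lt c_continuous c_itv c_max
    c_disjoint c_int_diag c_int_offdiag alpha_nondecreasing alpha_first alpha_last).
exists lm, lp; split => //.
- rewrite (spectrum_itv base ac) -/lp.
  by have -> : top_exponent sigma a1 = - lm by rewrite opprK.
- move=> x; rewrite /= !in_itv/= => /andP[x1 x2].
  by rewrite (lt_le_trans A1_lp)//= (le_lt_trans x2).
move=> r1 r2 a2 a3 r1_gt0 r2E a3c a3_bounds a2c lo hi window.
have S : cubic_setting sigma a1 a2 a3.
  by split => // w; case/andP: (a3_bounds w) => h _; exact: lt_le_trans h.
have decay_lm := decaying_shiftP base ac.
have decay_lp := decaying_opp_shiftP base ac.
case: window => [window|window]; [left|right].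
  have [a2_ge0 [l0 [l01 l02 l03 l04]]] := window_diagram S decay_lm decay_lp lm_lp
    A1_lp lm_An a1_bounds r1_gt0 a3_bounds window.
  exact: (GP_alpha_of_threshold S decay_lm decay_lp lm_lp a2_ge0 l01 l02 l03 l04).
(* The second window for [a2] is the first one for [- a2], so the threshold is found on the
   reflected equation. *)
have window' w : lo < - a2 w < hi.
  by have /andP[h1 h2] := window w; rewrite ltrNr h2 ltrNl h1.
have [a2_le0 [l0 [l01 l02 l03 l04]]] := window_diagram (cubic_setting_opp S) decay_lm
  decay_lp lm_lp A1_lp lm_An a1_bounds r1_gt0 a3_bounds window'.
apply: (GP_beta_of_threshold S decay_lm decay_lp lm_lp _ l01 l02 l03) => [w|l w ll].
  by rewrite -oppr_ge0.
by rewrite /lower l04// oppr0.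
Qed.
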